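(* Let $\alpha\in(0,1)$, let $\beta_0,\beta_1\in\mathbb{R}$ satisfy $\beta_0\beta_1\ge 0$ and $\beta_1\neq 0$, let $\kappa\in(0,1)$ and $\omega:=(0,\kappa)$. Then for all $T>0$ and $\tau\in(0,T)$ the impulsive system $$\begin{cases}\partial_t y-(x^\alpha y_x)_x=0 & \text{in }(0,1)\times\big((0,T)\setminus\{\tau\}\big),\\ y(x,\tau)=y(x,\tau^-)+1_\omega(x)h(x) & x\in(0,1),\\ \beta_0y(0,t)-\beta_1(x^\alpha y_x)(0,t)=0 & t\in(0,T),\\ y(1,t)=0 & t\in(0,T),\\ y(x,0)=y_0(x) & x\in(0,1),\end{cases}$$ is approximately impulse controllable at time $T$, that is: for all $y_0,y_T\in L^2(0,1)$ and every $\epsilon>0$ there is a control $h\in L^2(\omega)$ such that the associated solution satisfies $\|y(\cdot,T)-y_T\|\le\epsilon\|y_0\|$. In addition, there exist constants $\mathcal{C}>0$ and $\beta>0$ such that the observability estimate $$\|u(\cdot,S)\|^2\le\left(\frac{e^{\mathcal{C}\left(1+\frac1S\right)}}{\epsilon^{\beta}}\right)^2\|u(\cdot,S)\|_{L^2(\omega)}^2+\epsilon^2\|u(\cdot,0)\|^2$$ holds for all $S>0$, all $\epsilon>0$ and all $u_0\in L^2(0,1)$, where $u(\cdot,t)=e^{t\mathcal{A}}u_0$; and, with any such constants $\mathcal{C},\beta$, for all $T>0$, $\tau\in(0,T)$ and $\epsilon>0$ the cost of null approximate impulse control at time $T$ satisfies $$\mathcal{P}(T,\epsilon)\le\frac{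1}{\epsilon^{\beta}}\,e^{\mathcal{C}\left(1+\frac{1}{T-\tau}\right)}.$$
   Context: $\|\cdot\|$ denotes the norm of the real Hilbert space $L^2(0,1)$. Define $H^1_\alpha(0,1)=\{u\in L^2(0,1): u \text{ absolutely continuous on }[0,1],\ x^{\alpha/2}u_x\in L^2(0,1),\ u(1)=0\}$ and $H^2_\alpha(0,1)=\{u\in H^1_\alpha(0,1): x^\alpha u_x\in H^1(0,1)\}$. Let $\mathcal{A}u=(x^\alpha u_x)_x$ with domain $D(\mathcal{A})=\{u\in H^2_\alpha(0,1): \beta_0u(0)-\beta_1(x^\alpha u_x)(0)=0\}$. It is known that $\mathcal{A}$ is self-adjoint with dense domain and generates a strongly continuous semigroup of contractions $(e^{t\mathcal{A}})_{t\ge0}$ on $L^2(0,1)$. For $y_0\in L^2(0,1)$ and $h\in L^2(\omega)$, the solution of the impulsive system is the mild solution $y(\cdot,t)=e^{t\mathcal{A}}y_0+\mathbf{1}_{\{t\ge\tau\}}e^{(t-\tau)\mathcal{A}}(1_\omega h)$, where $1_\omega h$ is the extension of $h$ by zero to $(0,1)$; $y(\cdot,\tau^-)$ denotes the left limit at $\tau$. Null approximate impulse controllability at time $T$ means that for every $\epsilon>0$ and $y_0\in L^2(0,1)$ there is $h\in L^2(\omega)$ such that the associated solution satisfies $\|y(\cdot,T)\|\le\epsilon\|y_0\|$. The associated cost is defined as follows: for $\epsilon>0$ and $y_0\in L^2(0,1)$ let $\mathcal{R}_{T,\epsilon,y_0}=\{h\in L^2(\omega): \text{the solution } y \text{ of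 the impulsive system satisfies }\|y(\cdot,T)\|\le\epsilon\|y_0\|\}$, and $$\mathcal{P}(T,\epsilon)=\sup_{\|y_0\|=1}\ \inf_{h\in\mathcal{R}_{T,\epsilon,y_0}}\|h\|_{L^2(\omega)}.$$
   Formalization: For y_0 = 0 the bound ε‖y_0‖ would require reaching y_T exactly, which is impossible for a discontinuous y_T; in that case the proved bound is ‖y(·,T) − y_T‖ ≤ ε, while for y_0 ≠ 0 the bound is as stated. *)

(* Defs.v *)
From HB Require Import structures.
From mathcomp Require Import all_boot all_order all_algebra.
From mathcomp Require Import all_classical all_reals all_analysis.
From mathcomp Require Import measurable_realfun.

Set Implicit Arguments.
Unset Strict Implicit.
Unset Printing Implicit Defensive.
Import Order.TTheory GRing.Theory Num.Theory.
Import numFieldNormedType.Exports.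
Local Open Scope classical_set_scope.
Local Open Scope ring_scope.

Section L2.
Context {R : realType}.
Implicit Types a b c d : R.

(* Lebesgue measure on (a,b), as a measure on the line. *)
Definition leb a b : {measure set (measurableTypeR R) -> \bar R} :=
  mrestr lebesgue_measure (measurable_itv `]a, b[).

(* Representatives of the classes of L^2(a,b): Borel functions on the whole
   line, of which only the restriction to (a,b) matters.  Two of them denote
   the same class when they are equal [%[ae leb a b]]. *)
Definition L2 a b := LfunType (leb a b) (lee1n 2).

(* The norm of L^2(a,b); [fine] is harmless when f is square integrable
   on (a,b). *)
Definition L2norm a b (f : R -> R) : R :=
  fine ('N[leb a b]_2%:E [EFin \o f])%E.

Lemma extend0_Lfun c d a b (h : L2 a b) :
  (fun x => \1_`]a, b[ x * h x) \in Lfun (leb c d) 2%:E.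
Proof.
have mD : measurable (`]a, b[ : set (measurableTypeR R)).
  exact: measurable_itv.
have mh : measurable_fun setT (h : measurableTypeR R -> R) by [].
have mhD : measurable_fun setT
    ((fun x => \1_`]a, b[ x * h x) : measurableTypeR R -> R).
  by apply: measurable_funM => //; exact: measurable_indic.
have mg2 (u : measurableTypeR R -> R) : measurable_fun setT u ->
    measurable_fun setT (EFin \o (fun x => `|u x| `^ 2)).
  move=> mu; apply/measurable_EFinP.
  apply: (measurableT_comp (measurable_powR _)) => //.
  exact: measurableT_comp.
apply/andP; split; rewrite inE//= /finite_norm unlock poweR_lty//.
pose m1 : {measure set (measurableTypeR R) -> \bar R} :=
  mrestr lebesgue_measure mD.
pose m2 : {measure set (measurableTypeR R) -> \bar R} :=
  mrestr lebesgue_measure (measurableC mD).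
have hfin : (\int[leb a b]_x (`|(h x)%:E| `^ 2) < +oo)%E.
  have := @Lfunction_finite _ _ _ _ _ (lee1n 2) h.
  by rewrite /finite_norm unlock => /lty_poweRy; apply; rewrite invr_neq0.
apply: le_lt_trans hfin.
apply: (@le_trans _ _
  (\int[measure_add m1 m2]_x (`|(\1_`]a, b[ x * h x)%:E| `^ 2))%E).
  apply: ge0_le_measure_integral => //; last exact: mg2.
    move=> S mS; suff : (leb c d S <= m1 S + m2 S)%E by rewrite -(measure_addE m1 m2 S).
    rewrite /leb /m1 /m2 /= /mrestr.
    rewrite -measureU; first last.
    - by rewrite setIACA setICr setI0.
    - by apply: measurableI => //; exact: measurableC.
    - exact: measurableI.
    rewrite -setIUr setUCr setIT; apply: le_measure; rewrite ?inE//.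
    by apply: measurableI => //; exact: measurable_itv.
  by move=> x; exact: poweR_ge0.
rewrite ge0_integral_measure_add//; first last.
- exact: mg2.
- by move=> x _; exact: poweR_ge0.
rewrite [X in (_ + X)%E](_ : _ = 0%E) ?adde0.
  apply: ge0_le_integral => //.
  - by move=> x _; exact: poweR_ge0.
  - exact: mg2.
  - exact: mg2.
  - move=> x _; rewrite indicE; case: (x \in _); rewrite ?mul1r// mul0r.
    by rewrite abse0 poweR0r// poweR_ge0.
rewrite (ae_eq_integral (cst 0%E))//; first by rewrite integral0.
- exact: mg2.
- exists `]a, b[%classic; split => //; first by rewrite /m2 /= /mrestr setICr measure0.
  move=> x /= /not_implyP[_ /eqP]; rewrite indicE; case: (boolP (x \in _)).
    by rewrite inE.
  by rewrite mul0r normr0 /= powR0 ?pnatr_eq0// eqxx.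
Qed.

(* 1_(a,b) h, the extension by zero of h, as an element of L^2(c,d). *)
Definition extend0 c d a b (h : L2 a b) : L2 c d :=
  Lfun_Sub (lee1n 2) (extend0_Lfun c d h).

End L2.

Section degenerate_operator.
Context {R : realType}.
Implicit Types (a b alpha : R) (U V W G : R -> R).

Definition abs_continuous a b U : Prop :=
  forall e : R, 0 < e -> exists2 d : R, 0 < d &
    forall (n : nat) (x y : 'I_n -> R),
      (forall i, [/\ a <= x i, x i <= y i & y i <= b]) ->
      trivIset setT (fun i => `]x i, y i[%classic) ->
      \sum_i (y i - x i) < d -> \sum_i `|U (y i) - U (x i)| < e.

(* V is a version of the derivative U_x on (0,1). *)
Definition ae_derivative U V : Prop :=
  {ae leb 0 1, forall x : R, is_derive x (1 : R) U (V x)}.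

(* U is the absolutely continuous representative of an element of H^1(0,1),
   and G a version of its derivative. *)
Definition H1 U G : Prop :=
  [/\ abs_continuous 0 1 U, ae_derivative U G & G \in Lfun (leb 0 1) 2%:E].

(* Idem for H^1_alpha(0,1), with V a version of U_x. *)
Definition H1alpha alpha U V : Prop :=
  [/\ abs_continuous 0 1 U, ae_derivative U V,
      (fun x => x `^ (alpha / 2) * V x) \in Lfun (leb 0 1) 2%:E & U 1 = 0].

(* Idem for H^2_alpha(0,1): W is the continuous representative of
   x^alpha U_x, which gives its meaning to (x^alpha U_x)(0), and G is a
   version of (x^alpha U_x)_x. *)
Definition H2alpha alpha U V W G : Prop :=
  [/\ H1alpha alpha U V,
      {ae leb 0 1, forall x : R, W x = x `^ alpha * V x} & H1 W G].

(* The graph of the operator: u belongs to its domain and is mapped to f. *)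
Definition opA alpha (beta0 beta1 : R) (u f : L2 (0 : R) 1) : Prop :=
  exists U V W : R -> R,
    [/\ {ae leb 0 1, forall x : R, u x = U x},
        H2alpha alpha U V W f & beta0 * U 0 - beta1 * W 0 = 0].

End degenerate_operator.

Section semigroup.
Context {R : realType}.
Notation L2 := (L2 (0 : R) 1).
Notation norm := (L2norm (0 : R) 1).

(* Strongly continuous semigroups of linear contractions of L^2(0,1).
   Identities hold in L^2(0,1), that is, between representatives up to a
   null set; E t is unconstrained for t < 0. *)
Record contraction_semigroup (E : R -> L2 -> L2) : Prop := {
  sg_linear : forall t (k : R) (f g : L2), 0 <= t ->
    {ae leb 0 1, forall x : R, E t (k *: f + g) x = k * E t f x + E t g x} ;
  sg_0 : forall f : L2, {ae leb 0 1, forall x : R, E 0 f x = f x} ;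
  sg_D : forall (s t : R) (f : L2), 0 <= s -> 0 <= t ->
    {ae leb 0 1, forall x : R, E (s + t) f x = E s (E t f) x} ;
  sg_contraction : forall t (f : L2), 0 <= t -> norm (E t f) <= norm f ;
  sg_continuous : forall f : L2, norm (E t f - f) @[t --> 0^'+] --> (0 : R) }.

(* The (unbounded) operator with graph A is the infinitesimal generator of
   E, that is, E t = e^{tA}. *)
Definition is_generator (A : L2 -> L2 -> Prop) (E : R -> L2 -> L2) : Prop :=
  forall u f : L2, A u f <->
    norm (t^-1 *: (E t u - u) - f) @[t --> 0^'+] --> (0 : R).

End semigroup.

Section impulse_control.
Context {R : realType}.
Variables (kappa : R) (E : R -> L2 (0 : R) 1 -> L2 (0 : R) 1).
Notation omega_norm := (L2norm 0 kappa).
Notation norm := (L2norm (0 : R) 1).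
Implicit Types (tau t T eps C beta : R).

(* Mild solution of the impulsive system, the control acting on
   omega = (0,kappa) at time tau. *)
Definition mild_solution tau (y0 : L2 (0 : R) 1) (h : L2 0 kappa) t : L2 (0 : R) 1 :=
  E t y0 + (if tau <= t then E (t - tau) (extend0 0 1 h) else 0).

(* When y0 is the zero class the bound eps * norm y0 would prescribe the
   final state exactly; eps itself is used instead. *)
Definition approx_impulse_controllable tau T : Prop :=
  forall (y0 yT : L2 (0 : R) 1) eps, 0 < eps ->
    exists h : L2 0 kappa,
      norm (mild_solution tau y0 h T - yT) <=
        eps * (if norm y0 == 0 then 1 else norm y0).

(* Observability estimate, with u = e^{tA} u0. *)
Definition observability C beta : Prop :=
  forall (S eps : R) (u0 : L2 (0 : R) 1), 0 < S -> 0 < eps ->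
    norm (E S u0) ^+ 2 <=
      (expR (C * (1 + S^-1)) / eps `^ beta) ^+ 2 * omega_norm (E S u0) ^+ 2
      + eps ^+ 2 * norm u0 ^+ 2.

Definition null_controls tau T eps (y0 : L2 (0 : R) 1) : set (L2 0 kappa) :=
  [set h | norm (mild_solution tau y0 h T) <= eps * norm y0].

(* The infimum is +oo when there is no admissible control. *)
Definition control_cost tau T eps : \bar R :=
  ereal_sup [set ereal_inf [set (omega_norm h)%:E | h in null_controls tau T eps y0]
            | y0 in [set y0 : L2 (0 : R) 1 | norm y0 = 1]].

End impulse_control.

(* Main.v *)
Require Import Defs.
From mathcomp Require Import all_boot all_order all_algebra.
From mathcomp Require Import all_classical all_reals all_analysis.
From mathcomp Require Import measurable_realfun.
From mathcomp Require Import ring lra zify.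

Set Implicit Arguments.
Unset Strict Implicit.
Unset Printing Implicit Defensive.
Import Order.TTheory GRing.Theory Num.Theory.
Import numFieldNormedType.Exports.
Local Open Scope classical_set_scope.
Local Open Scope ring_scope.

(** Everything rests on the observability estimate, which is a quantitative form
of analyticity. Green's formula makes the generator [A] symmetric ([opA_sym]), so
that the semigroup is symmetric, hence smoothing: [A ^ j E S u0] is bounded by
[(j / S) ^ j <= (2 * j)! * exp (1 / S)] times the norm of [u0]
([ws_smoothing_iter], [power_fact_exp]). An element [u] of the domain and its flux
[W = x ^ alpha u_x] satisfy [u' = x ^ (- alpha) W] and [W' = A u], so that the
iterates of [A] control all the derivatives of [u] away from [0]; the [m]-th
derivative of [E S u0] on [(kappa / 4, 1)] is at most [B m! tau ^ m], with [B]
proportional to [exp (1 / S)] ([analytic_chain]). Such a function propagates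
smallness: interpolating it at [n] equidistant points of an interval where it is
small bounds it at distance [1 / (4 tau)] further, with a loss [16 ^ n] and an error
[2 ^ (- n) B], and finitely many steps lead from [(0, kappa)] to [1]
([lagrange_remainder], [propagation]). Therefore, for each [n],
<<
  |E S u0| <= C1 2 ^ (p n) |E S u0|_omega + C2 exp (1 / S) 2 ^ (- n) |u0|
>>
([orbit_estimate]), and choosing [n] of the order of [log (exp (1 / S) / eps)]
yields the observability estimate, with a power of [eps] ([orbit_observability]).

Controls are obtained by duality. If [z] solves
[e ^ 2 z + K ^ 2 E s (1_omega E s z) = E s g], the control [- K ^ 2 1_omega E s z]
steers [g] to [e ^ 2 z] in time [s], and observability with constants [K] and [e],
tested on [z] itself, bounds [e |z|] and [K |E s z|_omega] by the norm of [g]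
([null_control]). The equation is solved up to an arbitrarily small error by a
fixed point iteration; giving up a little of [eps] absorbs this error, which proves
the bound on the cost. Arbitrary targets are reached because the range of
[E s] is dense ([ws_range_dense]) and its elements [E s g] are the targets of null
controls ([approx_control]).

Symmetry of the semigroup and regularity of all the orbits both require that the
domains of the powers of [A] be dense. This is witnessed by the functions
[x ^ s P(x) ((x - a)(b - x))_+ ^ m], a family which [A] preserves up to a decrease
of [m] and whose closed span contains the indicators of intervals ([bump_opA],
[dense_bumps]). *)

(** * Semi-inner products *)

Lemma geometric_lt (R : realType) (q d : R) : 0 <= q < 1 -> 0 < d ->
  exists n, q ^+ n < d.
Proof.
move=> /andP[q0 q1] d0; have := @cvg_expr R q; rewrite ger0_norm// => /(_ q1).
move=> /cvgr0Pnorm_lt /(_ d d0) [n _ /(_ n (leqnn n))] /=.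
by rewrite ger0_norm ?exprn_ge0//; exists n.
Qed.

Lemma scaled_half_le (R : realType) (k e : R) : 0 < e ->
  `|k| * (e / (2 * (`|k| + 1))) <= e / 2.
Proof.
move=> e0; have k0 : 0 < 2 * (`|k| + 1) by rewrite mulr_gt0// ltr_wpDl.
rewrite mulrA ler_pdivrMr//.
have -> : e / 2 * (2 * (`|k| + 1)) = e * (`|k| + 1) by field.
by rewrite mulrC ler_pM2l// lerDl.
Qed.

Lemma sqr_mean_le (R : realType) (x y : R) : ((x + y) / 2) ^+ 2 <= x ^+ 2 + y ^+ 2.
Proof. by have := sqr_ge0 (x - y); have := sqr_ge0 (x + y); rewrite !expr2; lra. Qed.

(** Only nonnegativity is asked, since square integrable functions are represented
by functions, which may be null without being zero. *)
Record semi_inner (R : realType) (V : lmodType R) (ip : V -> V -> R) : Prop := {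
  si_sym : forall u v, ip u v = ip v u ;
  si_lin : forall a u v w, ip (a *: u + v) w = a * ip u w + ip v w ;
  si_ge0 : forall u, 0 <= ip u u }.

Definition snorm (R : realType) (V : lmodType R) (ip : V -> V -> R) (u : V) : R :=
  Num.sqrt (ip u u).

Section SemiInner.
Context (R : realType) (V : lmodType R) (ip : V -> V -> R).
Hypothesis ipP : semi_inner ip.
Local Notation nrm := (snorm ip).

Lemma ipC u v : ip u v = ip v u. Proof. exact: si_sym. Qed.

Lemma ip0l w : ip 0 w = 0.
Proof. by have := si_lin ipP 1 0 0 w; rewrite scaler0 addr0; lra. Qed.

Lemma ipDl u v w : ip (u + v) w = ip u w + ip v w.
Proof. by rewrite -{1}[u]scale1r (si_lin ipP) mul1r. Qed.

Lemma ipZl a u w : ip (a *: u) w = a * ip u w.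
Proof. by rewrite -[a *: u]addr0 (si_lin ipP) ip0l addr0. Qed.

Lemma ipNl u w : ip (- u) w = - ip u w.
Proof. by rewrite -scaleN1r ipZl mulN1r. Qed.

Lemma ipBl u v w : ip (u - v) w = ip u w - ip v w.
Proof. by rewrite ipDl ipNl. Qed.

Lemma ipDr u v w : ip w (u + v) = ip w u + ip w v.
Proof. by rewrite !(ipC w) ipDl. Qed.

Lemma ipZr a u w : ip w (a *: u) = a * ip w u.
Proof. by rewrite !(ipC w) ipZl. Qed.

Lemma ipBr u v w : ip w (u - v) = ip w u - ip w v.
Proof. by rewrite !(ipC w) ipBl. Qed.

Lemma snorm_ge0 u : 0 <= nrm u. Proof. exact: sqrtr_ge0. Qed.

Lemma snorm_sqr u : nrm u ^+ 2 = ip u u.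
Proof. by rewrite sqr_sqrtr// (si_ge0 ipP). Qed.

Lemma ip_sqr_le u v : ip u v ^+ 2 <= ip u u * ip v v.
Proof.
have pos s t : 0 <= s ^+ 2 * ip u u + 2 * (s * t) * ip u v + t ^+ 2 * ip v v.
  have := si_ge0 ipP (s *: u + t *: v).
  by rewrite !(ipDl, ipDr, ipZl, ipZr) (ipC v u); lra.
have [v0|v0] := eqVneq (ip v v) 0.
  rewrite v0 mulr0 exprn_even_le0//=; apply/negP => /negP uv.
  have := pos 1 (- (ip u u + 1) / (2 * ip u v)); rewrite v0.
  suff -> : 2 * (1 * (- (ip u u + 1) / (2 * ip u v))) * ip u v = - (ip u u + 1).
    by lra.
  by field.
have vp : 0 < ip v v by rewrite lt_neqAle eq_sym v0 (si_ge0 ipP).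
have := pos (ip v v) (- ip u v).
have -> : ip v v ^+ 2 * ip u u + 2 * (ip v v * - ip u v) * ip u v +
   (- ip u v) ^+ 2 * ip v v = ip v v * (ip u u * ip v v - ip u v ^+ 2) by ring.
by rewrite pmulr_rge0// subr_ge0.
Qed.

Lemma cauchy_schwarz u v : `|ip u v| <= nrm u * nrm v.
Proof.
rewrite -[leLHS]ger0_norm// -ler_sqr ?nnegrE ?mulr_ge0 ?snorm_ge0//.
by rewrite normr_id exprMn !snorm_sqr real_normK ?num_real// ip_sqr_le.
Qed.

Lemma ip_le u v : ip u v <= nrm u * nrm v.
Proof. exact: le_trans (ler_norm _) (cauchy_schwarz _ _). Qed.

Lemma snormD u v : nrm (u + v) <= nrm u + nrm v.
Proof.
rewrite -ler_sqr ?nnegrE ?addr_ge0 ?snorm_ge0// snorm_sqr.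
rewrite !(ipDl, ipDr) (ipC v u) sqrrD !snorm_sqr.
by have := ip_le u v; lra.
Qed.

Lemma snormZ a u : nrm (a *: u) = `|a| * nrm u.
Proof.
by rewrite /snorm ipZl ipZr mulrA -expr2 sqrtrM ?sqr_ge0// sqrtr_sqr.
Qed.

Lemma snormN u : nrm (- u) = nrm u.
Proof. by rewrite -scaleN1r snormZ normrN1 mul1r. Qed.

Lemma snormB u v : nrm (u - v) <= nrm u + nrm v.
Proof. by rewrite (le_trans (snormD _ _))// snormN. Qed.

Lemma snormBC u v : nrm (u - v) = nrm (v - u).
Proof. by rewrite -snormN opprB. Qed.

Lemma snorm_triangle w u v : nrm (u - v) <= nrm (u - w) + nrm (w - v).
Proof. by rewrite (le_trans _ (snormD _ _))// addrA subrK. Qed.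

(** Equality modulo null vectors, tested against all vectors: this form can be
used directly to rewrite inside inner products. *)
Definition weq u v := forall w, ip u w = ip v w.

Lemma weq_ip u v u' v' : weq u u' -> weq v v' -> ip u v = ip u' v'.
Proof. by move=> uu vv; rewrite uu ipC vv ipC. Qed.

Lemma weq_snorm u v : weq u v -> nrm u = nrm v.
Proof. by move=> uv; rewrite /snorm (weq_ip uv uv). Qed.

Lemma weqP u v : weq u v <-> nrm (u - v) = 0.
Proof.
split=> [uv|uv w].
  by rewrite /snorm ipBl !ipBr !(uv, ipC _ v) !subrr ?sqrtr0// uv subrr sqrtr0.
apply/eqP; rewrite -subr_eq0 -ipBl -normr_le0.
by rewrite (le_trans (cauchy_schwarz _ _))// uv mul0r.
Qed.

Lemma weq_sym u v : weq u v -> weq v u.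
Proof. by move=> uv w; rewrite uv. Qed.

Lemma weq_trans v u w : weq u v -> weq v w -> weq u w.
Proof. by move=> uv vw x; rewrite uv vw. Qed.

Lemma weqB u v u' v' : weq u u' -> weq v v' -> weq (u - v) (u' - v').
Proof. by move=> uu vv w; rewrite !ipBl uu vv. Qed.

Lemma weqZ a u u' : weq u u' -> weq (a *: u) (a *: u').
Proof. by move=> uu w; rewrite !ipZl uu. Qed.

End SemiInner.

Definition wlinear (R : realType) (V : lmodType R) (ip : V -> V -> R) (Q : V -> V) :=
  forall a u v, weq ip (Q (a *: u + v)) (a *: Q u + Q v).

Section ApproxInverse.
Context (R : realType) (V : lmodType R) (ip : V -> V -> R).
Hypothesis ipP : semi_inner ip.
Local Notation nrm := (snorm ip).
Variable Q : V -> V.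
Hypothesis Qlin : wlinear ip Q.
Hypothesis Q01 : forall u, ip (Q u) (Q u) <= ip (Q u) u.

(** Richardson's iteration: adding [(1 + l)^-1 *: r] to [z], where [r] is the
residual, turns [r] into [(1 + l)^-1 *: (r - Q r)], and [r - Q r] is not longer than
[r] because [Q] lies between [0] and [1]. *)
Lemma approx_inverse (l : R) f d : 0 < l -> 0 < d ->
  exists z, nrm (f - (l *: z + Q z)) <= d.
Proof.
move=> l0 d0.
have step n : exists z, nrm (f - (l *: z + Q z)) <= (1 + l)^-1 ^+ n * (nrm f + nrm (Q 0)).
  elim: n => [|n [z IH]].
    exists 0; rewrite expr0 mul1r scaler0 add0r; exact: snormB.
  pose r := f - (l *: z + Q z); pose c := (1 + l)^-1.
  exists (c *: r + z).
  have c0 : 0 <= c by rewrite invr_ge0; lra.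
  have lc : l * c = 1 - c by rewrite /c; field; lra.
  suff rE : weq ip (f - (l *: (c *: r + z) + Q (c *: r + z))) (c *: (r - Q r)).
    rewrite (weq_snorm ipP rE) (snormZ ipP) ger0_norm// exprS -mulrA ler_wpM2l//.
    apply: le_trans IH; rewrite -/r.
    clear rE; clearbody r; rewrite -ler_sqr ?nnegrE ?snorm_ge0//.
    rewrite !(snorm_sqr ipP) !(ipBl ipP) !(ipBr ipP) (ipC ipP r (Q r)).
    by have := Q01 r; have := si_ge0 ipP (Q r); lra.
  move=> w; rewrite (ipBl ipP) (ipDl ipP) (Qlin c r z w) !(ipZl ipP, ipDl ipP).
  rewrite (ipNl ipP) (mulrDr l) mulrA lc.
  rewrite !(ipNl ipP, ipDl ipP, ipZl ipP); ring.
have M0 : 0 < nrm f + nrm (Q 0) + 1.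
  by rewrite ltr_wpDl// addr_ge0// snorm_ge0.
have [||n] := @geometric_lt _ (1 + l)^-1 (d / (nrm f + nrm (Q 0) + 1)).
- by rewrite invr_ge0 invf_lt1; lra.
- exact: divr_gt0.
rewrite ltr_pdivlMr// => nd.
have [z zP] := step n; exists z; apply: (le_trans zP).
apply: le_trans (ltW nd); rewrite ler_wpM2l ?exprn_ge0 ?invr_ge0; lra.
Qed.

End ApproxInverse.

(** * Symmetric contraction semigroups *)

Record wsemigroup (R : realType) (V : lmodType R) (ip : V -> V -> R)
    (E : R -> V -> V) : Prop := {
  ws_lin : forall t, 0 <= t -> wlinear ip (E t) ;
  ws_0 : forall f, weq ip (E 0 f) f ;
  ws_D : forall s t f, 0 <= s -> 0 <= t -> weq ip (E (s + t) f) (E s (E t f)) ;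
  ws_contraction : forall t f, 0 <= t -> snorm ip (E t f) <= snorm ip f ;
  ws_continuous : forall f e, 0 < e -> exists2 d, 0 < d &
    forall t, 0 < t < d -> snorm ip (E t f - f) < e }.

Definition wgenerator (R : realType) (V : lmodType R) (ip : V -> V -> R)
    (E : R -> V -> V) (u f : V) : Prop :=
  forall e, 0 < e -> exists2 d, 0 < d &
    forall t, 0 < t < d -> snorm ip (t^-1 *: (E t u - u) - f) < e.

Section Semigroup.
Context (R : realType) (V : lmodType R) (ip : V -> V -> R).
Hypothesis ipP : semi_inner ip.
Local Notation nrm := (snorm ip).
Local Notation weq := (weq ip).
Variable E : R -> V -> V.
Hypothesis EP : wsemigroup ip E.
Local Notation gen := (wgenerator ip E).

Lemma ws_B t u v : 0 <= t -> weq (E t (u - v)) (E t u - E t v).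
Proof.
move=> t0; have := ws_lin EP t0 (-1) v u.
by rewrite !scaleN1r (addrC (- v)) (addrC (- E t v)).
Qed.

Lemma ws_Z t a u : 0 <= t -> weq (E t (a *: u)) (a *: E t u).
Proof.
move=> t0 w; rewrite -{1}[a *: u]addr0 (ws_lin EP t0 _ _ _ w) (ipDl ipP).
have := ws_B u u t0 w; rewrite subrr => ->.
by rewrite (ipBl ipP); ring.
Qed.

Lemma ws_weq t u v : 0 <= t -> weq u v -> weq (E t u) (E t v).
Proof.
move=> t0 /(weqP ipP) uv; apply/(weqP ipP)/le_anti; rewrite snorm_ge0 andbT.
rewrite -(weq_snorm ipP (ws_B u v t0)) -uv.
exact: (ws_contraction EP).
Qed.

Lemma ws_comm s t u : 0 <= s -> 0 <= t -> weq (E s (E t u)) (E t (E s u)).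
Proof.
by move=> s0 t0 w; rewrite -(ws_D EP _ s0 t0 w) addrC (ws_D EP _ t0 s0 w).
Qed.

Lemma ws_contrB t u v : 0 <= t -> nrm (E t u - E t v) <= nrm (u - v).
Proof.
by move=> t0; rewrite -(weq_snorm ipP (ws_B u v t0)) (ws_contraction EP).
Qed.

(** The semigroup commutes with its difference quotients and contracts, so that
the rate of convergence of the latter is not deteriorated along orbits. *)
Lemma diff_quotient_orbit s h u f : 0 <= s -> 0 <= h ->
  nrm (h^-1 *: (E h (E s u) - E s u) - E s f) <= nrm (h^-1 *: (E h u - u) - f).
Proof.
move=> s0 h0; apply: le_trans (ws_contraction EP _ s0).
rewrite le_eqVlt; apply/orP/or_introl/eqP/(weq_snorm ipP).
apply: weq_trans (weq_sym (ws_B _ _ s0)); apply: (weqB ipP) => //.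
apply: weq_trans (weq_sym (ws_Z _ _ s0)); apply: (weqZ ipP).
apply: weq_trans (weq_sym (ws_B _ _ s0)); apply: (weqB ipP) => //.
exact: ws_comm.
Qed.

Lemma gen_orbit s u f : 0 <= s -> gen u f -> gen (E s u) (E s f).
Proof.
move=> s0 uf e e0; have [d d0 dP] := uf e e0; exists d => // t td.
apply: le_lt_trans (dP t td); apply: diff_quotient_orbit => //.
by case/andP: td => /ltW.
Qed.

Section Symmetric.
Hypothesis gen_sym : forall u f v g, gen u f -> gen v g -> ip f v = ip u g.
Hypothesis gen_dense : forall f e, 0 < e -> exists u g, gen u g /\ nrm (f - u) < e.

(** Telescope [ip (E t u) v - ip u (E t v)] over [n] steps of length [h = t / n],
each step is [h] times a difference of two difference quotients, which vanishes
in the limit because the generator is symmetric. *)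
Let sym_dom t u f v g : 0 < t -> gen u f -> gen v g -> ip (E t u) v = ip u (E t v).
Proof.
move=> t0 uf vg; apply/eqP; rewrite -subr_eq0 -normr_le0.
apply/ler_addgt0Pr => e e0; rewrite add0r.
pose M := t * (nrm u + nrm v) + 1.
have M0 : 0 < M by rewrite ltr_wpDl// mulr_ge0 ?(ltW t0)// addr_ge0// snorm_ge0.
have eM : 0 < e / M by exact: divr_gt0.
have [d1 d10 d1P] := uf _ eM; have [d2 d20 d2P] := vg _ eM.
pose d := Num.min d1 d2; have d0 : 0 < d by rewrite lt_min d10.
pose n := (Num.truncn (t / d)).+1.
have n0 : 0 < n%:R :> R by rewrite ltr0n.
pose h := t / n%:R; have h0 : 0 < h by exact: divr_gt0.
have hd : h < d.
  by rewrite /h ltr_pdivrMr// mulrC -ltr_pdivrMr// truncnS_gt.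
have nh : n%:R * h = t by rewrite /h mulrC divfK ?gt_eqF.
pose T j := ip (E (j%:R * h) u) (E (t - j%:R * h) v).
have -> : ip (E t u) v - ip u (E t v) = T n - T 0.
  rewrite /T nh subrr mul0r subr0; congr (_ - _).
    by apply: (weq_ip ipP) => //; apply/weq_sym/(ws_0 EP).
  by apply: (weq_ip ipP) => //; apply/weq_sym/(ws_0 EP).
rewrite -(@telescope_sumr _ 0 n T)//.
apply: (le_trans (ler_norm_sum _ _ _)).
suff step j : (0 <= j < n)%N -> `|T j.+1 - T j| <= e / M * (h * (nrm u + nrm v)).
  rewrite big_nat (le_trans (ler_sum _ step))// -big_nat sumr_const_nat subn0.
  have -> : e / M * (h * (nrm u + nrm v)) *+ n = e / M * (t * (nrm u + nrm v)).
    by rewrite -mulr_natl -nh; ring.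
  by rewrite mulrAC ler_pdivrMr// ler_wpM2l ?(ltW e0)// /M lerDl.
move=> /= jn.
have hj : 0 <= j%:R * h by rewrite mulr_ge0// ltW.
have jt : 0 <= t - j.+1%:R * h.
  by rewrite subr_ge0 -nh ler_wpM2r ?(ltW h0)// ler_nat.
have Sj : j.+1%:R * h = h + j%:R * h by rewrite -natr1; ring.
have tj : t - j%:R * h = h + (t - j.+1%:R * h) by rewrite Sj; ring.
pose a := E (j%:R * h) u; pose b := E (t - j.+1%:R * h) v.
have -> : T j.+1 - T j =
    h * (ip (h^-1 *: (E h a - a) - E (j%:R * h) f) b
         - ip a (h^-1 *: (E h b - b) - E (t - j.+1%:R * h) g)).
  have -> : T j.+1 = ip (E h a) b.
    by rewrite /T {1}Sj; apply: (weq_ip ipP) => //; apply: (ws_D EP) => //; exact: ltW.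
  have -> : T j = ip a (E h b).
    rewrite /T tj; apply: (weq_ip ipP) => //; apply: (ws_D EP) => //; exact: ltW.
  rewrite !(ipBl ipP) !(ipBr ipP) (ipZl ipP) (ipZr ipP) (ipBl ipP) (ipBr ipP).
  have := gen_sym (gen_orbit hj uf) (gen_orbit jt vg); rewrite -/a -/b => ->.
  by field; rewrite gt_eqF.
have hd' : 0 < h < d by rewrite h0.
rewrite normrM gtr0_norm// [leRHS]mulrCA ler_wpM2l ?(ltW h0)//.
rewrite (le_trans (ler_normB _ _))// mulrDr addrC lerD//.
- rewrite (le_trans (cauchy_schwarz ipP _ _))// mulrC.
  apply: ler_pM; rewrite ?snorm_ge0//; last exact: (ws_contraction EP).
  rewrite (le_trans (diff_quotient_orbit _ _ _ _)) ?(ltW h0)//.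
  by apply/ltW/d2P; rewrite h0 (lt_le_trans hd)// ge_min lexx orbT.
- rewrite (le_trans (cauchy_schwarz ipP _ _))//.
  apply: ler_pM; rewrite ?snorm_ge0//; last exact: (ws_contraction EP).
  rewrite (le_trans (diff_quotient_orbit _ _ _ _)) ?(ltW h0)//.
  by apply/ltW/d1P; rewrite h0 (lt_le_trans hd)// ge_min lexx.
Qed.

Lemma semigroup_symmetric t u v : 0 <= t -> ip (E t u) v = ip u (E t v).
Proof.
rewrite le_eqVlt => /predU1P[<-|t0].
  apply: (weq_ip ipP); first exact: (ws_0 EP).
  by apply: weq_sym; exact: (ws_0 EP).
apply/eqP; rewrite -subr_eq0 -normr_le0; apply/ler_addgt0Pr => e e0; rewrite add0r.
pose M := 2 * (nrm u + nrm v + 1).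
have M0 : 0 < M by rewrite mulr_gt0// ltr_wpDl// addr_ge0// snorm_ge0.
have M1 : 2 * (nrm u + nrm v) <= M by rewrite /M; lra.
pose d := Num.min 1 (e / M); have d0 : 0 < d by rewrite lt_min ltr01 divr_gt0.
have [u' [f [uf ud]]] := gen_dense u d0.
have [v' [g [vg vd]]] := gen_dense v d0.
have -> : ip (E t u) v - ip u (E t v) =
  (ip (E t u - E t u') v + ip (E t u') (v - v'))
  - (ip (u - u') (E t v) + ip u' (E t v - E t v')).
  rewrite !(ipBl ipP) !(ipBr ipP); have := sym_dom t0 uf vg; lra.
have t0' := ltW t0.
have u'M : nrm u' <= nrm u + d.
  have := snormB ipP u (u - u'); rewrite subKr => /le_trans; apply.
  by rewrite lerD2l ltW.
have b1 : `|ip (E t u - E t u') v| <= d * nrm v.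
  rewrite (le_trans (cauchy_schwarz ipP _ _))// ler_wpM2r ?snorm_ge0//.
  exact: le_trans (ws_contrB _ _ t0') (ltW ud).
have b2 : `|ip (E t u') (v - v')| <= (nrm u + d) * d.
  rewrite (le_trans (cauchy_schwarz ipP _ _))//.
  apply: ler_pM; rewrite ?snorm_ge0//; last exact: ltW.
  exact: le_trans (ws_contraction EP _ t0') _.
have b3 : `|ip (u - u') (E t v)| <= d * nrm v.
  rewrite (le_trans (cauchy_schwarz ipP _ _))//.
  apply: ler_pM; rewrite ?snorm_ge0//; first exact: ltW.
  exact: (ws_contraction EP).
have b4 : `|ip u' (E t v - E t v')| <= (nrm u + d) * d.
  rewrite (le_trans (cauchy_schwarz ipP _ _))//.
  apply: ler_pM; rewrite ?snorm_ge0//.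
  exact: le_trans (ws_contrB _ _ t0') (ltW vd).
rewrite (le_trans (ler_normB _ _))//.
apply: le_trans (lerD (ler_normD _ _) (ler_normD _ _)) _.
apply: (@le_trans _ _ (d * M)).
  have d1 : d * d <= d * 1 by rewrite ler_wpM2l ?(ltW d0)// ge_min lexx.
  rewrite /M; lra.
by rewrite -ler_pdivlMr// ge_min lexx orbT.
Qed.

End Symmetric.

Hypothesis E_sym : forall (t : R) u v, 0 <= t -> ip (E t u) v = ip u (E t v).

(** Symmetry makes [t |-> ip (E t f) f] nonnegative, nonincreasing and convex; its
second differences are squared norms, which is how smoothing is obtained below. *)
Lemma ws_ip_half s f : 0 <= s -> ip (E s f) f = nrm (E (s / 2) f) ^+ 2.
Proof.
move=> s0; have s20 : 0 <= s / 2 by rewrite divr_ge0.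
by rewrite (snorm_sqr ipP) -(E_sym _ _ s20) -(ws_D EP f s20 s20) -splitr.
Qed.

(** A discrete counterpart of the decay in [1 / t ^ 2] of the second derivative of a
completely monotone function: sum the second differences twice, down from [n]. *)
Lemma second_difference_decay (psi : nat -> R) (n : nat) :
  (forall k, 0 <= psi k) ->
  (forall k, psi k.+1 <= psi k) ->
  (forall k, 0 <= psi k - 2 * psi k.+1 + psi k.+2) ->
  (forall k, psi k.+1 - 2 * psi k.+2 + psi k.+3 <= psi k - 2 * psi k.+1 + psi k.+2) ->
  n%:R ^+ 2 * (psi n - 2 * psi n.+1 + psi n.+2) <= 2 * psi 0.
Proof.
move=> psi0 b0 c0 cd; pose c k := psi k - 2 * psi k.+1 + psi k.+2.
have cn k : (k <= n)%N -> c n <= c k.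
  move=> /subnK <-; elim: (n - k)%N => //= m; exact: le_trans (cd _).
have bn k : (k <= n)%N -> (n - k)%:R * c n <= psi k - psi k.+1.
  move=> kn; suff H m : (m <= n)%N -> m%:R * c n <= psi (n - m)%N - psi (n - m).+1.
    by have := H (n - k)%N (leq_subr _ _); rewrite subKn.
  elim: m => [_|m IH mn]; first by rewrite mul0r subn0 subr_ge0.
  have := IH (ltnW mn); have := cn (n - m.+1)%N (leq_subr _ _).
  have e : (n - m.+1).+1 = (n - m)%N by rewrite -subSn// subSS.
  by rewrite [c (n - m.+1)%N]/c e -(@natr1 R m); lra.
have H m : (m <= n)%N ->
    (m%:R * (2 * n%:R - m%:R) / 2) * c n <= psi 0 - psi m.
  elim: m => [_|m IH mn]; first by rewrite !mul0r subrr.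
  have := IH (ltnW mn); have := bn m (ltnW mn).
  rewrite natrB ?(ltnW mn)// -(@natr1 R m).
  have : 0 <= c n by exact: c0.
  lra.
by have := H n (leqnn n); have := psi0 n; rewrite -/(c n); lra.
Qed.

Lemma ws_second_difference (h : R) f n : 0 < h ->
  n%:R ^+ 2 * nrm (E (n%:R * h / 2) (E h f - f)) ^+ 2 <= 2 * nrm f ^+ 2.
Proof.
move=> h0; pose psi k := ip (E (k%:R * h) f) f.
have kh (k : nat) : 0 <= k%:R * h by rewrite mulr_ge0// ltW.
have kh2 (k : nat) : 0 <= k%:R * h / 2 by rewrite divr_ge0.
have cE k : psi k - 2 * psi k.+1 + psi k.+2 =
    nrm (E (k%:R * h / 2) (E h f - f)) ^+ 2.
  rewrite (snorm_sqr ipP) -(E_sym _ _ (kh2 k)).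
  have -> : ip (E (k%:R * h / 2) (E (k%:R * h / 2) (E h f - f))) (E h f - f)
      = ip (E (k%:R * h) (E h f - f)) (E h f - f).
    by rewrite -(ws_D EP _ (kh2 k) (kh2 k)) -splitr.
  have h0' := ltW h0.
  rewrite (ws_B _ _ (kh k)) !(ipBl ipP) !(ipBr ipP) -!(E_sym _ _ h0').
  have D1 : ip (E (k%:R * h) (E h f)) f = psi k.+1.
    by rewrite -(ws_D EP f (kh k) h0') /psi -natr1 mulrDl mul1r.
  have -> : ip (E h (E (k%:R * h) f)) f = psi k.+1.
    by rewrite (ws_comm _ h0' (kh k)).
  have -> : ip (E h (E (k%:R * h) (E h f))) f = psi k.+2.
    rewrite (ws_comm _ h0' (kh k)).
    have e := ws_D EP f h0' h0'.
    rewrite -(ws_weq (kh k) e) -(ws_D EP f (kh k) (addr_ge0 h0' h0')).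
    by rewrite /psi -natr1 -natr1; congr (ip (E _ f) f); ring.
  by rewrite D1 /psi; ring.
have half k : k%:R * h / 2 + h / 2 = k.+1%:R * h / 2 by rewrite -natr1; ring.
rewrite -cE (le_trans (@second_difference_decay psi n _ _ _ _))//.
- by move=> k; rewrite /psi ws_ip_half// sqr_ge0.
- move=> k; rewrite /psi !ws_ip_half// -half ler_sqr ?nnegrE ?snorm_ge0//.
  rewrite addrC (weq_snorm ipP (ws_D EP _ _ _)) ?divr_ge0 ?(ltW h0)//.
  by rewrite (ws_contraction EP)// divr_ge0 ?(ltW h0).
- by move=> k; rewrite cE sqr_ge0.
- move=> k; rewrite !cE ler_sqr ?nnegrE ?snorm_ge0// -half addrC.
  rewrite (weq_snorm ipP (ws_D EP _ _ _)) ?divr_ge0 ?(ltW h0)//.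
  by rewrite (ws_contraction EP)// divr_ge0 ?(ltW h0).
- rewrite ler_wpM2l// /psi mul0r ws_ip_half// mul0r.
  by rewrite ler_sqr ?nnegrE ?snorm_ge0// (ws_contraction EP).
Qed.

(** The smoothing effect: replace the derivative [f'] of the orbit at [0] by a
difference quotient of step [h = 2 * t / n], to which the estimate of second
differences applies. *)
Lemma ws_smoothing (t : R) f f' : 0 < t -> gen f f' -> nrm (E t f') <= t^-1 * nrm f.
Proof.
move=> t0 ff; apply/ler_addgt0Pr => e e0.
have [d d0 dP] := ff e e0.
pose n := (Num.truncn (2 * t / d)).+1.
have n0 : 0 < n%:R :> R by rewrite ltr0n.
pose h := 2 * t / n%:R; have h0 : 0 < h by rewrite divr_gt0// mulr_gt0.
have hd : h < d.
  by rewrite /h ltr_pdivrMr// (mulrC d) -ltr_pdivrMr// truncnS_gt.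
have nh : n%:R * h / 2 = t by rewrite /h; field; rewrite gt_eqF.
have t0' := ltW t0.
have X : nrm (E t (E h f - f)) <= h * (t^-1 * nrm f).
  have := ws_second_difference f n h0; rewrite nh => H.
  rewrite -ler_sqr ?nnegrE ?mulr_ge0 ?snorm_ge0 ?invr_ge0 ?(ltW h0)//.
  rewrite -(@ler_pM2l _ (n%:R ^+ 2)) ?exprn_gt0//; apply: le_trans H _.
  have -> : n%:R ^+ 2 * (h * (t^-1 * nrm f)) ^+ 2 = 4 * nrm f ^+ 2.
    by rewrite /h; field; rewrite !gt_eqF.
  by rewrite ler_wpM2r ?sqr_ge0// ler_nat.
have -> : E t f' = E t (h^-1 *: (E h f - f)) - (E t (h^-1 *: (E h f - f)) - E t f').
  by rewrite subKr.
rewrite (le_trans (snormB ipP _ _))// lerD//.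
  rewrite (weq_snorm ipP (ws_Z _ _ t0')) (snormZ ipP) ger0_norm ?invr_ge0 ?(ltW h0)//.
  by rewrite ler_pdivrMl.
by rewrite (le_trans (ws_contrB _ _ t0'))// ltW// dP// h0.
Qed.

(** One application of the generator for each interval of length [t]. *)
Lemma ws_smoothing_iter (t : R) (u : nat -> V) j : 0 < t ->
  (forall k, (k < j)%N -> gen (u k) (u k.+1)) ->
  nrm (E (j%:R * t) (u j)) <= t^-1 ^+ j * nrm (u 0).
Proof.
move=> t0; elim: j => [_|j IH uj].
  by rewrite mul0r expr0 mul1r (ws_contraction EP).
have jt : 0 <= j%:R * t by rewrite mulr_ge0// ltW.
rewrite -natr1 mulrDl mul1r addrC (weq_snorm ipP (ws_D EP _ (ltW t0) jt)).
have := ws_smoothing t0 (gen_orbit jt (uj j (ltnSn j))) => /le_trans; apply.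
rewrite exprS -mulrA ler_wpM2l ?invr_ge0 ?(ltW t0)// IH// => k kj.
by apply: uj; rewrite ltnS ltnW.
Qed.

(** Halve the time step by step: with [Q = E (s / 2)], which lies between [0] and
[1], let [z] nearly solve [l *: z + Q z = g] with [l] small. Then [Q g - Q (Q z)] is
close to [l *: Q z], and [Q z] is bounded independently of [l]. *)
Lemma ws_range_dense_half (s : R) f n e : 0 < s -> 0 < e ->
  exists g, nrm (E (s / 2 ^+ n) f - E s g) < e.
Proof.
move=> + e0; elim: n s e e0 => [|n IH] s e e0 s0.
  by exists f; rewrite expr0 divr1 subrr /snorm (ip0l ipP) sqrtr0.
have s2 : 0 < s / 2 by rewrite divr_gt0.
have [g gP] := IH (s / 2) (e / 2) (divr_gt0 e0 (ltr0n _ 2)) s2.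
have s2' := ltW s2; have s4' : 0 <= s / 2 / 2 by rewrite divr_ge0.
have Q01 u : ip (E (s / 2) u) (E (s / 2) u) <= ip (E (s / 2) u) u.
  rewrite (ws_ip_half _ s2') -(snorm_sqr ipP) ler_sqr ?nnegrE ?snorm_ge0//.
  rewrite {1}(splitr (s / 2)) (weq_snorm ipP (ws_D EP _ s4' s4')).
  exact: (ws_contraction EP).
pose d := Num.min 1 (e / 8); have d0 : 0 < d by rewrite lt_min ltr01 divr_gt0.
pose l := e / (8 * (nrm g + 1)).
have M0 : 0 < nrm g + 1 by rewrite ltr_wpDl ?snorm_ge0.
have l0 : 0 < l by rewrite divr_gt0// mulr_gt0.
have [z zP] := approx_inverse ipP (ws_lin EP s2') Q01 g l0 d0.
exists z; pose r := g - (l *: z + E (s / 2) z).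
have rd : nrm r <= d by [].
have gr : nrm (g - r) <= nrm g + 1.
  by rewrite (le_trans (snormB ipP _ _))// lerD2l (le_trans rd)// ge_min lexx.
have Qz : nrm (E (s / 2) z) <= nrm g + 1.
  have : nrm (E (s / 2) z) ^+ 2 <= (nrm g + 1) * nrm (E (s / 2) z).
    apply: (@le_trans _ _ (ip (g - r) (E (s / 2) z))); last first.
      by rewrite (le_trans (ip_le ipP _ _))// ler_wpM2r ?snorm_ge0.
    rewrite /r subKr (ipDl ipP) (ipZl ipP) (snorm_sqr ipP) lerDr.
    by rewrite mulr_ge0 ?(ltW l0)// (ipC ipP) (le_trans _ (Q01 z)) ?(si_ge0 ipP).
  have := snorm_ge0 ip (E (s / 2) z); rewrite le_eqVlt => /predU1P[<- _|q0].
    exact: ltW.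
  by rewrite expr2 ler_pM2r.
have e1 : nrm (E (s / 2) g - E s z) <= d + l * (nrm g + 1).
  rewrite {2}(splitr s).
  have -> : nrm (E (s / 2) g - E (s / 2 + s / 2) z) = nrm (E (s / 2) (r + l *: z)).
    apply: (weq_snorm ipP); rewrite /r opprD addrA addrAC subrK.
    apply: weq_sym; apply: weq_trans (ws_B _ _ s2') _; apply: (weqB ipP) => //.
    by apply: weq_sym; exact: (ws_D EP).
  rewrite (weq_snorm ipP (_ : weq _ (E (s / 2) r + l *: E (s / 2) z))).
    rewrite (le_trans (snormD ipP _ _))// lerD//.
      exact: le_trans (ws_contraction EP _ s2') rd.
    by rewrite (snormZ ipP) gtr0_norm// ler_wpM2l// ltW.
  by rewrite addrC (addrC (E _ r)); exact: (ws_lin EP s2').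
have e2 : d + l * (nrm g + 1) <= e / 4.
  have -> : l * (nrm g + 1) = e / 8 by rewrite /l; field; rewrite gt_eqF.
  have : d <= e / 8 by rewrite ge_min lexx orbT.
  lra.
have -> : s / 2 ^+ n.+1 = s / 2 / 2 ^+ n by rewrite exprS invfM mulrA.
by rewrite (le_lt_trans (snorm_triangle ipP (E (s / 2) g) _ _))//; lra.
Qed.

(** Backward uniqueness in dual form. Strong continuity provides approximations of
[f] in the range of [E (s / 2 ^ n)], which the previous lemma brings into the
range of [E s]. *)
Lemma ws_range_dense (s : R) f e : 0 < s -> 0 < e -> exists g, nrm (f - E s g) < e.
Proof.
move=> s0 e0; have e2 : 0 < e / 2 by rewrite divr_gt0.
have [d d0 dP] := ws_continuous EP f e2.
have [||n nP] := @geometric_lt R 2^-1 (d / s); first 2 last.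
- have s2 : 0 < s / 2 ^+ n < d.
    by rewrite divr_gt0 ?exprn_gt0//= mulrC -ltr_pdivlMr// -exprVn.
  have [g gP] := ws_range_dense_half f n s0 e2; exists g.
  rewrite (le_lt_trans (snorm_triangle ipP (E (s / 2 ^+ n) f) _ _))//.
  by have := dP _ s2; rewrite (snormBC ipP) => ?; lra.
- by rewrite invr_ge0 invf_lt1; lra.
- exact: divr_gt0.
Qed.

(** * Control by duality *)

(** [P] is the restriction to the control region, extended by zero, and [ipw] the
inner product of this region; [Q] is the Gramian of the control problem. *)
Section Control.
Variables (ipw : V -> V -> R) (P : V -> V).
Hypothesis ipwP : semi_inner ipw.
Hypothesis ipw_le : forall u, ipw u u <= ip u u.
Hypothesis PE : forall u v, ip (P u) v = ipw u v.
Variables (s : R) (s0 : 0 < s).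

Let Q z := E s (P (E s z)).

Let P_weq u v : weq u v -> weq (P u) (P v).
Proof.
move=> /(weqP ipP) uv w; rewrite !PE; apply/eqP.
rewrite -subr_eq0 -(ipBl ipwP) -normr_le0 (le_trans (cauchy_schwarz ipwP _ _))//.
rewrite (_ : snorm ipw (u - v) = 0) ?mul0r//; apply/le_anti.
rewrite snorm_ge0 andbT -uv; exact: ler_wsqrtr.
Qed.

Let Q_lin : wlinear ip Q.
Proof.
have s0' := ltW s0.
move=> a u v; apply: weq_trans (ws_lin EP s0' _ _ _).
apply: (ws_weq s0'); apply: weq_trans (P_weq (ws_lin EP s0' _ _ _)) _ => w.
by rewrite (ipDl ipP) (ipZl ipP) !PE (ipDl ipwP) (ipZl ipwP).
Qed.

Let ipQ z u : ip (Q z) u = ipw (E s z) (E s u).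
Proof. by rewrite /Q E_sym ?PE// ltW. Qed.

Let Q01 u : ip (Q u) (Q u) <= ip (Q u) u.
Proof.
rewrite -(snorm_sqr ipP) ipQ -(snorm_sqr ipwP) ler_sqr ?nnegrE ?snorm_ge0//.
apply: le_trans (ws_contraction EP _ (ltW s0)) _.
have : snorm ip (P (E s u)) ^+ 2 <= snorm ipw (E s u) * snorm ip (P (E s u)).
  rewrite (snorm_sqr ipP) PE (le_trans (ip_le ipwP _ _))// ler_wpM2l ?snorm_ge0//.
  exact: ler_wsqrtr.
have := snorm_ge0 ip (P (E s u)); rewrite le_eqVlt => /predU1P[<- _|q0].
  exact: snorm_ge0.
by rewrite expr2 ler_pM2r.
Qed.

(** Test the equation [e ^+ 2 *: z + K ^+ 2 *: Q z = E s g] on [z]: the left-hand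
side becomes [K ^+ 2 * ipw (E s z) (E s z) + e ^+ 2 * ip z z], which observability
compares to the square of the norm of [E s z], while the right-hand side
is [ip g (E s z)]. Hence the square root of this quantity, called [x] below, is at
most the norm of [g], up to the residual [r] of the equation. *)
Lemma null_control (K e : R) g (d : R) : 0 < K -> 0 < e -> 0 < d ->
  (forall z, nrm (E s z) ^+ 2 <= K ^+ 2 * ipw (E s z) (E s z) + e ^+ 2 * nrm z ^+ 2) ->
  exists z, nrm (E s g - K ^+ 2 *: Q z) <= e * nrm g + d /\
            K ^+ 2 * snorm ipw (E s z) <= K * nrm g + d.
Proof.
move=> K0 e0 d0 obs.
pose c := Num.min (d / 2) (d * e / K).
have c0 : 0 < c by rewrite lt_min !divr_gt0// mulr_gt0.
have cd : c <= d / 2 by rewrite ge_min lexx.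
have ce : K * (c / e) <= d.
  by rewrite mulrA ler_pdivrMr// mulrC -ler_pdivlMr// ge_min lexx orbT.
have K2 : 0 < K ^+ 2 by rewrite exprn_gt0.
have [z zP] := approx_inverse ipP Q_lin Q01 ((K ^+ 2)^-1 *: E s g)
  (divr_gt0 (exprn_gt0 2 e0) K2) (divr_gt0 c0 K2).
exists z; pose r := E s g - (e ^+ 2 *: z + K ^+ 2 *: Q z).
have rc : nrm r <= c.
  have -> : r = K ^+ 2 *: ((K ^+ 2)^-1 *: E s g - (e ^+ 2 / K ^+ 2 *: z + Q z)).
    rewrite /r scalerBr scalerDr !scalerA mulfV ?gt_eqF// scale1r mulrC divfK//.
    by rewrite gt_eqF.
  rewrite (snormZ ipP) gtr0_norm// -(divfK (lt0r_neq0 K2) c) mulrC.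
  by rewrite ler_pM2r.
have s0' := ltW s0.
pose X := K ^+ 2 * snorm ipw (E s z) ^+ 2 + e ^+ 2 * nrm z ^+ 2.
have X0 : 0 <= X by rewrite addr_ge0// mulr_ge0// sqr_ge0.
pose x := Num.sqrt X; have xX : x ^+ 2 = X by rewrite sqr_sqrtr.
have x0 : 0 <= x by exact: sqrtr_ge0.
have EX : nrm (E s z) <= x.
  by rewrite -ler_sqr ?nnegrE ?snorm_ge0// xX /X (snorm_sqr ipwP).
have zX : e * nrm z <= x.
  rewrite -ler_sqr ?nnegrE ?mulr_ge0 ?snorm_ge0 ?(ltW e0)// xX /X exprMn lerDr.
  by rewrite mulr_ge0// sqr_ge0.
have wX : K * snorm ipw (E s z) <= x.
  rewrite -ler_sqr ?nnegrE ?mulr_ge0 ?snorm_ge0 ?(ltW K0)// xX /X exprMn lerDl.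
  by rewrite mulr_ge0// sqr_ge0.
have xle : (x <= nrm g + c / e).
  have : x ^+ 2 <= (nrm g + c / e) * x.
    have -> : x ^+ 2 = ip g (E s z) - ip r z.
      rewrite xX /X /r !(ipBl ipP) !(ipDl ipP) !(ipZl ipP) ipQ (E_sym _ _ s0').
      by rewrite (snorm_sqr ipP) (snorm_sqr ipwP); ring.
    rewrite mulrDl lerD//.
      by rewrite (le_trans (ip_le ipP _ _))// ler_wpM2l ?snorm_ge0.
    rewrite (le_trans (ler_norm _))// normrN (le_trans (cauchy_schwarz ipP _ _))//.
    apply: (@le_trans _ _ (c * nrm z)); first by rewrite ler_wpM2r ?snorm_ge0.
    by rewrite -mulrA ler_wpM2l ?(ltW c0)// ler_pdivlMl.
  have : 0 <= x by []; rewrite le_eqVlt => /predU1P[<- _|xp].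
    by rewrite addr_ge0 ?snorm_ge0// divr_ge0 ?ltW.
  by rewrite expr2 ler_pM2r.
split.
  have -> : E s g - K ^+ 2 *: Q z = r + e ^+ 2 *: z.
    by rewrite /r opprD addrA addrAC subrK.
  rewrite (le_trans (snormD ipP _ _))// (snormZ ipP) ger0_norm ?sqr_ge0//.
  have : e ^+ 2 * nrm z <= e * (nrm g + c / e).
    by rewrite expr2 -mulrA ler_wpM2l ?(ltW e0)// (le_trans zX).
  have -> : e * (nrm g + c / e) = e * nrm g + c by field; rewrite gt_eqF.
  lra.
have : K ^+ 2 * snorm ipw (E s z) <= K * (nrm g + c / e).
  by rewrite expr2 -mulrA ler_wpM2l ?(ltW K0)// (le_trans wX).
by rewrite mulrDr; lra.
Qed.

(** A nearly null control for the initial state [g] has [- E s g] as its contribution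
to the final state, and such states are dense. *)
Lemma approx_control f e : 0 < e ->
  (forall e, 0 < e -> exists2 K : R, 0 < K & forall z : V,
    nrm (E s z) ^+ 2 <= K ^+ 2 * ipw (E s z) (E s z) + e ^+ 2 * nrm z ^+ 2) ->
  exists (z : V) (c : R), nrm (f - c *: Q z) <= e.
Proof.
move=> e0 obs; have e3 : 0 < e / 3 by rewrite divr_gt0.
have [g gP] := ws_range_dense f s0 e3.
have M0 : 0 < nrm g + 1 by rewrite ltr_wpDl ?snorm_ge0.
have eM : 0 < e / 3 / (nrm g + 1) by exact: divr_gt0.
have [K K0 KP] := obs _ eM.
have [z [zP _]] := null_control g K0 eM e3 KP.
exists z, (K ^+ 2); rewrite (le_trans (snorm_triangle ipP (E s g) _ _))//.
have : e / 3 / (nrm g + 1) * nrm g <= e / 3.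
  by rewrite mulrAC ler_pdivrMr// ler_wpM2l ?(ltW e3)// lerDl.
lra.
Qed.

End Control.
End Semigroup.

(** * Square integrable functions on an interval *)

Section LebesgueInterval.
Context {R : realType}.
Implicit Types (a b : R).
Local Notation mu := (@lebesgue_measure R).

Lemma measurable_oo a b : measurable (`]a, b[ : set (measurableTypeR R)).
Proof. exact: measurable_itv. Qed.

Lemma leb_outside a b : leb a b (~` `]a, b[) = 0%E.
Proof. by rewrite /leb /= /mrestr setICl measure0. Qed.

Lemma integral_leb a b (f : measurableTypeR R -> \bar R) : measurable_fun setT f ->
  (\int[leb a b]_x f x = \int[mu]_(x in `]a, b[) f x)%E.
Proof.
move=> mf; have mD := measurable_oo a b.
rewrite -(setUv (`]a, b[ : set (measurableTypeR R))) integral_setU//; first last.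
- by apply/disj_setPCl.
- by rewrite setUv.
- exact: measurableC.
rewrite (null_set_integral (measurableC mD)) ?adde0; first last.
- exact: leb_outside.
- exact: measurable_funTS.
apply: eq_measure_integral => A mA AD.
by rewrite /leb /= /mrestr (setIidl AD).
Qed.

Lemma ae_leb_itv a b (P : R -> Prop) :
  (forall x, a < x < b -> P x) -> {ae leb a b, forall x, P x}.
Proof.
move=> h; exists (~` `]a, b[); split; [|exact: leb_outside|].
  by apply: measurableC; exact: measurable_oo.
by move=> x /= nP; rewrite in_itv/= => /h.
Qed.

Lemma leb_sub a b c d A : a <= c -> d <= b -> measurable A ->
  (leb c d A <= leb a b A)%E.
Proof.
move=> ac db mA; rewrite /leb /= /mrestr le_measure ?inE//.
- by apply: measurableI => //; exact: measurable_oo.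
- by apply: measurableI => //; exact: measurable_oo.
apply: setIS => x /=; rewrite !in_itv/= => /andP[cx xd].
by rewrite (le_lt_trans ac cx) (lt_le_trans xd db).
Qed.

Lemma ae_leb_sub a b c d (P : R -> Prop) : a <= c -> d <= b ->
  {ae leb a b, forall x, P x} -> {ae leb c d, forall x, P x}.
Proof.
move=> ac db [A [mA A0 PA]]; exists A; split => //.
by apply/eqP; rewrite eq_le measure_ge0 andbT -A0 leb_sub.
Qed.

Lemma ae_leb_lebesgue a b (P : R -> Prop) :
  {ae mu, forall x, P x} -> {ae leb a b, forall x, P x}.
Proof.
move=> [A [mA A0 PA]]; exists A; split => //.
apply/eqP; rewrite eq_le measure_ge0 andbT -A0 /leb /= /mrestr le_measure ?inE//.
by apply: measurableI => //; exact: measurable_oo.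
Qed.

Lemma ae_leb_imp a b (P Q : R -> Prop) : (forall x, a < x < b -> P x -> Q x) ->
  {ae leb a b, forall x, P x} -> {ae leb a b, forall x, Q x}.
Proof.
move=> PQ aeP; have := ae_leb_itv (fun x (h : a < x < b) => h).
have FF := ae_filter_ringOfSetsType (leb a b).
apply: (@filterS2 _ _ FF _ _ _ _ aeP) => x Px xab; exact: PQ.
Qed.

Lemma ae_leb_imp2 a b (P Q S : R -> Prop) :
  (forall x, a < x < b -> P x -> Q x -> S x) ->
  {ae leb a b, forall x, P x} -> {ae leb a b, forall x, Q x} ->
  {ae leb a b, forall x, S x}.
Proof.
move=> PQS aeP aeQ; have FF := ae_filter_ringOfSetsType (leb a b).
have aePQ : {ae leb a b, forall x, P x /\ Q x}.
  by apply: (@filterS2 _ _ FF _ _ _ _ aeP aeQ).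
by apply: ae_leb_imp aePQ => x xab [Px Qx]; exact: PQS.
Qed.

Lemma ae_leb_and a b (P Q : R -> Prop) :
  {ae leb a b, forall x, P x} -> {ae leb a b, forall x, Q x} ->
  {ae leb a b, forall x, P x /\ Q x}.
Proof. by apply: ae_leb_imp2. Qed.

Lemma lebT_fin a b : (leb a b setT < +oo)%E.
Proof.
rewrite /leb /= /mrestr setTI lebesgue_measure_itv/=.
by case: ifP => //; rewrite -EFinB ltry.
Qed.

End LebesgueInterval.

Section L2ip.
Context {R : realType} (a b : R).
Local Notation L2 := (@L2 R a b).

Definition L2ip (f g : L2) : R := \int[leb a b]_x (f x * g x).

Lemma L2_mul_integrable (f g : L2) :
  (leb a b).-integrable setT (EFin \o (fun x => f x * g x)).
Proof. by apply/Lfun1_integrable/Lfun2_mul_Lfun1; exact: LfunP. Qed.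

Lemma L2ip_semi_inner : semi_inner L2ip.
Proof.
split=> [u v|k u v w|u].
- by apply: eq_Rintegral => x _; rewrite mulrC.
- have ik : (leb a b).-integrable setT (EFin \o (fun x => k * (u x * w x))).
    have := integrableZl measurableT k (L2_mul_integrable u w).
    by apply: eq_integrable => // x _.
  rewrite /L2ip -RintegralZl//; last exact: L2_mul_integrable.
  rewrite -RintegralD//; last exact: L2_mul_integrable.
  by apply: eq_Rintegral => x _ /=; rewrite mulrDl mulrA.
- by apply: Rintegral_ge0 => x _; rewrite -expr2 sqr_ge0.
Qed.

Lemma L2norm_snorm (f : L2) : L2norm a b f = snorm L2ip f.
Proof.
rewrite /L2norm unlock /snorm /L2ip /Rintegral.
under eq_integral => x _.
  rewrite /= powR_mulrn// real_normK ?num_real// expr2.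
  over.
rewrite -[X in (X `^ _)%E](@fineK _); last first.
  exact: (integrable_fin_num measurableT (L2_mul_integrable f f)).
rewrite poweR_EFin/= powR12_sqrt//.
by apply: fine_ge0; apply: integral_ge0 => x _; rewrite lee_fin -expr2 sqr_ge0.
Qed.

Lemma L2ip_ae (f g f' g' : L2) : {ae leb a b, forall x, f x = f' x} ->
  {ae leb a b, forall x, g x = g' x} -> L2ip f g = L2ip f' g'.
Proof.
move=> ff gg; rewrite /L2ip /Rintegral; congr fine.
have m (u v : L2) : measurable_fun setT
    ((fun x => (u x * v x)%:E) : measurableTypeR R -> \bar R).
  by apply/measurable_EFinP; apply: measurable_funM.
apply: ae_eq_integral => //; rewrite /ae_eq.
by apply: filterS2 ff gg => x /= -> ->.
Qed.

Lemma weq_ae (f g : L2) : {ae leb a b, forall x, f x = g x} -> weq L2ip f g.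
Proof.
by move=> fg w; apply: L2ip_ae => //; exact: ae_leb_itv.
Qed.

End L2ip.

Section Restriction.
Context {R : realType} (k : R) (k01 : 0 < k < 1).
Local Notation ip := (@L2ip R 0 1).

Lemma restr_Lfun (f : L2 (0 : R) 1) : (f : R -> R) \in Lfun (leb 0 k) 2%:E.
Proof.
case/andP: k01 => k0 k1.
apply/andP; split; rewrite inE//= /finite_norm unlock poweR_lty//.
have : (\int[leb 0 1]_x (`|(f x)%:E| `^ 2) < +oo)%E.
  have := @Lfunction_finite _ _ _ _ _ (lee1n 2) f.
  by rewrite /finite_norm unlock => /lty_poweRy; apply; rewrite invr_neq0.
apply: le_lt_trans; apply: ge0_le_measure_integral => //.
- by move=> A mA; apply: leb_sub => //; exact: ltW.
- by move=> x; exact: poweR_ge0.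
- apply/measurable_EFinP; apply: (measurableT_comp (measurable_powR _)) => //.
  exact: measurableT_comp.
Qed.

(** The same function, whose class now only retains its values on [(0, k)]. *)
Definition restr (f : L2 (0 : R) 1) : L2 (0 : R) k :=
  Lfun_Sub (lee1n 2) (restr_Lfun f).

Definition ipw (f g : L2 (0 : R) 1) : R := L2ip (restr f) (restr g).

Definition cut (f : L2 (0 : R) 1) : L2 (0 : R) 1 := extend0 0 1 (restr f).

Lemma ipw_semi_inner : semi_inner ipw.
Proof.
have := L2ip_semi_inner 0 k => -[S L P].
split=> [u v|c u v w|u]; [exact: S| |exact: P].
by rewrite /ipw -L; congr L2ip.
Qed.

Lemma cutE f x : cut f x = \1_`]0, k[ x * f x. Proof. by []. Qed.

Lemma ip_cut f g : ip (cut f) g = ipw f g.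
Proof.
rewrite /ipw /L2ip /Rintegral; congr fine.
have m (u v : measurableTypeR R -> R) :
    measurable_fun setT u -> measurable_fun setT v -> measurable_fun setT
    ((fun x => (u x * v x)%:E) : measurableTypeR R -> \bar R).
  by move=> mu mv; apply/measurable_EFinP; apply: measurable_funM.
rewrite !integral_leb; [|exact: m|exact: m].
have sub : `]0, k[%classic `<=` (`]0, 1[%classic : set R).
  move=> x /=; rewrite !in_itv/= => /andP[-> xk]/=.
  by case/andP: k01 => _; exact: lt_trans.
rewrite -[in RHS](setIidr sub) integral_mkcondr.
apply: eq_integral => x _; rewrite cutE /patch indicE.
by case: ifPn => _; rewrite ?mul1r// !mul0r.
Qed.

Lemma ipw_le f : ipw f f <= ip f f.
Proof.
have nn (x : R) : (0 <= (f x * f x)%:E)%E by rewrite lee_fin -expr2 sqr_ge0.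
rewrite /ipw /L2ip /Rintegral fine_le//.
- exact: (integrable_fin_num measurableT (L2_mul_integrable (restr f) (restr f))).
- exact: (integrable_fin_num measurableT (L2_mul_integrable f f)).
apply: ge0_le_measure_integral => //.
- by case/andP: k01 => _ /ltW k1 A mA; apply: leb_sub.
- by apply/measurable_EFinP; apply: measurable_funM.
Qed.

Lemma L2norm_restr (f : L2 (0 : R) 1) : L2norm 0 k f = snorm ipw f.
Proof. exact: (L2norm_snorm (restr f)). Qed.

End Restriction.

(** * Absolutely continuous functions *)

Section Derivative.
Context {R : realType}.
Implicit Types (f g : R -> R) (x l : R).

(** A first-order expansion without quotients or one-sided cases, the form in which
covering arguments use differentiability. *)
Lemma is_deriveP f x l : is_derive x (1 : R) f l <->
  forall e, 0 < e -> exists2 d, 0 < d & forall y, `|y - x| < d ->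
    `|f y - f x - l * (y - x)| <= e * `|y - x|.
Proof.
split=> [[df dl] e e0|H].
- move: df; rewrite /derivable => /cvgrPdist_le /(_ e e0) [d /= d0 dP].
  exists d => // y yd.
  have [->|yx] := eqVneq y x; first by rewrite !subrr mulr0 subrr normr0 mulr0.
  have h0 : y - x != 0 by rewrite subr_eq0.
  have := dP (y - x); rewrite /ball_/= sub0r normrN => /(_ yd h0).
  rewrite -[lim _]/('D_1 f x) dl /= /GRing.scale/= mulr1 subrK => le.
  rewrite -ler_pdivrMr ?normr_gt0//; apply: le_trans le.
  rewrite -normfV -normrM distrC mulrBl mulfK// mulrC.
  exact: lexx.
- have cv : (fun h => h^-1 *: ((f \o shift x) (h *: 1) - f x)) @ 0^' --> l.
    apply/cvgrPdist_le => e e0; have [d d0 dP] := H e e0.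
    exists d => //= h; rewrite /ball_/= sub0r normrN => hd h0.
    have := dP (h + x); rewrite addrK => /(_ hd).
    rewrite -ler_pdivrMr ?normr_gt0// -normfV -normrM mulrBl mulfK// distrC.
    by rewrite /GRing.scale/= mulr1 (mulrC h^-1).
  by split; [apply/cvg_ex; exists l|exact: cvg_lim].
Qed.

End Derivative.

Section Chains.
Context {R : realType}.
Implicit Types (F G : R -> R) (a b e d x y : R) (s : seq (R * R)).
Local Notation mu := (@lebesgue_measure R).

(** Disjoint families are replaced by ordered lists of nonoverlapping intervals,
because those of adjacent intervals can be concatenated. *)
Fixpoint chain a b s : Prop :=
  if s is p :: s' then [/\ a <= p.1, p.1 <= p.2 & chain p.2 b s'] else a <= b.

Definition total_length s := \sum_(p <- s) (p.2 - p.1).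
Definition variation F s := \sum_(p <- s) `|F p.2 - F p.1|.

Lemma chain_le a b s : chain a b s -> a <= b.
Proof.
elim: s a => //= p s IH a [ap p12 /IH]; apply: le_trans.
exact: le_trans p12.
Qed.

Lemma chain_cat a b c s1 s2 : chain a b s1 -> chain b c s2 -> chain a c (s1 ++ s2).
Proof.
elim: s1 a => [|p s IH] a /=; last by move=> [ap p12 ps] /(IH _ ps).
by case: s2 => [|q s] ab /=; [exact: le_trans|move=> [bq *]; split=> //; exact: le_trans bq].
Qed.

Lemma chain_sub a b c d s : c <= a -> b <= d -> chain a b s -> chain c d s.
Proof.
elim: s c a => [|p s IH] c a ca bd /=.
  by move=> ab; exact: le_trans (le_trans ca ab) bd.
by move=> [ap p12 ps]; split => //; [exact: le_trans ap|exact: IH ps].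
Qed.

Lemma chain_mem a b s p : chain a b s -> p \in s -> [/\ a <= p.1, p.1 <= p.2 & p.2 <= b].
Proof.
elim: s a => //= q s IH a [aq q12 qs]; rewrite inE => /predU1P[->|ps].
  by split => //; exact: chain_le qs.
have [qp p12 pb] := IH _ qs ps; split => //.
by rewrite (le_trans aq)// (le_trans q12).
Qed.

Lemma chain_nth a b s i j : chain a b s -> (i < j < size s)%N ->
  (nth (0, 0) s i).2 <= (nth (0, 0) s j).1.
Proof.
elim: s a i j => //= [a i j _|p s IH a [|i] [|j] //=]; first by rewrite ltn0 andbF.
- move=> [ap p12 ps] js.
  by have [] := chain_mem ps (mem_nth (0, 0) (js : (j < size s)%N)).
- by move=> [ap p12 ps]; rewrite !ltnS; exact: IH ps.
Qed.

Definition chain_ac a b F := forall e, 0 < e -> exists2 d, 0 < d &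
  forall s, chain a b s -> total_length s < d -> variation F s < e.

Lemma abs_continuous_chain a b F : abs_continuous a b F -> chain_ac a b F.
Proof.
move=> FP e e0; have [d d0 dP] := FP e e0; exists d => // s cs.
rewrite /total_length /variation !(big_nth (0, 0)) !big_mkord; apply: dP.
  by move=> i; exact: chain_mem cs (mem_nth _ (ltn_ord i)).
apply/trivIsetP => i j _ _ ij; rewrite -subset0 => x [] /=.
rewrite !in_itv/= => /andP[xi xi'] /andP[xj xj'].
have [ij'|ji'|ij'] := ltngtP i j; last by move/eqP: ij; apply; exact: val_inj.
- have := chain_nth cs (_ : (i < j < size s)%N); rewrite ij' ltn_ord => /(_ isT).
  by rewrite leNgt (lt_trans xj xi').
- have := chain_nth cs (_ : (j < i < size s)%N); rewrite ji' ltn_ord => /(_ isT).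
  by rewrite leNgt (lt_trans xi xj').
Qed.

Lemma chain_ac_sub a b c d F : a <= c -> d <= b -> chain_ac a b F -> chain_ac c d F.
Proof.
move=> ac db FP e e0; have [h h0 hP] := FP e e0; exists h => // s cs.
by apply: hP; exact: chain_sub cs.
Qed.

Lemma chain_ac_lin a b k F G : chain_ac a b F -> chain_ac a b G ->
  chain_ac a b (fun x => k * F x + G x).
Proof.
move=> FP GP e e0.
have k0 : 0 < 2 * (`|k| + 1) by rewrite mulr_gt0// ltr_wpDl.
have [d1 d10 d1P] := FP _ (divr_gt0 e0 k0).
have [d2 d20 d2P] := GP _ (divr_gt0 e0 (ltr0n _ 2)).
exists (Num.min d1 d2); first by rewrite lt_min d10.
move=> s cs; rewrite lt_min => /andP[/(d1P _ cs) F1 /(d2P _ cs) G1].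
apply: (@le_lt_trans _ _ (`|k| * variation F s + variation G s)).
  rewrite /variation mulr_sumr -big_split/=; apply: ler_sum => p _.
  rewrite -normrM (le_trans _ (ler_normD _ _))//.
  by rewrite le_eqVlt; apply/orP/or_introl/eqP; congr (`|_|); ring.
have : `|k| * variation F s <= `|k| * (e / (2 * (`|k| + 1))).
  by rewrite ler_wpM2l// ltW.
have := scaled_half_le k e0.
lra.
Qed.

Lemma chain_ac_mul a b M F G :
  (forall x, a <= x <= b -> `|F x| <= M) -> (forall x, a <= x <= b -> `|G x| <= M) ->
  chain_ac a b F -> chain_ac a b G -> chain_ac a b (fun x => F x * G x).
Proof.
move=> FM GM FP GP e e0.
have M1 : 0 < 2 * (`|M| + 1) by rewrite mulr_gt0// ltr_wpDl.
have [d1 d10 d1P] := FP _ (divr_gt0 e0 M1).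
have [d2 d20 d2P] := GP _ (divr_gt0 e0 M1).
exists (Num.min d1 d2); first by rewrite lt_min d10.
move=> s cs; rewrite lt_min => /andP[/(d1P _ cs) F1 /(d2P _ cs) G1].
apply: (@le_lt_trans _ _ (`|M| * (variation F s + variation G s))).
  rewrite /variation -big_split mulr_sumr/= !big_seq; apply: ler_sum => p ps.
  have [ap p12 pb] := chain_mem cs ps.
  have -> : F p.2 * G p.2 - F p.1 * G p.1 =
    (F p.2 - F p.1) * G p.2 + F p.1 * (G p.2 - G p.1) by ring.
  rewrite (le_trans (ler_normD _ _))// !normrM mulrDr.
  apply: lerD; last first.
    rewrite ler_wpM2r// (le_trans (FM _ _)) ?ler_norm// ap/=.
    exact: le_trans p12 pb.
  rewrite mulrC ler_wpM2r// (le_trans (GM _ _)) ?ler_norm// pb andbT.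
  exact: le_trans ap p12.
have : `|M| * (variation F s + variation G s) <= `|M| * (e / (`|M| + 1)).
  rewrite ler_wpM2l//.
  have -> : e / (`|M| + 1) = e / (2 * (`|M| + 1)) + e / (2 * (`|M| + 1)).
    by field; rewrite gt_eqF// ltr_wpDl.
  by rewrite ltW// ltrD.
move=> /le_lt_trans; apply.
by rewrite mulrA ltr_pdivrMr ?ltr_wpDl// mulrC ltr_pM2l// ltrDl.
Qed.

Lemma lipschitz_chain_ac a b M F :
  (forall x y, a <= x -> x <= y -> y <= b -> `|F y - F x| <= M * (y - x)) ->
  chain_ac a b F.
Proof.
move=> FM e e0; have M1 : 0 < `|M| + 1 by rewrite ltr_wpDl.
exists (e / (`|M| + 1)); first exact: divr_gt0.
move=> s cs; rewrite ltr_pdivlMr//; apply: le_lt_trans.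
rewrite mulrC /total_length /variation mulr_sumr !big_seq; apply: ler_sum => p ps.
have [ap p12 pb] := chain_mem cs ps.
rewrite (le_trans (FM _ _ _ _ _))// ler_wpM2r ?subr_ge0//.
by rewrite (le_trans (ler_norm _))// lerDl.
Qed.

Lemma within_continuous_epsdelta a b F :
  (forall x, a <= x <= b -> forall e, 0 < e -> exists2 d, 0 < d &
    forall y, a <= y <= b -> `|y - x| < d -> `|F y - F x| < e) ->
  {within `[a, b], continuous F}.
Proof.
move=> FP; apply/subspace_continuousP => x /=; rewrite in_itv/= => xab.
apply/cvgrPdist_lt => e e0; have [d d0 dP] := FP x xab e e0.
exists d => //= y; rewrite /ball_/= distrC => yd; rewrite in_itv/= => yab.
by rewrite distrC; exact: dP.
Qed.

Lemma chain_ac_continuous a b F : chain_ac a b F -> {within `[a, b], continuous F}.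
Proof.
move=> FP; apply: within_continuous_epsdelta => x /andP[ax xb] e e0.
have [d d0 dP] := FP e e0; exists d => // y /andP[ay yb] yx.
have [xy|/ltW yx'] := leP x y.
  have := dP [:: (x, y)]; rewrite /total_length /variation !big_seq1/=.
  by apply => //; rewrite -[y - x]ger0_norm// subr_ge0.
have := dP [:: (y, x)]; rewrite /total_length /variation !big_seq1/= distrC.
by apply => //; rewrite -[x - y]ger0_norm ?subr_ge0// distrC.
Qed.

Lemma chain_ac_bounded a b F : chain_ac a b F -> exists M, forall x, a <= x <= b -> `|F x| <= M.
Proof.
move=> FP; have [ab|ba] := leP a b; last first.
  by exists 0 => x /andP[ax xb]; have := le_lt_trans (le_trans ax xb) ba; rewrite ltxx.
have cF := chain_ac_continuous FP.
have [c _ cP] := EVT_max ab cF; have [c' _ cP'] := EVT_min ab cF.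
exists (Num.max (F c) (- F c')) => x xab; rewrite ler_norml.
by rewrite lerNl !le_max lerN2 cP ?in_itv// cP' ?in_itv// orbT.
Qed.

(** The intervals are compared with the trace of [O] on [[a, b[], so that the
induction on the list can split the latter at the end of the first interval. *)
Lemma chain_measure a b s (O : set R) : open O -> chain a b s ->
  (forall p, p \in s -> forall x, p.1 <= x <= p.2 -> O x) ->
  ((total_length s)%:E <= mu (O `&` `[a, b[))%E.
Proof.
move=> oO; have mO : measurable (O : set (measurableTypeR R)) by exact: open_measurable.
elim: s a => [|p s IH] a /=; first by rewrite /total_length big_nil.
move=> [ap p12 ps] sO; rewrite /total_length big_cons EFinD -/(total_length s).
have pb := chain_le ps.
apply: (@le_trans _ _ (mu `[p.1, p.2[ + mu (O `&` `[p.2, b[))%E).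
  apply: leeD; last by apply: IH => // q qs; apply: sO; rewrite inE qs orbT.
  rewrite lebesgue_measure_itv/= lte_fin.
  move: p12; rewrite le_eqVlt => /predU1P[->|->]; last by [].
  by rewrite ltxx subrr.
rewrite -measureU//.
- apply: le_measure; rewrite ?inE.
  + by apply: measurableU => //; exact: measurableI.
  + exact: measurableI.
  + move=> x [/=|[Ox /=]]; rewrite in_itv/= => /andP[xl xr]; split => //=.
    * by apply: (sO p); rewrite ?mem_head// xl ltW.
    * by rewrite in_itv/= (le_trans ap xl) (lt_le_trans xr pb).
    * by rewrite in_itv/= xr andbT (le_trans ap)// (le_trans p12).
- exact: measurableI.
- rewrite -subset0 => x [] /=; rewrite in_itv/= => /andP[_ xp] [_ /=].
  by rewrite in_itv/= leNgt xp.
Qed.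

(** Cousin's lemma in the form of an induction principle; the supremum of the points
that can be reached from [a] is reached and cannot be interior. *)
Lemma interval_induction a b (Q : R -> R -> Prop) : a <= b ->
  (forall x, a <= x <= b -> exists2 d, 0 < d & forall u v,
    a <= u -> u <= x -> x <= v -> v <= b -> v - u < d -> Q u v) ->
  (forall x y z, Q x y -> Q y z -> Q x z) -> Q a b.
Proof.
move=> ab loc tr; pose S := [set x | a <= x <= b /\ Q a x].
have Sa : S a.
  split; first by rewrite lexx.
  by have [|d d0] := loc a; [rewrite lexx|apply; rewrite ?subrr].
have ubS : ubound S b by move=> x [/andP[]].
have hS : has_sup S by split; [exists a|exists b].
have supS x : S x -> x <= sup S by move=> Sx; exact: (ub_le_sup hS.2).
have ac : a <= sup S by exact: supS.
have cb : sup S <= b by apply: ge_sup => //; exists a.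
have [|d d0 dP] := loc (sup S); first by rewrite ac.
have d20 : 0 < d / 2 by rewrite divr_gt0.
have [x [/andP[ax xb] Qx] xc] := sup_adherent d20 hS.
have xs : x <= sup S by apply: supS; rewrite /S/= ax.
pose v := Num.min b (sup S + d / 2).
have sv : sup S <= v by rewrite le_min cb/= lerDl ltW.
have vb : v <= b by rewrite ge_min lexx.
have Qv : Q a v.
  apply: (tr _ _ _ Qx); apply: (dP _ _ ax xs sv vb).
  have : v <= sup S + d / 2 by rewrite ge_min lexx orbT.
  lra.
have : v <= sup S by apply: supS; split => //; rewrite (le_trans ac sv).
rewrite ge_min => /orP[bs|].
  by have -> : b = v by apply/le_anti; rewrite vb (le_trans bs sv).
by rewrite gerDl leNgt d20.
Qed.

(** Cut [[a, b]] into intervals about points where the derivative is controlled and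
intervals contained in an open set of small measure, whose total contribution is
small by absolute continuity. *)
Lemma chain_ac_mean_value a b K F : a <= b -> 0 <= K -> chain_ac a b F ->
  {ae leb a b, forall x, exists2 l, is_derive x (1 : R) F l & `|l| <= K} ->
  `|F b - F a| <= K * (b - a).
Proof.
move=> ab K0 FP [A [mA A0 AP]].
apply/ler_addgt0Pr => e e0.
have e20 : 0 < e / 2 by rewrite divr_gt0.
have [d d0 dP] := FP _ e20.
pose B : set (measurableTypeR R) := (A `&` `]a, b[) `|` ([set a] `|` [set b]).
have mAB : measurable (A `&` `]a, b[ : set (measurableTypeR R)).
  by apply: measurableI => //; exact: measurable_oo.
have mB : measurable B by apply: measurableU => //; apply: measurableU.
have B0 : mu B = 0%E.
  rewrite (measureU0 mAB); [exact: A0|exact: measurableU|].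
  rewrite measureU0//; exact: lebesgue_measure_set1.
have [|O [oO BO muO]] := lebesgue_regularity_outer mB _ d0.
  by apply: le_lt_trans (ltry (0 : R)); rewrite le_eqVlt; apply/orP/or_introl/eqP.
have mO : measurable (O : set (measurableTypeR R)) by exact: open_measurable.
have Od : (mu O < d%:E)%E.
  have OE : O = (O `\` B) `|` B by rewrite setUC setDUK.
  by apply: le_lt_trans muO; rewrite {1}OE measureU0//; exact: measurableD.
pose eta := e / 2 / (b - a + 1).
have ba1 : 0 < b - a + 1 by rewrite ltr_wpDl// subr_ge0.
have eta0 : 0 < eta by exact: divr_gt0.
pose Q u v := exists s, [/\ chain u v s,
  forall p, p \in s -> forall x, p.1 <= x <= p.2 -> O x &
  `|F v - F u| <= (K + eta) * (v - u) + variation F s].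
have : Q a b.
  apply: interval_induction => //.
    move=> x /andP[ax xb]; have [Ox|NOx] := pselect (O x).
      have [/= r r0 rO] := (oO x Ox : nbhs x O).
      exists r => // u v au ux xv vb uv; exists [:: (u, v)]; split => /=.
      + by split => //; rewrite (le_trans ux).
      + move=> p; rewrite inE => /eqP -> /= y /andP[uy yv]; apply: rO.
        by rewrite /ball/= ltr_norml; apply/andP; split; lra.
      + rewrite /variation big_seq1 lerDr mulr_ge0 ?(addr_ge0 K0 (ltW eta0))//.
        by rewrite subr_ge0 (le_trans ux).
    have [l dx lK] : exists2 l, is_derive x (1 : R) F l & `|l| <= K.
      apply: contrapT => nd; apply: NOx; apply: BO.
      have [xa|xa] := eqVneq x a; first by right; left.
      have [xb'|xb'] := eqVneq x b; first by right; right.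
      left; split; first exact: AP.
      by rewrite /= in_itv/= !lt_neqAle eq_sym xa ax xb' xb.
    have [r r0 rP] := (is_deriveP _ _ _).1 dx _ eta0.
    exists r => // u v au ux xv vb uv; exists [::]; split => //=.
      exact: le_trans xv.
    rewrite /variation big_nil addr0.
    have near_x y : `|y - x| < r -> `|F y - F x| <= (K + eta) * `|y - x|.
      move=> /rP yr; rewrite -[F y - F x](subrK (l * (y - x))).
      rewrite (le_trans (ler_normD _ _))// mulrDl addrC lerD// normrM.
      by rewrite ler_wpM2r.
    have : `|F v - F x| <= (K + eta) * (v - x).
      have := near_x v; rewrite ger0_norm ?subr_ge0//; apply.
      by rewrite (le_lt_trans _ uv)// lerB.
    have : `|F x - F u| <= (K + eta) * (x - u).
      have := near_x u; rewrite (distrC u) (distrC (F u)) ger0_norm ?subr_ge0//; apply.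
      by rewrite (le_lt_trans _ uv)// lerB.
    have := ler_normD (F v - F x) (F x - F u); rewrite addrA subrK.
    lra.
  move=> x y z [s [cs sO sF]] [s' [cs' sO' sF']]; exists (s ++ s'); split.
  - exact: chain_cat cs cs'.
  - by move=> p; rewrite mem_cat => /orP[/sO|/sO'].
  - rewrite /variation big_cat/= -!/(variation F _).
    by have := ler_normD (F z - F y) (F y - F x); rewrite addrA subrK; lra.
move=> [s [cs sO sF]]; apply: (le_trans sF).
have sd : total_length s < d.
  rewrite -lte_fin (le_lt_trans _ Od)// (le_trans (chain_measure oO cs sO))//.
  by apply: le_measure; rewrite ?inE//; exact: measurableI.
have := dP s cs sd.
have : eta * (b - a) <= e / 2.
  by rewrite /eta mulrAC ler_pdivrMr// ler_wpM2l ?(ltW e20)// lerDl.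
lra.
Qed.

Lemma chain_ac_null_derivative a b F : a <= b -> chain_ac a b F ->
  {ae leb a b, forall x, is_derive x (1 : R) F 0} -> F b = F a.
Proof.
move=> ab FP dF; apply/eqP; rewrite -subr_eq0 -normr_le0 -(mul0r (b - a)).
apply: chain_ac_mean_value => //; apply: ae_leb_imp dF => x _ dx.
by exists 0 => //; rewrite normr0.
Qed.

(** An almost everywhere derivative which is continuous at [x] is a genuine
derivative there: apply the mean value inequality to [F - f x *: id]. *)
Lemma chain_ac_derivative a b F f x : chain_ac a b F -> a < x < b ->
  {for x, continuous f} -> {ae leb a b, forall x, is_derive x (1 : R) F (f x)} ->
  is_derive x (1 : R) F (f x).
Proof.
move=> FP /andP[ax xb] /cvgrPdist_le cf dF; apply/is_deriveP => e e0.
have [d0 /= d00 d0P] := cf e e0.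
pose d := Num.min d0 (Num.min (x - a) (b - x)).
have d_gt0 : 0 < d by rewrite !lt_min d00 !subr_gt0 ax.
have key u v : u <= v -> `|u - x| < d -> `|v - x| < d ->
    `|F v - F u - f x * (v - u)| <= e * (v - u).
  move=> uv; rewrite !ltr_norml => /andP[u1 u2] /andP[v1 v2].
  have d1 : d <= d0 by rewrite ge_min lexx.
  have d2 : d <= x - a by rewrite !ge_min lexx orbT.
  have d3 : d <= b - x by rewrite !ge_min lexx !orbT.
  have Fuv : chain_ac u v F by apply: chain_ac_sub FP; lra.
  have Iuv : chain_ac u v id.
    apply: (@lipschitz_chain_ac _ _ 1) => s t _ st _; rewrite mul1r ger0_norm ?subr_ge0//.
  have := chain_ac_lin (- f x) Iuv Fuv => /(chain_ac_mean_value uv (ltW e0)).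
  rewrite (_ : _ - _ = F v - F u - f x * (v - u)); last by rewrite /=; ring.
  apply; apply: (@ae_leb_imp _ _ _ (fun y => is_derive y (1 : R) F (f y))); last first.
    by apply: ae_leb_sub dF; lra.
  move=> y /andP[uy yv] dy; exists (f y - f x); last first.
    by rewrite distrC; apply: d0P; rewrite /ball_/= ltr_norml; apply/andP; split; lra.
  rewrite (_ : (fun _ => _) = F - f x \*: (id : R -> R)); last first.
    by apply/funext => z /=; rewrite mulNr addrC.
  apply: (is_derive_eq (is_deriveB dy _)).
  by rewrite /GRing.scale/= mulr1.
exists d => // y yx; have d'x : `|x - x| < d by rewrite subrr normr0.
have [xy|/ltW xy] := leP x y.
  by rewrite [`|y - x|]ger0_norm ?subr_ge0// key.
have := key y x xy yx d'x; rewrite (distrC y) [`|x - y|]ger0_norm ?subr_ge0//.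
rewrite -normrN; congr (`|_| <= _); ring.
Qed.

End Chains.

(** * The fundamental theorem of calculus *)

Section FTC.
Context {R : realType}.
Implicit Types (F G H f : R -> R) (a b x y : R).
Local Notation mu := (@lebesgue_measure R).

Lemma chain_increment a b H s : {homo H : x y / x <= y} -> chain a b s ->
  \sum_(p <- s) (H p.2 - H p.1) <= H b - H a.
Proof.
move=> Hm; elim: s a => [|p s IH] a /=; first by rewrite big_nil subr_ge0 => /Hm.
move=> [ap p12 /IH ps]; rewrite big_cons.
by have := Hm _ _ ap; lra.
Qed.

(** A criterion suited to the primitive [G] of a square integrable [f], with [H] that
of [f ^+ 2]: since [|f| <= h * f ^+ 2 + (4 * h)^-1] the increments of [G] are
controlled by those of [H], with a weight as small as desired. *)
Lemma control_chain_ac a b G H : {homo H : x y / x <= y} ->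
  (forall h, 0 < h -> exists C, forall x y, x <= y ->
    `|G y - G x| <= h * (H y - H x) + C * (y - x)) ->
  chain_ac a b G.
Proof.
move=> Hm GH e e0; pose S := `|H b - H a| + 1.
have S0 : 0 < S by rewrite ltr_wpDl.
have h0 : 0 < e / (2 * S) by rewrite divr_gt0// mulr_gt0.
have [C CP] := GH _ h0.
have C0 : 0 < `|C| + 1 by rewrite ltr_wpDl.
exists (e / (2 * (`|C| + 1))); first by rewrite divr_gt0// mulr_gt0.
move=> s cs; rewrite ltr_pdivlMr ?mulr_gt0// => sd.
apply: (@le_lt_trans _ _ (e / (2 * S) * \sum_(p <- s) (H p.2 - H p.1)
    + (`|C| + 1) * total_length s)).
  rewrite /variation /total_length !mulr_sumr -big_split/= !big_seq.
  apply: ler_sum => p ps; have [ap p12 pb] := chain_mem cs ps.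
  rewrite (le_trans (CP _ _ p12))// lerD2l ler_wpM2r ?subr_ge0//.
  by rewrite (le_trans (ler_norm _))// lerDl.
have : e / (2 * S) * \sum_(p <- s) (H p.2 - H p.1) <= e / 2.
  rewrite invfM mulrA -[leRHS]mulr1 -mulrA ler_wpM2l ?divr_ge0 ?(ltW e0)//.
  rewrite mulrC ler_pdivrMr// mul1r (le_trans (chain_increment Hm cs))//.
  by rewrite (le_trans (ler_norm _))// lerDl.
lra.
Qed.

Lemma integrable_leb a b f : (leb a b).-integrable setT (EFin \o f) ->
  mu.-integrable `]a, b[ (EFin \o f).
Proof.
move=> /integrableP[mf foo]; apply/integrableP; split.
  exact: measurable_funTS.
move: foo; rewrite integral_leb//.
exact: measurableT_comp.
Qed.

Lemma Lfun2_integrable a b f : f \in Lfun (leb a b) 2%:E ->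
  (leb a b).-integrable setT (EFin \o f).
Proof.
move=> fL; apply/Lfun1_integrable; apply: Lfun_subset12 fL.
by rewrite ge0_fin_numE// lebT_fin.
Qed.

Lemma Rintegral_leb a b f : measurable_fun setT (f : measurableTypeR R -> R) ->
  \int[leb a b]_x f x = \int[mu]_(x in `]a, b[) f x.
Proof. by move=> mf; rewrite /Rintegral integral_leb//; exact/measurable_EFinP. Qed.

Lemma primitive_chain_ac a b c d f : mu.-integrable setT (EFin \o f) ->
  mu.-integrable setT (EFin \o (fun x => f x ^+ 2)) ->
  (forall x y, x <= y -> \int[mu]_(t in `]-oo, y]) f t - \int[mu]_(t in `]-oo, x]) f t
     = \int[mu]_(t in `]x, y]) f t) /\
  chain_ac c d (fun x => \int[mu]_(t in `]-oo, x]) f t).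
Proof.
move=> fi f2i.
have itvB (g : R -> R) x y : mu.-integrable setT (EFin \o g) -> x <= y ->
    \int[mu]_(t in `]-oo, y]) g t - \int[mu]_(t in `]-oo, x]) g t
     = \int[mu]_(t in `]x, y]) g t.
  move=> gi xy; rewrite Rintegral_itvB ?bnd_simp//.
  exact: integrableS gi.
split=> [x y|]; first exact: itvB.
apply: (@control_chain_ac c d _ (fun x => \int[mu]_(t in `]-oo, x]) (f t ^+ 2))).
  move=> x y xy; rewrite -subr_ge0 itvB// Rintegral_ge0// => t _.
  exact: sqr_ge0.
move=> h h0; exists (4 * h)^-1 => x y xy; rewrite !itvB//.
have mI : measurable (`]x, y] : set (measurableTypeR R)) by exact: measurable_itv.
have fI : mu.-integrable `]x, y] (EFin \o f) by exact: integrableS fi.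
have f2I : mu.-integrable `]x, y] (EFin \o (fun x => f x ^+ 2)) by exact: integrableS f2i.
have cI : mu.-integrable `]x, y] (EFin \o (fun=> (4 * h)^-1)).
  apply/integrableP; split; first exact: measurable_cst.
  under eq_integral do rewrite /=.
  rewrite (@integral_cst _ _ _ mu _ mI `|(4 * h)^-1|%:E).
  rewrite /= lebesgue_measure_itv/= lte_fin.
  by case: ifP => _; rewrite ?mule0// -EFinB -EFinM ltry.
have hI : mu.-integrable `]x, y] (EFin \o (fun x => h * f x ^+ 2)).
  have := integrableZl mI h f2I; apply: eq_integrable => // t _.
apply: (le_trans (le_normr_Rintegral mI fI)).
rewrite (_ : _ * _ + _ * _ = \int[mu]_(t in `]x, y]) (h * f t ^+ 2 + (4 * h)^-1)); last first.
  rewrite RintegralD// RintegralZl// Rintegral_cst//; congr (_ + _ * _).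
  rewrite /= lebesgue_measure_itv/= lte_fin.
  by move: xy; rewrite le_eqVlt => /predU1P[->|->]//; rewrite ltxx subrr.
apply: le_Rintegral => //.
- exact: (integrable_abse fI).
- by have := integrableD mI hI cI; apply: eq_integrable.
- move=> t _; rewrite -subr_ge0 -(real_normK (num_real (f t))).
  have -> : h * `|f t| ^+ 2 + (4 * h)^-1 - `|f t| = (2 * h * `|f t| - 1) ^+ 2 / (4 * h).
    by field; rewrite gt_eqF.
  by rewrite divr_ge0 ?sqr_ge0// mulr_ge0// ltW.
Qed.

(** By Lebesgue's differentiation theorem, the difference of [F] and of a primitive
of [f] has a null derivative almost everywhere; being absolutely continuous, it is
constant. *)
Lemma chain_ac_FTC a b F f : a <= b -> chain_ac a b F ->
  f \in Lfun (leb a b) 2%:E ->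
  {ae leb a b, forall x, is_derive x (1 : R) F (f x)} ->
  F b - F a = \int[leb a b]_x f x.
Proof.
move=> ab FP fL dF.
have fm : measurable_fun setT (f : measurableTypeR R -> R).
  by move: fL; rewrite inE => /andP[]; rewrite inE.
have mI := measurable_oo a b.
pose f0 := f \_ `]a, b[.
have f0i : mu.-integrable setT (EFin \o f0).
  rewrite /f0 -restrict_EFin; apply/(integrable_mkcond _ mI).
  by apply: integrable_leb; exact: Lfun2_integrable.
have f02i : mu.-integrable setT (EFin \o (fun x => f0 x ^+ 2)).
  have := integrable_leb (Lfun2_integrable_sqr fL) => /(integrable_mkcond _ mI).
  apply: eq_integrable => // x _; rewrite /f0 /= /patch.
  by case: ifP => // _; rewrite expr0n.
have [GB Gac] := primitive_chain_ac a b a b f0i f02i.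
set G := (fun x => _) in Gac.
have dG : {ae leb a b, forall x, is_derive x (1 : R) G (f0 x)}.
  apply: ae_leb_lebesgue.
  have := @FTC1Ny R f0 _ _; move=> /(_ _ _)[].
  - by move=> y; exact: integrableS f0i.
    by apply: open_integrable_locally => //; exact: openT.
  move=> A [mA A0 AP]; exists A; split => // x /= nd; apply: AP => /= dx.
  by apply: nd; case: dx => dx1 dx2; split; [exact: dx1|rewrite -derive1E; exact: dx2].
have dFG : {ae leb a b, forall x, is_derive x (1 : R) (fun x => -1 * G x + F x) 0}.
  apply: ae_leb_imp2 dF dG => x xab dFx dGx.
  rewrite (_ : (fun x => _) = F - G); last by apply/funext => y /=; rewrite mulN1r addrC.
  apply: (is_derive_eq (is_deriveB dFx dGx)).
  by rewrite /f0 patchE mem_set ?subrr//= in_itv.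
have := chain_ac_null_derivative ab (chain_ac_lin (-1) Gac FP) dFG.
move=> /eqP; rewrite -subr_eq0 => /eqP H.
have -> : F b - F a = G b - G a by lra.
rewrite /G GB// Rintegral_leb//.
rewrite -Rintegral_itv_bndo_bndc; last first.
  by apply: integrableS f0i => //; exact: measurable_oo.
by apply: eq_Rintegral => x; rewrite /f0 patchE => ->.
Qed.

End FTC.

(** * Square integrability and mean values *)

Section Lfun2.
Context {R : realType}.
Implicit Types (f g : R -> R) (a b c d x y : R).
Local Notation mu := (@lebesgue_measure R).

Lemma Lfun2P a b f : f \in Lfun (leb a b) 2%:E <->
  measurable_fun setT (f : measurableTypeR R -> R) /\
  (\int[leb a b]_x (f x ^+ 2)%:E < +oo)%E.
Proof.
split=> [fL|[mf foo]].
  split; first by move: fL; rewrite inE => /andP[]; rewrite inE.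
  have /integrableP[_] := Lfun2_integrable_sqr fL.
  by under eq_integral do rewrite /= ger0_norm ?sqr_ge0//.
apply/andP; split; rewrite inE//= /finite_norm unlock poweR_lty//.
by under eq_integral do rewrite /= powR_mulrn// real_normK ?num_real//.
Qed.

Lemma measurable_sqr f : measurable_fun setT (f : measurableTypeR R -> R) ->
  measurable_fun setT ((fun x => (f x ^+ 2)%:E) : measurableTypeR R -> \bar R).
Proof. by move=> mf; apply/measurable_EFinP; exact: measurable_funX. Qed.

Lemma Lfun2_ae_le a b f g M : 0 <= M -> f \in Lfun (leb a b) 2%:E ->
  measurable_fun setT (g : measurableTypeR R -> R) ->
  {ae leb a b, forall x, `|g x| <= M * `|f x|} -> g \in Lfun (leb a b) 2%:E.
Proof.
move=> M0 /Lfun2P[mf foo] mg gf; apply/Lfun2P; split => //.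
apply: (@le_lt_trans _ _ (\int[leb a b]_x ((M ^+ 2)%:E * (f x ^+ 2)%:E))%E).
  apply: ae_ge0_le_integral => //.
  - by move=> x _; rewrite lee_fin sqr_ge0.
  - exact: measurable_sqr.
  - by move=> x _; rewrite -EFinM lee_fin mulr_ge0// sqr_ge0.
  - by apply: emeasurable_funM => //; exact: measurable_sqr.
  - apply: ae_leb_imp gf => x _ gf _; rewrite -EFinM lee_fin -exprMn.
    rewrite -(real_normK (num_real (g x))) -(real_normK (num_real (_ * _))).
    by rewrite ler_sqr ?nnegrE// normrM (ger0_norm M0).
rewrite ge0_integralZl//.
- by rewrite lte_mul_pinfty// lee_fin sqr_ge0.
- exact: measurable_sqr.
- by move=> x _; rewrite lee_fin sqr_ge0.
- by rewrite lee_fin sqr_ge0.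
Qed.

Lemma Lfun2_cst a b c : cst c \in Lfun (leb a b) 2%:E.
Proof.
apply/Lfun2P; split; first exact: measurable_cst.
rewrite (@integral_cst _ _ _ (leb a b) _ measurableT (c ^+ 2)%:E).
by rewrite lte_mul_pinfty// ?lee_fin ?sqr_ge0//; exact: lebT_fin.
Qed.

Lemma Lfun2_bounded a b f M : measurable_fun setT (f : measurableTypeR R -> R) ->
  (forall x, a < x < b -> `|f x| <= M) -> f \in Lfun (leb a b) 2%:E.
Proof.
move=> mf fM; apply: (@Lfun2_ae_le _ _ (cst 1) f `|M|) => //.
  exact: Lfun2_cst.
by apply: ae_leb_itv => x /fM; rewrite /= normr1 mulr1 => /le_trans; apply; exact: ler_norm.
Qed.

Lemma Lfun2_sub a b c d f : a <= c -> d <= b -> f \in Lfun (leb a b) 2%:E ->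
  f \in Lfun (leb c d) 2%:E.
Proof.
move=> ac db /Lfun2P[mf foo]; apply/Lfun2P; split => //; apply: le_lt_trans foo.
apply: ge0_le_measure_integral => //; last exact: measurable_sqr.
- by move=> A mA; exact: leb_sub.
- by move=> x; rewrite lee_fin sqr_ge0.
Qed.

Definition L2sub a b c d (ac : a <= c) (db : d <= b) (f : L2 a b) : L2 c d :=
  Lfun_Sub (lee1n 2) (Lfun2_sub ac db (LfunP f)).

Lemma L2sub_le a b c d (ac : a <= c) (db : d <= b) (f : L2 a b) :
  snorm (@L2ip R c d) (L2sub ac db f) <= snorm (@L2ip R a b) f.
Proof.
apply: ler_wsqrtr; rewrite /L2ip /Rintegral fine_le//.
- exact: (integrable_fin_num measurableT (L2_mul_integrable (L2sub ac db f) (L2sub ac db f))).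
- exact: (integrable_fin_num measurableT (L2_mul_integrable f f)).
apply: ge0_le_measure_integral => //.
- by move=> A mA; exact: leb_sub.
- by move=> x /=; rewrite lee_fin -expr2 sqr_ge0.
- by apply/measurable_EFinP; apply: measurable_funM.
Qed.

Definition L2cst a b c : L2 a b := Lfun_Sub (lee1n 2) (Lfun2_cst a b c).

Lemma leb_setT a b : a <= b -> leb a b setT = (b - a)%:E.
Proof.
move=> ab; rewrite /leb /= /mrestr setTI lebesgue_measure_itv/= lte_fin.
by move: ab; rewrite le_eqVlt => /predU1P[->|->]; rewrite ?ltxx ?subrr// EFinB.
Qed.

Lemma L2ip_cst a b c c' : a <= b -> L2ip (L2cst a b c) (L2cst a b c') = c * c' * (b - a).
Proof.
move=> ab; transitivity (\int[leb a b]_(x in setT) (c * c')) => //.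
by rewrite Rintegral_cst// leb_setT.
Qed.

Lemma Rintegral_L2_le a b (f : L2 a b) : a <= b ->
  `|\int[leb a b]_x f x| <= Num.sqrt (b - a) * snorm (@L2ip R a b) f.
Proof.
move=> ab; have -> : \int[leb a b]_x f x = L2ip (L2cst a b 1) f.
  by apply: eq_Rintegral => x _; rewrite /= mul1r.
apply: le_trans (cauchy_schwarz (L2ip_semi_inner a b) _ _) _.
by rewrite {1}/snorm L2ip_cst// !mul1r.
Qed.

Lemma L2_sqr_ge0 a b (f : L2 a b) x : setT x -> (0 <= (f x * f x)%:E)%E.
Proof. by move=> _; rewrite lee_fin -expr2 sqr_ge0. Qed.

Lemma L2_sqr_measurable a b (f : L2 a b) :
  measurable_fun setT ((fun x => (f x * f x)%:E) : measurableTypeR R -> \bar R).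
Proof. by apply/measurable_EFinP; apply: measurable_funM. Qed.

(** Used in contrapositive form, to find a point where [f] is not larger than its
mean square. *)
Lemma L2_lower_bound a b (f : L2 a b) c : a <= b -> 0 <= c ->
  {ae leb a b, forall x, c <= `|f x|} ->
  c ^+ 2 * (b - a) <= snorm (@L2ip R a b) f ^+ 2.
Proof.
move=> ab c0 cf; rewrite (snorm_sqr (L2ip_semi_inner a b)).
have -> : c ^+ 2 * (b - a) = L2ip (L2cst a b c) (L2cst a b c) by rewrite L2ip_cst.
rewrite /L2ip /Rintegral fine_le//.
- exact: (integrable_fin_num measurableT (L2_mul_integrable (L2cst a b c) (L2cst a b c))).
- exact: (integrable_fin_num measurableT (L2_mul_integrable f f)).
apply: ae_ge0_le_integral => //; try exact: L2_sqr_ge0; try exact: L2_sqr_measurable.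
apply: ae_leb_imp cf => x _ cf _; rewrite lee_fin -!expr2.
by rewrite -(real_normK (num_real (f x))) ler_sqr ?nnegrE.
Qed.

Lemma L2_upper_bound a b (f : L2 a b) c : a <= b ->
  {ae leb a b, forall x, `|f x| <= c} -> snorm (@L2ip R a b) f ^+ 2 <= c ^+ 2 * (b - a).
Proof.
move=> ab cf; rewrite (snorm_sqr (L2ip_semi_inner a b)).
have -> : c ^+ 2 * (b - a) = L2ip (L2cst a b c) (L2cst a b c) by rewrite L2ip_cst.
rewrite /L2ip /Rintegral fine_le//.
- exact: (integrable_fin_num measurableT (L2_mul_integrable f f)).
- exact: (integrable_fin_num measurableT (L2_mul_integrable (L2cst a b c) (L2cst a b c))).
apply: ae_ge0_le_integral => //; try exact: L2_sqr_ge0; try exact: L2_sqr_measurable.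
apply: ae_leb_imp cf => x _ cf _; rewrite lee_fin -!expr2.
by rewrite -(real_normK (num_real (f x))) ler_sqr ?nnegrE// (le_trans _ cf).
Qed.

End Lfun2.

(** * Green's formula and regularity in the domain *)

Section Operator.
Context {R : realType} (alpha beta0 beta1 : R).
Hypothesis beta1_neq0 : beta1 != 0.
Local Notation op := (opA alpha beta0 beta1).

(** The function [W * U' - W' * U] has derivative [f * v - g * u]; it vanishes at
[1] by the Dirichlet condition and at [0] because the boundary condition makes
[W 0] and [W' 0] the same multiple of [U 0] and [U' 0]. *)
Lemma opA_sym (u f v g : L2 (0 : R) 1) : op u f -> op v g -> L2ip f v = L2ip u g.
Proof.
move=> [U [V [W [uU [[Uac dU VL U1] WV [Wac dW fL]] bU]]]].
move=> [U' [V' [W' [vU [[U'ac dU' V'L U'1] W'V' [W'ac dW' gL]] bU']]]].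
have [M MP] := chain_ac_bounded (abs_continuous_chain Uac).
have [M' MP'] := chain_ac_bounded (abs_continuous_chain U'ac).
have [N NP] := chain_ac_bounded (abs_continuous_chain Wac).
have [N' NP'] := chain_ac_bounded (abs_continuous_chain W'ac).
have WU' : chain_ac 0 1 (fun x => W x * U' x).
  apply: (@chain_ac_mul _ _ _ (Num.max N M')); try exact: abs_continuous_chain.
    by move=> x /NP; rewrite le_max => ->.
  by move=> x /MP'; rewrite le_max orbC => ->.
have W'U : chain_ac 0 1 (fun x => W' x * U x).
  apply: (@chain_ac_mul _ _ _ (Num.max N' M)); try exact: abs_continuous_chain.
    by move=> x /NP'; rewrite le_max => ->.
  by move=> x /MP; rewrite le_max orbC => ->.
have Phi := chain_ac_lin (-1) W'U WU'.
have prodL (h w : L2 (0 : R) 1) (K : R) (Uw : R -> R) :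
    (forall x, 0 <= x <= 1 -> `|Uw x| <= K) -> {ae leb 0 1, forall x : R, w x = Uw x} ->
    (fun x => h x * w x) \in Lfun (leb 0 1) 2%:E.
  move=> KP wU; apply: (@Lfun2_ae_le _ _ _ h _ `|K|) => //; first exact: LfunP.
    exact: measurable_funM.
  apply: ae_leb_imp wU => x /andP[x0 x1] ->; rewrite normrM mulrC ler_wpM2r//.
  by rewrite (le_trans (KP _ _)) ?ler_norm// !ltW.
pose P1 : L2 (0 : R) 1 := Lfun_Sub (lee1n 2) (prodL f v _ _ MP' vU).
pose P2 : L2 (0 : R) 1 := Lfun_Sub (lee1n 2) (prodL g u _ _ MP uU).
have dPhi : {ae leb 0 1, forall x,
    is_derive x (1 : R) (fun x => -1 * (W' x * U x) + W x * U' x) ((P1 - P2) x)}.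
  have := ae_leb_and (ae_leb_and uU vU) (ae_leb_and WV W'V').
  move=> /ae_leb_and /(_ (ae_leb_and (ae_leb_and dU dU') (ae_leb_and dW dW'))).
  apply: ae_leb_imp => x x01 [[[uUx vUx] [WVx W'Vx]] [[dUx dU'x] [dWx dW'x]]].
  rewrite (_ : (fun x => _) = W * U' - W' * U); last first.
    by apply/funext => y; rewrite /= mulN1r addrC.
  apply: (is_derive_eq (is_deriveB (is_deriveM dWx dU'x) (is_deriveM dW'x dUx))).
  have -> : (P1 - P2) x = f x * v x - g x * u x by [].
  by rewrite /GRing.scale/= vUx uUx WVx W'Vx; ring.
have := chain_ac_FTC ler01 Phi (LfunP (P1 - P2)) dPhi.
rewrite U1 U'1 !mulr0 addr0 sub0r.
have -> : - (-1 * (W' 0 * U 0) + W 0 * U' 0) = 0.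
  have E : W 0 = beta0 / beta1 * U 0.
    by apply: (mulfI beta1_neq0); rewrite mulrA mulrCA mulfV// mulr1; lra.
  have E' : W' 0 = beta0 / beta1 * U' 0.
    by apply: (mulfI beta1_neq0); rewrite mulrA mulrCA mulfV// mulr1; lra.
  by rewrite E E'; ring.
rewrite /L2ip RintegralB//; [|exact: L2_mul_integrable f v|exact: L2_mul_integrable g u].
move=> /esym/eqP; rewrite subr_eq0 => /eqP ->.
by apply: eq_Rintegral => x _; rewrite mulrC.
Qed.

End Operator.

Section Regularity.
Context {R : realType} (alpha beta0 beta1 : R).
Hypothesis alpha01 : 0 < alpha < 1.
Local Notation op := (opA alpha beta0 beta1).
Local Notation nrm := (snorm (@L2ip R 0 1)).

Lemma is_derive_continuous (f : R -> R) (x l : R) :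
  is_derive x (1 : R) f l -> {for x, continuous f}.
Proof. by move=> [df _]; apply/differentiable_continuous/derivable1_diffP. Qed.

Lemma within_continuousT a b c d (f : R -> R) : a <= c -> d <= b ->
  {within `[a, b], continuous f} -> {within `[c, d], continuous f}.
Proof.
move=> ac db; apply: continuous_subspaceW => x /=; rewrite !in_itv/= => /andP[cx xd].
by rewrite (le_trans ac)// (le_trans xd).
Qed.

Lemma powRNalpha_ge1 (x : R) : 0 < x <= 1 -> 1 <= x `^ (- alpha).
Proof.
case/andP: alpha01 => a0 a1 x01.
by rewrite -(powRr0 x); apply: ger_powR => //; lra.
Qed.

Lemma powRNalpha_le (r x : R) : 0 < r -> r <= x <= 1 -> x `^ (- alpha) <= r^-1.
Proof.
move=> r0 /andP[rx x1]; have x0 : 0 < x by exact: lt_le_trans rx.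
case/andP: alpha01 => a0 a1.
apply: (@le_trans _ _ (x^-1)); last by rewrite lef_pV2.
by rewrite -powR_inv1 ?(ltW x0)//; apply: ger_powR; [rewrite x0|lra].
Qed.

(** Pointwise bounds by the graph norm. The flux [W] oscillates by at most the
norm of [f], so that it is enough to bound it at one point. In [(1/4, 1/2)] there is
a point [y] where [U] is bounded by the norm of [u]; as [U] vanishes at [1], the mean
value theorem turns this into a bound on [W] at some point of [(y, 1)]. The bound
on [U] follows by the mean value theorem again, and degenerates only near [0]. *)
Lemma opA_regular (u f : L2 (0 : R) 1) : op u f -> exists U W : R -> R,
  [/\ {ae leb 0 1, forall x : R, u x = U x},
      {within `[0, 1], continuous U} /\ U 1 = 0,
      chain_ac 0 1 W /\ {ae leb 0 1, forall x : R, is_derive x (1 : R) W (f x)},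
      forall x : R, 0 < x < 1 -> is_derive x (1 : R) U (x `^ (- alpha) * W x) &
      (forall x : R, 0 < x < 1 -> `|W x| <= 4 * nrm u + nrm f) /\
      (forall r x : R, 0 < r -> r <= x < 1 -> `|U x| <= r^-1 * (4 * nrm u + nrm f))].
Proof.
case/andP: (alpha01) => a0 a1.
move=> [U [V [W [uU [[/abs_continuous_chain Uac dU VL U1] WV H1W] bU]]]].
have [/abs_continuous_chain Wac dW fL] := H1W.
have cU := chain_ac_continuous Uac.
have cW := chain_ac_continuous Wac.
have dUW (x : R) : 0 < x < 1 -> is_derive x (1 : R) U (x `^ (- alpha) * W x).
  move=> x01; apply: (@chain_ac_derivative _ 0 1 U (fun x => x `^ (- alpha) * W x)) => //.
    case/andP: (x01) => x0 _; apply: cvgM.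
      exact: (is_derive_continuous (is_derive1_powR _ x0)).
    by apply: (within_continuous_continuous ltr01 cW); rewrite in_itv.
  apply: ae_leb_imp2 dU WV => y /andP[y0 _] dy ->; rewrite mulrA -powRD ?addNr ?powRr0 ?mul1r//.
  by rewrite eqxx/= gt_eqF.
have Winc (x y : R) : 0 < x -> x <= y -> y < 1 -> `|W y - W x| <= nrm f.
  move=> x0 xy y1; have x0' := ltW x0; have y1' := ltW y1.
  have Wxy : chain_ac x y W by exact: chain_ac_sub Wac.
  have fxy := Lfun2_sub x0' y1' (LfunP f).
  rewrite (chain_ac_FTC xy Wxy fxy); last exact: ae_leb_sub dW.
  rewrite (le_trans (Rintegral_L2_le (L2sub x0' y1' f) xy))//.
  apply: le_trans (L2sub_le x0' y1' f); rewrite ler_piMl ?snorm_ge0//.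
  by rewrite -sqrtr1 ler_wsqrtr//; lra.
have UMVT (x : R) : 0 < x < 1 -> exists2 t, x < t < 1 &
    - U x = t `^ (- alpha) * W t * (1 - x).
  move=> /andP[x0 x1].
  have [||t tx] := @MVT R U (fun x => x `^ (- alpha) * W x) x 1 x1.
  - move=> t; rewrite in_itv/= => /andP[xt t1]; apply: dUW.
    by rewrite (lt_trans x0 xt).
  - by apply: within_continuousT cU => //; exact: ltW.
  - by rewrite U1 sub0r; exists t => //; move: tx; rewrite in_itv.
have Wb (x : R) : 0 < x < 1 -> `|W x| <= 4 * nrm u + nrm f.
  move=> /andP[x0 x1]; apply/ler_addgt0Pr => e e0.
  (* If [U] exceeded [c] throughout [(1/4, 1/2)], the norm of [u] would be at least
  [c / 2], which is more than [nrm u]. *)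
  pose c := 2 * nrm u + e / 4.
  have u0 := snorm_ge0 (@L2ip R 0 1) u.
  have c0 : 0 <= c by rewrite /c; lra.
  have [y [y14 yc]] : exists y, 4^-1 < y < 2^-1 /\ `|U y| <= c.
    apply: contrapT => nex.
    have a4 : 0 <= 4^-1 :> R by lra.
    have b2 : 2^-1 <= 1 :> R by lra.
    have h : 4^-1 <= 2^-1 :> R by lra.
    have := @L2_lower_bound _ _ _ (L2sub a4 b2 u) c h c0.
    have uU' : {ae leb 4^-1 2^-1, forall x, c <= `|u x|}.
      apply: ae_leb_imp (ae_leb_sub a4 b2 uU) => y yI ->.
      by rewrite leNgt; apply/negP => yc; apply: nex; exists y; rewrite ltW.
    move=> /(_ uU'); apply/negP; rewrite -ltNge.
    have := L2sub_le a4 b2 u.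
    rewrite -ler_sqr ?nnegrE ?snorm_ge0// => /le_lt_trans; apply.
    have -> : 2^-1 - 4^-1 = (2^-1) ^+ 2 :> R by field.
    have cp : 0 <= c / 2 by rewrite divr_ge0.
    rewrite -exprMn ltr_sqr ?nnegrE ?snorm_ge0// /c; lra.
  have y01 : 0 < y < 1 by lra.
  have [t /andP[yt t1] tE] := UMVT y y01.
  have t0 : 0 < t by lra.
  have Wt : `|W t| <= 2 * c.
    have : `|W t| * 2^-1 <= `|U y|.
      rewrite -(normrN (U y)) tE -mulrA (mulrC (W t)) !normrM mulrA [leRHS]mulrC ler_wpM2l//.
      rewrite ger0_norm ?powR_ge0// ger0_norm ?subr_ge0; last by lra.
      have := @powRNalpha_ge1 t; rewrite t0 (ltW t1) => /(_ isT).
      by move: (t `^ _) => p p1; nra.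
    lra.
  have : `|W x - W t| <= nrm f.
    by have [xt|/ltW tx] := leP x t; [rewrite distrC|]; apply: Winc.
  have := ler_normD (W x - W t) (W t); rewrite subrK /c in Wt *.
  lra.
exists U, W; split => //; split => // r x r0 /andP[rx x1].
have x0 : 0 < x by exact: lt_le_trans rx.
have [|t /andP[xt t1] tE] := UMVT x; first by rewrite x0.
rewrite -normrN tE !normrM.
have -> : r^-1 * (4 * nrm u + nrm f) = r^-1 * (4 * nrm u + nrm f) * 1 by rewrite mulr1.
apply: ler_pM => //; last by rewrite ger0_norm; lra.
apply: ler_pM => //; last by apply: Wb; rewrite t1 (lt_trans x0).
by rewrite ger0_norm ?powR_ge0// (powRNalpha_le r0)//; lra.
Qed.

End Regularity.

(** * Functions linked by weighted derivatives *)

(** The successive derivatives are given as data: they come with the explicit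
formulas that bound them. *)
Definition jet (R : realType) (c d : R) (n : nat) (g : nat -> R -> R) : Prop :=
  forall m, (m < n)%N -> forall x : R, c < x < d -> is_derive x (1 : R) (g m) (g m.+1 x).

Section WeightedDerivatives.
Context {R : realType} (r : R) (a : nat -> R) (F : nat -> R -> R) (n : nat).
Hypothesis r01 : 0 < r < 1.
Hypothesis a01 : forall i, 0 <= a i <= 1.
Hypothesis dF : forall i, (i < n)%N -> forall x : R, r < x < 1 ->
  is_derive x (1 : R) (F i) (x `^ (- a i) * F i.+1 x).

Let c i := \sum_(k < i) a k.

(** The [m]-th derivative of [x `^ (- (l%:R + c i)) * F i x]. Differentiating the
power increases [l]; differentiating [F i] produces the weight [x `^ (- a i)], which
increases [i]. *)
Fixpoint wjet m l i (x : R) : R :=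
  if m is m'.+1 then - (l%:R + c i) * wjet m' l.+1 i x + wjet m' l i.+1 x
  else x `^ (- (l%:R + c i)) * F i x.

Lemma wjet_derive m l i (x : R) : (m + i < n)%N -> r < x < 1 ->
  is_derive x (1 : R) (wjet m l i) (wjet m.+1 l i x).
Proof.
move=> + /[dup] x01 /andP[rx x1]; case/andP: r01 => r0 r1.
have x0 : 0 < x by exact: lt_trans rx.
elim: m l i => [|m IH] l i mi.
  rewrite (_ : wjet 0 l i = (fun y : R => y `^ (- (l%:R + c i))) * F i)//.
  apply: (is_derive_eq (is_deriveM (@is_derive1_powR R _ x x0) (dF mi x01))).
  rewrite /GRing.scale/= /c big_ord_recr/= -/(c i).
  have -> : - (l.+1%:R + c i) = - (l%:R + c i) - 1 :> R by rewrite -natr1; ring.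
  have -> : - (l%:R + (c i + a i)) = - (l%:R + c i) - a i by ring.
  rewrite add0n (@powRD R x (- (l%:R + c i)) (- a i)); last by rewrite (gt_eqF x0) implybT.
  by ring.
rewrite [wjet m.+1 l i](_ : _ =
  (- (l%:R + c i)) \*: wjet m l.+1 i + wjet m l i.+1); last exact/funext.
apply: (is_derive_eq (is_deriveD (is_deriveZ _ (IH l.+1 i _)) (IH l i.+1 _))) => //.
  by rewrite (leq_trans _ mi)// addSn.
by rewrite addnS -addSn.
Qed.

Variables (B s : R).
Hypotheses (B0 : 0 <= B) (s0 : 0 <= s).
Hypothesis FB : forall i, (i <= n)%N -> forall x, r < x < 1 ->
  `|F i x| <= B * (i`!)%:R * (r * s) ^+ i.

(** The factor [(l + i)`!] is there to make the induction work: the coefficient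
[l%:R + c i] of the first term of the recursion is at most [l + i + 1] and is absorbed
by the passage from [(l + i)`!] to [(l + i).+1`!]; the same passage compensates the
factor [i.+1] lost in the second term. *)
Lemma wjet_bound m l i x : (m + i <= n)%N -> r < x < 1 ->
  ((l + i)`!)%:R * `|wjet m l i x|
    <= B * ((l + i + m)`!)%:R * (i`!)%:R * s ^+ i * r^-1 ^+ l * (r^-1 + s) ^+ m.
Proof.
move=> + /[dup] x01 /andP[rx x1]; case/andP: r01 => r0 r1.
have x0 : 0 < x by exact: lt_trans rx.
have rV1 : 1 <= r^-1 by rewrite invf_ge1// ltW.
have c0 j : 0 <= c j by apply: sumr_ge0 => k _; case/andP: (a01 k).
have ci j : c j <= j%:R.
  rewrite -[j in leRHS]card_ord -sumr_const; apply: ler_sum => k _.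
  by case/andP: (a01 k).
elim: m l i => [|m IH] l i mi.
  rewrite addn0 expr0 mulr1 /= normrM ger0_norm ?powR_ge0//.
  have p1 : x `^ (- (l%:R + c i)) <= r^-1 ^+ (l + i).
    have -> : r^-1 ^+ (l + i) = r `^ (- (l + i)%:R) by rewrite powR_invn ?(ltW r0)// exprVn.
    apply: (@le_trans _ _ (x `^ (- (l + i)%:R))).
      apply: ger_powR; first by rewrite x0 ltW.
      by rewrite lerN2 natrD lerD2l.
    rewrite !powRN lef_pV2 ?posrE ?powR_gt0//.
    by apply: ge0_ler_powR; rewrite ?nnegrE// ?ltW.
  have := ler_pM (powR_ge0 _ _) (normr_ge0 _) p1 (FB mi x01).
  move=> /(ler_wpM2l (ler0n R (l + i)`!)) => /le_trans; apply.
  rewrite exprD exprMn le_eqVlt; apply/orP; left; apply/eqP.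
  have -> : r ^+ i = (r^-1 ^+ i)^-1 by rewrite exprVn invrK.
  by field; rewrite expf_neq0// invr_neq0// gt_eqF.
have m1 : (m + i <= n)%N by rewrite (leq_trans _ mi)// leq_add2r.
have m2 : (m + i.+1 <= n)%N by rewrite addnS -addSn.
have h1 := IH l.+1 i m1; have h2 := IH l i.+1 m2.
pose X := B * ((l + i + m.+1)`!)%:R * (i`!)%:R * s ^+ i * r^-1 ^+ l * (r^-1 + s) ^+ m.
have X0 : 0 <= X.
  by rewrite /X !mulr_ge0 ?exprn_ge0 ?addr_ge0 ?invr_ge0 ?(ltW r0).
have {}h1 : ((l + i).+1`!)%:R * `|wjet m l.+1 i x| <= r^-1 * X.
  apply: (le_trans h1); rewrite le_eqVlt; apply/orP; left; apply/eqP.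
  by rewrite /X exprS addSn addnS; ring.
have {}h2 : ((l + i).+1`!)%:R * `|wjet m l i.+1 x| <= i.+1%:R * s * X.
  move: h2; rewrite addnS => h2; apply: (le_trans h2).
  rewrite le_eqVlt; apply/orP; left; apply/eqP.
  by rewrite /X exprS addSn addnS (factS i) natrM; ring.
move: h1 h2; rewrite factS natrM; set p := ((l + i)`!)%:R.
have p0 : 0 <= p by exact: ler0n.
set D1 := `|wjet m l.+1 i x|; set D2 := `|wjet m l i.+1 x| => h1 h2.
have D10 : 0 <= D1 by exact: normr_ge0.
have D20 : 0 <= D2 by exact: normr_ge0.
have li : l%:R + c i <= (l + i).+1%:R.
  by rewrite -addnS natrD lerD2l (le_trans (ci i))// ler_nat.
have k1 : p * ((l%:R + c i) * D1) <= r^-1 * X.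
  by rewrite (le_trans _ h1)// mulrCA -mulrA ler_wpM2r ?mulr_ge0.
have k2 : p * D2 <= s * X.
  have L0 : 0 < (l + i).+1%:R :> R by [].
  rewrite -(ler_pM2l L0) mulrA (le_trans h2)// -(mulrA _ s) ler_wpM2r ?(mulr_ge0 s0 X0)//.
  by rewrite ler_nat ltnS leq_addl.
apply: (@le_trans _ _ (p * ((l%:R + c i) * D1 + D2))).
  rewrite ler_wpM2l//= (le_trans (ler_normD _ _))// lerD2r normrM normrN.
  by rewrite (ger0_norm (addr_ge0 (ler0n _ _) (c0 i))).
rewrite mulrDr (le_trans (lerD k1 k2))//.
by rewrite le_eqVlt; apply/orP; left; apply/eqP; rewrite /X exprS; ring.
Qed.

Lemma wjetP : exists f : nat -> R -> R, [/\
  forall x, r < x < 1 -> f 0 x = F 0 x,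
  jet r 1 n f & forall m x, (m <= n)%N -> r < x < 1 ->
    `|f m x| <= B * (m`!)%:R * (r^-1 + s) ^+ m].
Proof.
exists (fun m => wjet m 0 0); split.
- by move=> x _; rewrite /= /c big_ord0 addr0 oppr0 powRr0 mul1r.
- by move=> m mn x x01; apply: wjet_derive => //; rewrite addn0.
- move=> m x mn x01; have := @wjet_bound m 0 0 x.
  by rewrite !addn0 !add0n fact0 !expr0 !mulr1 mul1r; apply.
Qed.

End WeightedDerivatives.

(** * Lagrange interpolation *)

Section LagrangeInterpolation.
Context {R : realType}.
Implicit Types (g : nat -> R -> R) (c d x y : R) (z : nat -> R).

Lemma jet_sub c d c' d' n n' g : c <= c' -> d' <= d -> (n' <= n)%N ->
  jet c d n g -> jet c' d' n' g.
Proof.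
move=> cc dd nn gP m mn x /andP[cx xd]; apply: gP; first exact: leq_trans nn.
by rewrite (le_lt_trans cc cx) (lt_le_trans xd dd).
Qed.

Lemma jet_continuous c d n g x y : (0 < n)%N -> jet c d n g -> c < x -> y < d ->
  {within `[x, y], continuous (g 0)}.
Proof.
move=> n0 gP cx yd; apply: derivable_within_continuous => t; rewrite in_itv/= => /andP[xt ty].
by have [] := gP 0 n0 t; first by rewrite (lt_le_trans cx xt) (le_lt_trans ty yd).
Qed.

Lemma iterated_rolle n g z c d : jet c d n g ->
  (forall i, (i <= n)%N -> c < z i < d) -> (forall i, (i < n)%N -> z i < z i.+1) ->
  (forall i, (i <= n)%N -> g 0 (z i) = 0) -> exists2 t, c < t < d & g n t = 0.
Proof.
elim: n g z => [|n IH] g z gP zcd zinc g0.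
  by exists (z 0); [exact: zcd|exact: g0].
have /choice[y yP] : forall i, exists y, (i <= n)%N -> z i < y < z i.+1 /\ g 1 y = 0.
  move=> i; have [ni|ni] := leqP i n; last by exists 0.
  have /andP[ci _] := zcd i (leqW ni); have /andP[_ di] := zcd i.+1 ni.
  have [||||t tI dt] := @Rolle R (g 0) (z i) (z i.+1).
  - exact: zinc.
  - move=> t; rewrite in_itv/= => /andP[it ti].
    by have [] := gP 0 isT t; first by rewrite (lt_trans ci it) (lt_trans ti di).
  - exact: jet_continuous gP _ _.
  - by rewrite !g0// leqW.
  exists t => _; move: tI; rewrite in_itv/= => tI; split => //.
  have /gP/= : (0 < n.+1)%N by [].
  move=> /(_ t); case/andP: tI => it ti.
  rewrite (lt_trans ci it) (lt_trans ti di) => /(_ isT) [_ <-].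
  by case: dt.
have [||||t tcd gt] := IH (fun m => g m.+1) y.
- by move=> m mn; exact: gP.
- move=> i ni; have [/andP[iy yi] _] := yP i ni.
  have /andP[ci _] := zcd i (leqW ni); have /andP[_ di] := zcd i.+1 ni.
  by rewrite (lt_trans ci iy) (lt_trans yi di).
- move=> i ni; have [/andP[_ h1] _] := yP i (ltnW ni).
  by have [/andP[h2 _] _] := yP i.+1 ni; exact: lt_trans h2.
- by move=> i ni; have [] := yP i ni.
by exists t.
Qed.

Definition nodal n z : {poly R} := \prod_(k < n) ('X - (z k)%:P).
Definition conodal n z (i : 'I_n) : {poly R} := \prod_(k < n | k != i) ('X - (z k)%:P).

Lemma size_nodal n z : size (nodal n z) = n.+1.
Proof. by rewrite size_prod_XsubC /index_enum -enumT size_enum_ord. Qed.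

Lemma monic_nodal n z : nodal n z \is monic.
Proof. exact: monic_prod_XsubC. Qed.

Lemma nodalE n z (i : 'I_n) : nodal n z = ('X - (z i)%:P) * conodal z i.
Proof. by rewrite /nodal (bigD1 i). Qed.

Lemma size_conodal n z (i : 'I_n) : size (conodal z i) = n.
Proof.
have := size_nodal n z; rewrite (nodalE z i) size_monicM ?monicXsubC//.
  by rewrite size_XsubC addSn/= => -[].
by apply/eqP => c0; have := size_nodal n z; rewrite (nodalE z i) c0 mulr0 size_poly0.
Qed.

Lemma horner_nodal n z y : (nodal n z).[y] = \prod_(k < n) (y - z k).
Proof. by rewrite horner_prod; apply: eq_bigr => k _; rewrite !hornerE. Qed.

Lemma horner_conodal n z (i : 'I_n) y :
  (conodal z i).[y] = \prod_(k < n | k != i) (y - z k).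
Proof. by rewrite horner_prod; apply: eq_bigr => k _; rewrite !hornerE. Qed.

Lemma derivn_nodal n z : (nodal n z)^`(n) = (n`!%:R)%:P.
Proof.
apply/polyP => i; rewrite coef_derivn coefC.
case: i => [|i]; last first.
  by rewrite nth_default ?mul0rn// size_nodal addnS ltnS leq_addr.
rewrite addn0 ffactnn /=.
have /monicP := monic_nodal n z; rewrite /lead_coef size_nodal /= => ->.
by [].
Qed.

(** Subtract from [g 0] its interpolation polynomial at the first [n] nodes, then the
multiple of their nodal polynomial that makes the difference vanish at the last
node as well, and apply Rolle's theorem [n] times. *)
Lemma lagrange_remainder n g z c d : jet c d n g ->
  (forall i, (i <= n)%N -> c < z i < d) ->
  (forall i j, (i < j)%N -> (j <= n)%N -> z i < z j) ->
  exists2 t, c < t < d &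
    g 0 (z n) = \sum_(i < n) g 0 (z i) * ((conodal z i).[z n] / (conodal z i).[z i])
                + g n t / n`!%:R * (nodal n z).[z n].
Proof.
move=> gP zcd zinc.
have zneq i j : (i <= n)%N -> (j <= n)%N -> i != j -> z i - z j != 0.
  move=> ni nj; rewrite neq_ltn subr_eq0 => /orP[ij|ij].
    by rewrite lt_eqF// zinc.
  by rewrite gt_eqF// zinc.
have N0 : (nodal n z).[z n] != 0.
  rewrite horner_nodal; apply/prodf_neq0 => k _; apply: zneq => //.
    exact: ltnW.
  by rewrite gtn_eqF.
have C0 (i : 'I_n) : (conodal z i).[z i] != 0.
  rewrite horner_conodal; apply/prodf_neq0 => k ki; apply: zneq; try exact: ltnW.
  by rewrite eq_sym.
pose P := \sum_(i < n) (g 0 (z i) / (conodal z i).[z i]) *: conodal z i.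
pose k := (g 0 (z n) - P.[z n]) / (nodal n z).[z n].
pose Q := P + k *: nodal n z.
have Pn : P^`(n) = 0.
  apply: derivn_poly0; rewrite (leq_trans (size_sum _ _ _))//.
  apply/bigmax_leqP => i _; rewrite (leq_trans (size_scale_leq _ _))//.
  by rewrite size_conodal.
have Qn t : Q^`(n).[t] = n`!%:R * k.
  rewrite derivnD Pn add0r derivnZ derivn_nodal hornerZ hornerC; exact: mulrC.
have Pz (j : 'I_n) : P.[z j] = g 0 (z j).
  rewrite horner_sum (bigD1 j)//= big1 ?addr0; first by rewrite !hornerE divfK.
  move=> i ij; rewrite hornerZ (horner_conodal z i (z j)) (bigD1 j) /= ?subrr ?mul0r ?mulr0//.
  by rewrite eq_sym.
have Nz (j : 'I_n) : (nodal n z).[z j] = 0.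
  by rewrite (nodalE z j) !hornerE subrr mul0r.
pose h m := fun x => g m x - Q^`(m).[x].
have [||||t tcd] := @iterated_rolle n h z c d.
- move=> m mn x xcd; rewrite /h derivnS.
  exact: (is_deriveB (gP m mn x xcd) (is_derive_poly _ _)).
- exact: zcd.
- by move=> i ni; apply: zinc.
- move=> i; rewrite leq_eqVlt => /predU1P[->|ni]; rewrite /h derivn0.
    by rewrite !hornerE /k divfK// subrKC subrr.
  by rewrite !hornerE (Pz (Ordinal ni)) (Nz (Ordinal ni)) mulr0 addr0 subrr.
rewrite /h Qn => /eqP; rewrite subr_eq0 => /eqP gn.
exists t => //; rewrite gn (mulrC _ k) mulfK; last by rewrite pnatr_eq0 -lt0n fact_gt0.
rewrite /k divfK// (_ : \sum_(i < n) _ = P.[z n]) ?subrKC//.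
rewrite horner_sum; apply: eq_bigr => i _; rewrite hornerZ; ring.
Qed.

End LagrangeInterpolation.

(** * Propagation of smallness *)

(** The denominators of Lagrange interpolation at equidistant nodes; in natural
numbers, [(i - k) + (k - i)] is the distance of [i] and [k]. *)
Lemma prod_distance (n i : nat) : (i <= n)%N ->
  (\prod_(k < n.+1 | (k : nat) != i) ((i - k) + (k - i)) = i`! * (n - i)`!)%N.
Proof.
move=> ni; rewrite -(big_mkord (fun k => k != i) (fun k => (i - k) + (k - i))%N).
rewrite -(subnKC ni); elim: (n - i)%N => [|m IH].
  rewrite addn0 subnn fact0 muln1 big_mkcond big_nat_recr//= eqxx muln1 -big_mkcond/=.
  rewrite big_nat_cond (eq_big (fun k => (0 <= k < i)%N) (fun k => (i - k)%N)).
  - by rewrite -big_nat big_mkord -ffact_prod ffactnn.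
  - by move=> k /=; case: ltngtP; rewrite ?andbF//.
  - by move=> k; lia.
rewrite big_mkcond big_nat_recr//= -big_mkcond/=.
have -> : (i + m.+1 != i)%N by lia.
have -> : (i + m.+1 - i = m.+1)%N by lia.
have -> : (i - (i + m.+1) + m.+1 = m.+1)%N by lia.
move: IH; rewrite addnS factS; have -> : (i + m - i = m)%N by lia. move=> ->.
by ring.
Qed.

Lemma sum_binomial n : (\sum_(i < n.+1) 'C(n, i) = 2 ^ n)%N.
Proof.
rewrite -[2%N]/(1 + 1)%N Pascal; apply: eq_bigr => i _.
by rewrite !exp1n !muln1.
Qed.

(** Compare [n ^ n / n!] to the binomial coefficient of [2 * n] over [n]. *)
Lemma expnn_le n : (n ^ n <= 4 ^ n * n`!)%N.
Proof.
have h : (n ^ n <= (2 * n) ^_ n)%N.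
  rewrite ffact_prod -[X in (_ ^ X <= _)%N]card_ord -prod_nat_const.
  by apply: leq_prod => i _; have := ltn_ord i; lia.
rewrite (leq_trans h)// -bin_ffact leq_mul2r.
apply/orP; right; rewrite (_ : 4 ^ n = 2 ^ (2 * n))%N; last by rewrite expnM.
have nn : (n < (2 * n).+1)%N by lia.
rewrite -sum_binomial (bigD1 (Ordinal nn))//=.
exact: leq_addr.
Qed.

Section Propagation.
Context {R : realType}.
Implicit Types (g : nat -> R -> R) (b d r tau B M S x y : R).

(** Interpolate at [n] equidistant points of [[b - d, b]]: their Lebesgue constant at
distance [d] is at most [16 ^ n], and the remainder is [B * (2 * d * tau) ^ n]. *)
Lemma propagation_step n g r b d tau B M y : (0 < n)%N -> 0 < d -> d * tau <= 4^-1 ->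
  0 <= tau -> 0 <= B -> r < b - d -> b <= y -> y <= b + d -> y < 1 ->
  jet r 1 n g ->
  (forall t, r < t < 1 -> `|g n t| <= B * n`!%:R * tau ^+ n) ->
  (forall x, b - d <= x <= b -> `|g 0 x| <= M) ->
  `|g 0 y| <= 16 ^+ n * M + B * 2^-1 ^+ n.
Proof.
case: n => // p _; set n := p.+1.
move=> d0 dtau tau0 B0 rb by_ yb y1 gP gB gM.
have n0 : 0 < n%:R :> R by rewrite ltr0n.
pose h := d / n%:R; have h0 : 0 < h by exact: divr_gt0.
have nh : n%:R * h = d by rewrite /h mulrC divfK// gt_eqF.
pose z i := if (i < n)%N then b - d + i%:R * h else y.
have zn : z n = y by rewrite /z ltnn.
have zi (i : 'I_n) : z i = b - d + i%:R * h by rewrite /z ltn_ord.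
have zb i : (i < n)%N -> b - d <= z i < b.
  move=> ni; rewrite /z ni lerDl mulr_ge0 ?(ltW h0)//=.
  by rewrite -ltrBrDl opprB addrC subrK -nh ltr_pM2r// ltr_nat.
have zinc i j : (i < j)%N -> (j <= n)%N -> z i < z j.
  move=> ij; rewrite leq_eqVlt => /predU1P[jn|jn].
    rewrite jn zn; rewrite jn in ij; have /andP[_ h1] := zb i ij.
    exact: lt_le_trans by_.
  by rewrite /z jn (ltn_trans ij jn) ltrD2l ltr_pM2r// ltr_nat.
have zcd i : (i <= n)%N -> r < z i < 1.
  rewrite leq_eqVlt => /predU1P[->|/zb/andP[h1 h2]].
    by rewrite zn y1 andbT (lt_le_trans rb)//; lra.
  by rewrite (lt_le_trans rb h1) (lt_trans h2)// (le_lt_trans by_).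
have [t trd] := lagrange_remainder gP zcd zinc.
rewrite zn => ->.
have yz (k : 'I_n) : 0 <= y - z k <= 2 * d.
  have /andP[h1 h2] := zb k (ltn_ord k); apply/andP; split; lra.
have M0 : 0 <= M.
  by have := gM b; rewrite lexx gerBl ltW// => /(_ isT); apply: le_trans.
rewrite (le_trans (ler_normD _ _))// lerD//.
  have term (i : 'I_n) : `|g 0 (z i) * ((conodal z i).[y] / (conodal z i).[z i])|
      <= M * ((2 * n%:R) ^+ p / p`!%:R * 'C(p, i)%:R).
    rewrite normrM; apply: ler_pM => //.
      by apply: gM; have /andP[-> /ltW] := zb i (ltn_ord i).
    have ip : (i <= p)%N by rewrite -ltnS.
    rewrite !horner_conodal normrM normfV !normr_prod.
    have -> : \prod_(k < n | k != i) `|z i - z k| = h ^+ p * (i`! * (p - i)`!)%N%:R.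
      rewrite -prod_distance// natr_prod.
      have -> : h ^+ p = \prod_(k < n | k != i) h by rewrite prodr_const cardC1 card_ord.
      rewrite -big_split/=; apply: eq_bigr => k _; rewrite !zi.
      rewrite opprD addrACA subrr add0r -mulrBl normrM (gtr0_norm h0) mulrC.
      congr (_ * _); have [ik|/ltnW ki] := leqP i k.
        by rewrite (eqP (ik : (i - k == 0)%N)) add0n natrB// distrC ger0_norm// subr_ge0 ler_nat.
      by rewrite (eqP (ki : (k - i == 0)%N)) addn0 natrB// ger0_norm// subr_ge0 ler_nat.
    have cP : 0 < (i`! * (p - i)`!)%N%:R :> R by rewrite ltr0n muln_gt0 !fact_gt0.
    rewrite ler_pdivrMr; last by rewrite mulr_gt0// exprn_gt0.
    apply: (@le_trans _ _ ((2 * d) ^+ p)).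
      have -> : (2 * d) ^+ p = \prod_(k < n | k != i) (2 * d) by rewrite prodr_const cardC1 card_ord.
      apply: ler_prod => k _; rewrite normr_ge0/=.
      by case/andP: (yz k) => h1 h2; rewrite ger0_norm.
    rewrite -nh le_eqVlt; apply/orP; left; apply/eqP.
    have := bin_fact ip => /(congr1 (fun k => k%:R : R)); rewrite [in LHS]natrM => E.
    have -> : (2 * n%:R) ^+ p / p`!%:R * 'C(p, i)%:R * (h ^+ p * (i`! * (p - i)`!)%N%:R)
      = (2 * n%:R) ^+ p * h ^+ p / p`!%:R * ('C(p, i)%:R * (i`! * (p - i)`!)%N%:R) by ring.
    rewrite E divfK; first by rewrite -exprMn; congr (_ ^+ _); ring.
    by rewrite pnatr_eq0 -lt0n fact_gt0.
  rewrite (le_trans (ler_norm_sum _ _ _))// (le_trans (ler_sum _ (fun i _ => term i)))//.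
  rewrite -mulr_sumr mulrC ler_wpM2r// -mulr_sumr -natr_sum.
  rewrite sum_binomial.
  have f0 : 0 < n`!%:R :> R by rewrite ltr0n fact_gt0.
  have -> : (2 * n%:R) ^+ p / p`!%:R * (2 ^ p)%N%:R = 4 ^+ p * (n ^ n)%N%:R / n`!%:R :> R.
    rewrite factS expnS !natrM !natrX exprMn (_ : 4 ^+ p = 2 ^+ p * 2 ^+ p :> R).
      rewrite -/n; field; rewrite !gt_eqF// ltr0n fact_gt0.
    by rewrite -exprMn; congr (_ ^+ _); ring.
  rewrite ler_pdivrMr//.
  apply: (@le_trans _ _ (4 ^+ n * ((4 ^ n * n`!)%N%:R))).
    apply: ler_pM => //; rewrite ?exprn_ge0//; last by rewrite ler_nat expnn_le.
    by rewrite ler_weXn2l ?ler1n.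
  rewrite natrM natrX mulrA -exprMn le_eqVlt; apply/orP; left; apply/eqP.
  by congr (_ ^+ _ * _); ring.
rewrite normrM normrM normfV (ger0_norm (ler0n _ n`!)).
apply: (@le_trans _ _ (B * tau ^+ n * (2 * d) ^+ n)).
  apply: ler_pM => //.
    rewrite ler_pdivrMr ?ltr0n ?fact_gt0//.
    by rewrite (le_trans (gB t trd))// mulrAC.
  rewrite horner_nodal normr_prod -[X in _ ^+ X]card_ord -prodr_const.
  apply: ler_prod => k _; rewrite normr_ge0/=.
  by case/andP: (yz k) => h1 h2; rewrite ger0_norm.
rewrite -mulrA ler_wpM2l// -exprMn; apply: lerXn2r; rewrite ?nnegrE ?mulr_ge0 ?(ltW d0)//.
lra.
Qed.

(** [4] accounts for the Lebesgue constant [16 ^ n = 2 ^ (4 * n)] of one step, and [5]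
for the multiplication of the parameter [n] in the previous step. *)
Fixpoint loss (j : nat) : nat := if j is j'.+1 then (4 + 5 * loss j')%N else 1.

(** The parameter [n] is divided by [5] at each step, so that the previous error
[2^-1 ^ (5 * n)] beats the Lebesgue constant [16 ^ n] with a factor [2^-1 ^ n] to
spare. *)
Lemma propagation g r x0 b0 d tau B S N j n x :
  0 < d -> d * tau <= 4^-1 -> 0 <= tau -> 0 <= B -> 0 <= S -> r < x0 -> x0 + d <= b0 ->
  jet r 1 N g ->
  (forall m t, (m <= N)%N -> r < t < 1 -> `|g m t| <= B * m`!%:R * tau ^+ m) ->
  (forall m t, (0 < m)%N -> x0 <= t <= b0 -> t < 1 ->
    `|g 0 t| <= 2 ^+ m * S + tau * B * 2^-1 ^+ m) ->
  (0 < n)%N -> (5 ^ j * n <= N)%N -> x0 <= x <= b0 + j%:R * d -> x < 1 ->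
  `|g 0 x| <= 2 ^+ (loss j * n) * S + (tau + j%:R) * B * 2^-1 ^+ n.
Proof.
move=> d0 dtau tau0 B0 S0 rx xb gP gB base; elim: j n x => [|j IH] n x n0 nN.
  by rewrite mul0r addr0 mul1n addr0 => xI x1; exact: base.
move=> /andP[x0x xbj] x1.
have n5 : (0 < 5 * n)%N by rewrite muln_gt0.
have nN' : (5 ^ j * (5 * n) <= N)%N by rewrite mulnA -expnSr.
have bj : x0 + d <= b0 + j%:R * d by rewrite (le_trans xb)// lerDl mulr_ge0// ltW.
have hstep : 0 <= B * 2^-1 ^+ n by rewrite mulr_ge0// exprn_ge0.
have [xb'|bx] := leP x (b0 + j%:R * d).
  have nN1 : (5 ^ j * n <= N)%N by rewrite (leq_trans _ nN')// leq_mul2l leq_pmull// orbT.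
  have := IH n x n0 nN1; rewrite x0x xb' => /(_ isT x1) => /le_trans; apply.
  apply: lerD; last by rewrite -natr1; lra.
  have lossS : (loss j <= loss j.+1)%N.
    by rewrite (leq_trans (leq_pmull (loss j) (isT : (0 < 5)%N)))// leq_addl.
  by rewrite ler_wpM2r// ler_weXn2l ?ler1n// leq_mul2r lossS orbT.
have nN1 : (n <= N)%N by rewrite (leq_trans _ nN)// leq_pmull// expn_gt0.
pose M := 2 ^+ (loss j * (5 * n)) * S + (tau + j%:R) * B * 2^-1 ^+ (5 * n).
have step := @propagation_step n g r (b0 + j%:R * d) d tau B M x n0 d0 dtau tau0 B0.
apply: le_trans (step _ _ _ x1 _ _ _) _.
- by lra.
- exact: ltW.
- by move: xbj; rewrite -natr1; lra.
- exact: jet_sub gP.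
- by move=> t tI; exact: gB.
- move=> y /andP[y1 y2]; apply: IH => //; last exact: le_lt_trans y2 (lt_trans bx x1).
  by rewrite y2 andbT; lra.
have e1 : 16 ^+ n * 2 ^+ (loss j * (5 * n)) = 2 ^+ (loss j.+1 * n) :> R.
  rewrite (_ : 16 = 2 ^+ 4 :> R); last by ring.
  by rewrite -exprM -exprD /=; congr (_ ^+ _); ring.
have e2 : 16 ^+ n * 2^-1 ^+ (5 * n) = 2^-1 ^+ n :> R.
  by rewrite exprM -exprMn; congr (_ ^+ _); field.
rewrite /M mulrDr mulrA e1 -addrA lerD2l mulrCA e2 -natr1.
by rewrite le_eqVlt; apply/orP; left; apply/eqP; ring.
Qed.

End Propagation.

(** * Quantitative unique continuation *)

Section AnalyticRegularity.
Context {R : realType} (alpha beta0 beta1 : R).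
Hypothesis alpha01 : 0 < alpha < 1.
Local Notation op := (opA alpha beta0 beta1).
Local Notation nrm := (snorm (@L2ip R 0 1)).

Lemma half_le_double i N : (i <= 2 * N -> i./2 <= N)%N. Proof. by lia. Qed.

Lemma half_lt_double i N : (i < 2 * N -> i./2 < N)%N. Proof. by lia. Qed.

Lemma double_half_le i : (2 * i./2 <= i)%N. Proof. by lia. Qed.

Lemma quadratic_le_pow4 i : ((i.+1 * i.+2) <= 2 * 4 ^ i)%N.
Proof. by elim: i => // i IH; rewrite expnS; lia. Qed.

(** Alternate the iterates and their fluxes: in this sequence each function has the
next one as its derivative, with weight [x `^ (- alpha)] after an iterate and [1]
after a flux, so that each iteration of the operator counts for two
derivatives, in accordance with the growth [(2 * j)!]. *)
Lemma analytic_chain (r A : R) (N : nat) (u : nat -> L2 (0 : R) 1) :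
  0 < r < 1 -> 0 <= A ->
  (forall j, (j <= N)%N -> op (u j) (u j.+1)) ->
  (forall j, (j <= N.+1)%N -> nrm (u j) <= ((2 * j)`!)%:R * A) ->
  exists U (g : nat -> R -> R), [/\ {ae leb 0 1, forall x : R, u 0%N x = U x},
    forall x, r < x < 1 -> g 0%N x = U x,
    jet r 1 (2 * N) g &
    forall m x, (m <= 2 * N)%N -> r < x < 1 ->
      `|g m x| <= 10 * r^-1 * A * (m`!)%:R * (5 / r) ^+ m].
Proof.
move=> r01 A0 uop uA; case/andP: (r01) => r0 r1.
have /choice[UW UWP] : forall j, exists UW : (R -> R) * (R -> R), (j <= N)%N ->
  [/\ {ae leb 0 1, forall x : R, u j x = UW.1 x},
      {within `[0, 1], continuous UW.1} /\ UW.1 1 = 0,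
      chain_ac 0 1 UW.2 /\ {ae leb 0 1, forall x : R, is_derive x (1 : R) UW.2 (u j.+1 x)},
      forall x : R, 0 < x < 1 -> is_derive x (1 : R) UW.1 (x `^ (- alpha) * UW.2 x) &
      (forall x : R, 0 < x < 1 -> `|UW.2 x| <= 4 * nrm (u j) + nrm (u j.+1)) /\
      (forall r x : R, 0 < r -> r <= x < 1 ->
         `|UW.1 x| <= r^-1 * (4 * nrm (u j) + nrm (u j.+1)))].
  move=> j; have [jN|jN] := leqP j N; last by exists (id, id).
  by have [U [W UW]] := opA_regular alpha01 (uop j jN); exists (U, W).
pose F i := if odd i then (UW i./2).2 else (UW i./2).1.
pose a i := if odd i then 0 else alpha.
have a01 i : 0 <= a i <= 1.
  by rewrite /a; case: odd; rewrite ?lexx ?ler01//; case/andP: alpha01 => h1 h2; rewrite !ltW.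
have dF i : (i < 2 * N)%N -> forall x : R, r < x < 1 ->
    is_derive x (1 : R) (F i) (x `^ (- a i) * F i.+1 x).
  move=> iN x /andP[rx x1]; have x01 : 0 < x < 1 by rewrite x1 (lt_trans r0 rx).
  have iN2 : (i./2 <= N)%N by apply: half_le_double; rewrite // ltnW.
  rewrite /F /a /= uphalf_half; case: (boolP (odd i)) => oi /=; last first.
    by rewrite add0n; have [_ _ _ + _] := UWP _ iN2; apply.
  rewrite add1n oppr0 powRr0 mul1r.
  have iN3 : (i./2.+1 <= N)%N by exact: half_lt_double.
  have [_ _ [Wac dW] _ _] := UWP _ iN2.
  have [uU [cU _] _ _ _] := UWP _ iN3.
  apply: (@chain_ac_derivative _ 0 1) => //.
    by apply: (within_continuous_continuous ltr01 cU); rewrite in_itv.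
  by apply: ae_leb_imp2 dW uU => y _ dy <-.
have FB i : (i <= 2 * N)%N -> forall x : R, r < x < 1 ->
    `|F i x| <= 10 * r^-1 * A * (i`!)%:R * (r * (4 / r)) ^+ i.
  move=> iN x /andP[rx x1]; have x01 : 0 < x < 1 by rewrite x1 (lt_trans r0 rx).
  have iN2 : (i./2 <= N)%N by apply: half_le_double; rewrite // ltnW.
  have [_ _ _ _ [WB UB]] := UWP _ iN2.
  apply: (@le_trans _ _ (r^-1 * (4 * nrm (u i./2) + nrm (u i./2.+1)))).
    rewrite /F; case: ifP => _; last by apply: UB => //; rewrite (ltW rx).
    rewrite (le_trans (WB _ x01))// ler_peMl//.
      by rewrite addr_ge0 ?snorm_ge0// mulr_ge0// snorm_ge0.
    by rewrite invf_ge1// ltW.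
  have f1 : ((2 * i./2)`! <= (i.+2)`!)%N.
    by apply: leq_fact; rewrite (leq_trans (double_half_le i))// leqW.
  have f2 : ((2 * i./2.+1)`! <= (i.+2)`!)%N.
    by apply: leq_fact; rewrite mulnS !ltnS double_half_le.
  apply: (@le_trans _ _ (r^-1 * (5 * ((i.+2)`!%:R * A)))).
    rewrite ler_wpM2l ?invr_ge0 ?(ltW r0)//.
    have h1 := uA i./2 (leqW iN2); have h2 := uA i./2.+1 iN2.
    have k1 : ((2 * i./2)`!)%:R * A <= (i.+2)`!%:R * A by rewrite ler_wpM2r// ler_nat.
    have k2 : ((2 * i./2.+1)`!)%:R * A <= (i.+2)`!%:R * A by rewrite ler_wpM2r// ler_nat.
    lra.
  have -> : r * (4 / r) = 4 by field; rewrite gt_eqF.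
  have -> : 10 * r^-1 * A * i`!%:R * 4 ^+ i = r^-1 * (5 * (i`!%:R * (2 * 4 ^+ i) * A)) by ring.
  rewrite ler_wpM2l ?invr_ge0 ?(ltW r0)// ler_wpM2l// ler_wpM2r//.
  rewrite -natrX -!natrM ler_nat !factS mulnA mulnC leq_mul2l.
  by rewrite mulnC quadratic_le_pow4 orbT.
have B0 : 0 <= 10 * r^-1 * A by rewrite !mulr_ge0// invr_ge0 ltW.
have s0 : 0 <= 4 / r by rewrite divr_ge0// ltW.
have [g [g0 gP gB]] := wjetP r01 a01 dF B0 s0 FB.
have [uU _ _ _ _] := UWP 0%N isT.
exists (UW 0%N).1, g; split => // m x mN xI.
by have := gB m x mN xI; rewrite (_ : r^-1 + 4 / r = 5 / r)//; ring.
Qed.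

Section Observation.
Variable kappa : R.
Hypothesis kappa01 : 0 < kappa < 1.
Local Notation nrmw := (snorm (ipw kappa01)).

(** The passage from mean square smallness on [(0, kappa)] to pointwise smallness
inside it costs one derivative: near [t] there is a point where [U] is of the size
of its mean square on an interval of length [s], and moving back to [t]
costs [B * tau * s]. *)
Lemma pointwise_base (u : L2 (0 : R) 1) (U : R -> R) (g : nat -> R -> R) (B tau : R) m t :
  {ae leb 0 1, forall x : R, u x = U x} ->
  (forall x, kappa / 4 < x < 1 -> g 0%N x = U x) ->
  jet (kappa / 4) 1 1 g -> 0 <= B -> 0 <= tau ->
  (forall x, kappa / 4 < x < 1 -> `|g 1%N x| <= B * tau) ->
  kappa / 2 <= t <= 3 * kappa / 4 ->
  `|g 0%N t| <= 2 ^+ m * (2 / Num.sqrt kappa * nrmw u) + tau * B * 2^-1 ^+ m.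
Proof.
case/andP: (kappa01) => k0 k1.
move=> uU gU gP B0 tau0 g1 /andP[t1 t2]; apply/ler_addgt0Pr => e e0.
(* The mean square over an interval of length [s] loses [1 / sqrt s], that is
[2 ^ m] up to a constant, and the displacement is at most [2^-1 ^ m]. *)
pose s := kappa / 4 * (4^-1) ^+ m.
have s0 : 0 < s by rewrite !mulr_gt0// exprn_gt0.
have q1 : (4^-1 : R) ^+ m <= 1 by rewrite exprn_ile1//; lra.
have q1' : (4^-1 : R) ^+ m <= 2^-1 ^+ m.
  by apply: lerXn2r; rewrite ?nnegrE//; lra.
have sk : s <= kappa / 4 by rewrite ler_piMr// divr_ge0// ltW.
pose w := nrmw u.
have w0 : 0 <= w by exact: snorm_ge0.
pose c := 2 ^+ m * (2 / Num.sqrt kappa * w) + e.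
have sk0 : 0 < Num.sqrt kappa by rewrite sqrtr_gt0.
have c0 : 0 < c by rewrite ltr_wpDl// !mulr_ge0 ?exprn_ge0// invr_ge0 ltW.
have [y [yI yc]] : exists y, t < y < t + s /\ `|U y| <= c.
  apply: contrapT => nex.
  have ta : 0 <= t by lra.
  have tb : t + s <= kappa by lra.
  have h : t <= t + s by lra.
  have := @L2_lower_bound _ _ _ (L2sub ta tb (restr kappa01 u)) c h (ltW c0).
  have uU' : {ae leb t (t + s), forall x, c <= `|u x|}.
    have tb1 : t + s <= 1 by lra.
    apply: ae_leb_imp (ae_leb_sub ta tb1 uU) => y yI ->.
    by rewrite leNgt; apply/negP => yc; apply: nex; exists y; rewrite (ltW yc).
  move=> /(_ uU'); apply/negP; rewrite -ltNge.
  have := L2sub_le ta tb (restr kappa01 u).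
  rewrite -ler_sqr ?nnegrE ?snorm_ge0// => /le_lt_trans; apply.
  rewrite -[snorm _ (restr _ _)]/w addrC addKr.
  have -> : c ^+ 2 * s = (c * (Num.sqrt kappa / 2 * 2^-1 ^+ m)) ^+ 2.
    rewrite /s !exprMn sqr_sqrtr ?(ltW k0)// -exprM mulnC exprM.
    by rewrite (_ : (4^-1 : R) = 2^-1 ^+ 2); [ring|field].
  have p0 : 0 < Num.sqrt kappa / 2 * 2^-1 ^+ m by rewrite !mulr_gt0// exprn_gt0.
  rewrite ltr_sqr ?nnegrE ?mulr_ge0 ?(ltW c0) ?(ltW p0)// /c mulrDl.
  have -> : 2 ^+ m * (2 / Num.sqrt kappa * w) * (Num.sqrt kappa / 2 * 2^-1 ^+ m) = w.
    have m2 : 2 ^+ m != 0 :> R by rewrite expf_neq0.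
    by rewrite exprVn; field; rewrite m2 lt0r_neq0.
  by rewrite ltrDl mulr_gt0.
case/andP: yI => ty yts.
have [||x xI xE] := @MVT R (g 0%N) (g 1%N) t y ty.
- move=> x; rewrite in_itv/= => /andP[tx xy]; apply: gP => //; lra.
- by apply: (jet_continuous _ gP) => //; lra.
have tI : kappa / 4 < t < 1 by lra.
have yI : kappa / 4 < y < 1 by lra.
have -> : g 0%N t = g 0%N y - (g 0%N y - g 0%N t) by rewrite subKr.
rewrite (le_trans (ler_normB _ _))// addrAC lerD//; first by rewrite gU.
rewrite xE normrM.
move: xI; rewrite in_itv/= => /andP[tx xy].
have h1 : `|g 1%N x| <= B * tau by apply: g1; lra.
have h2 : `|y - t| <= 2^-1 ^+ m.
  rewrite ger0_norm ?subr_ge0 ?(ltW ty)//.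
  have : s <= 4^-1 ^+ m.
    by rewrite /s ler_piMl ?exprn_ge0//; lra.
  lra.
by rewrite (mulrC tau); apply: ler_pM.
Qed.

End Observation.
End AnalyticRegularity.

Section InteriorEstimate.
Context {R : realType} (alpha beta0 beta1 kappa : R).
Hypothesis alpha01 : 0 < alpha < 1.
Hypothesis kappa01 : 0 < kappa < 1.
Local Notation op := (opA alpha beta0 beta1).
Local Notation ip := (@L2ip R 0 1).
Local Notation nrm := (snorm ip).
Local Notation nrmw := (snorm (ipw kappa01)).

Lemma snorm_cut u : nrm (cut kappa01 u) <= nrmw u.
Proof.
have ipP := L2ip_semi_inner (R := R) 0 1.
have ipwP := ipw_semi_inner kappa01.
have : nrm (cut kappa01 u) ^+ 2 <= nrmw u * nrm (cut kappa01 u).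
  rewrite (snorm_sqr ipP) ip_cut; apply: le_trans (ip_le ipwP _ _) _.
  by apply: ler_wpM2l; [exact: snorm_ge0|apply: ler_wsqrtr; exact: ipw_le].
have := snorm_ge0 ip (cut kappa01 u); rewrite le_eqVlt => /predU1P[<- _|q0].
  exact: snorm_ge0.
by rewrite expr2 ler_pM2r.
Qed.

Lemma snorm_split (u : L2 (0 : R) 1) (c : R) : 0 <= c ->
  {ae leb 0 1, forall x : R, kappa <= x -> `|u x| <= c} -> nrm u <= nrmw u + c.
Proof.
move=> c0 uc; have ipP := L2ip_semi_inner (R := R) 0 1.
have -> : u = cut kappa01 u + (u - cut kappa01 u) by rewrite addrC subrK.
rewrite (le_trans (snormD ipP _ _))// lerD//.
  by rewrite addrC subrK; exact: snorm_cut.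
have /(L2_upper_bound ler01) : {ae leb 0 1, forall x, `|(u - cut kappa01 u) x| <= c}.
  apply: ae_leb_imp uc => x /andP[x0 x1] xc.
  rewrite [_ x](_ : _ = u x - \1_`]0, kappa[ x * u x)// indicE.
  have [xk|kx] := ltP x kappa.
    by rewrite mem_set ?mul1r ?subrr ?normr0//= in_itv/= x0.
  rewrite memNset ?mul0r ?subr0; last by rewrite /= in_itv/= x0/= ltNge kx.
  exact: xc.
by rewrite subr0 mulr1 ler_sqr ?nnegrE ?snorm_ge0.
Qed.

(** Analyticity holds on [(kappa / 4, 1)], smallness is known on
[(kappa / 2, 3 * kappa / 4)], and [J] steps of length [d] lead from there to [1]; the
order of differentiation that they require is proportional to [n]. *)
Lemma interior_estimate : exists (C1 C2 : R) (p q : nat), [/\ 0 < C1, 0 < C2 &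
  forall (N n : nat) (A : R) (u : nat -> L2 (0 : R) 1),
    (0 < n)%N -> (q * n <= N)%N -> 0 <= A ->
    (forall j, (j <= N)%N -> op (u j) (u j.+1)) ->
    (forall j, (j <= N.+1)%N -> nrm (u j) <= ((2 * j)`!)%:R * A) ->
    nrm (u 0%N) <= C1 * 2 ^+ (p * n) * nrmw (u 0%N) + C2 * A * 2^-1 ^+ n].
Proof.
case/andP: (kappa01) => k0 k1.
pose r := kappa / 4; pose tau := 5 / r; pose d := kappa / 80.
(* With [tau = 20 / kappa], this [d] is the largest one allowed by
[d * tau <= 4^-1]. *)
pose J := (Num.truncn (80 / kappa)).+1.
have r0 : 0 < r by rewrite divr_gt0.
have r01 : 0 < r < 1 by rewrite r0/= /r; lra.
have d0 : 0 < d by rewrite divr_gt0.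
have tau0 : 0 <= tau by rewrite divr_ge0// ltW.
have dtau : d * tau <= 4^-1.
  rewrite le_eqVlt; apply/orP; left; apply/eqP.
  by rewrite /d /tau /r; field; rewrite gt_eqF.
have Jd : 1 <= J%:R * d.
  rewrite /d mulrA ler_pdivlMr// mul1r -ler_pdivrMr// ltW//.
  exact: truncnS_gt.
have sk0 : 0 < Num.sqrt kappa by rewrite sqrtr_gt0.
exists (1 + 2 / Num.sqrt kappa), ((tau + J%:R) * (10 * r^-1)), (loss J), (5 ^ J)%N.
split.
- by rewrite addr_gt0// divr_gt0.
- by rewrite !mulr_gt0 ?invr_gt0// ltr_wpDl// ltr0n.
move=> N n A u n0 nN A0 uop uA.
have [U [g [uU gU gP gB]]] := analytic_chain alpha01 r01 A0 uop uA.
have N0 : (0 < N)%N by rewrite (leq_trans _ nN)// muln_gt0 expn_gt0.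
pose B := 10 * r^-1 * A.
have B0 : 0 <= B by rewrite /B !mulr_ge0// invr_ge0 ltW.
pose S := 2 / Num.sqrt kappa * nrmw (u 0%N).
have S0 : 0 <= S by rewrite /S !mulr_ge0 ?invr_ge0 ?(ltW sk0) ?snorm_ge0.
have base m t : (0 < m)%N -> kappa / 2 <= t <= 3 * kappa / 4 -> t < 1 ->
    `|g 0%N t| <= 2 ^+ m * S + tau * B * 2^-1 ^+ m.
  move=> _ tI _; apply: (pointwise_base kappa01 m uU gU _ B0 tau0 _ tI).
    by apply: jet_sub gP => //; rewrite muln_gt0.
  move=> x xI; have := gB 1%N x _ xI; rewrite mulr1 expr1; apply.
  by rewrite muln_gt0.
have rx : r < kappa / 2 by rewrite /r; lra.
have xb : kappa / 2 + d <= 3 * kappa / 4 by rewrite /d; lra.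
have nN2 : (5 ^ J * n <= 2 * N)%N by rewrite (leq_trans nN)// leq_pmull.
have P := propagation d0 dtau tau0 B0 S0 rx xb gP gB base n0 nN2.
pose c := 2 ^+ (loss J * n) * S + (tau + J%:R) * B * 2^-1 ^+ n.
have c0 : 0 <= c.
  have tJ : 0 <= tau + J%:R by rewrite addr_ge0.
  by rewrite /c addr_ge0 ?(mulr_ge0 _ S0) ?(mulr_ge0 (mulr_ge0 tJ B0)) ?exprn_ge0.
have : nrm (u 0%N) <= nrmw (u 0%N) + c.
  apply: snorm_split => //; apply: ae_leb_imp uU => x /andP[x0 x1] -> kx.
  rewrite -gU; last by rewrite x1 andbT /r; lra.
  by apply: P => //; apply/andP; split; lra.
move=> /le_trans; apply; rewrite /c addrA; apply: lerD; last first.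
  by rewrite /B le_eqVlt; apply/orP; left; apply/eqP; ring.
rewrite /S (_ : _ * nrmw _ = 2 ^+ (loss J * n) * nrmw (u 0%N)
  + 2 ^+ (loss J * n) * (2 / Num.sqrt kappa * nrmw (u 0%N))); last by ring.
by rewrite lerD2r ler_peMl ?snorm_ge0// exprn_ege1// ler1n.
Qed.

End InteriorEstimate.

(** * Density of the domains of the powers *)

Section ClosedSubspace.
Import HBNNSimple.
Context {R : realType}.
Local Notation L2 := (L2 (0 : R) 1).
Local Notation ip := (@L2ip R 0 1).
Local Notation nrm := (snorm ip).

Lemma L2_dominated (h : nat -> L2) (f G : L2) :
  (forall n (x : R), 0 < x < 1 -> `|h n x| <= G x) ->
  (forall x : R, 0 < x < 1 -> h n x @[n --> \oo] --> f x) ->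
  forall e, 0 < e -> exists n, nrm (f - h n) < e.
Proof.
move=> hG hf e e0; have ipP := L2ip_semi_inner (R := R) 0 1.
have fG (x : R) : 0 < x < 1 -> `|f x| <= G x.
  move=> x01; apply: (cvgr_to_le (cvg_norm (hf x x01))).
  by near=> n; exact: hG.
pose phi n := fun x : measurableTypeR R => (((f - h n) x * (f - h n) x)%:E : \bar R).
have phi_m n : measurable_fun setT (phi n).
  by apply/measurable_EFinP; apply: measurable_funM.
have intG : (leb 0 1).-integrable setT (fun x => ((2 * G x) * (2 * G x))%:E).
  have := L2_mul_integrable (2 *: G) (2 *: G).
  by apply: eq_integrable.
have [] := @dominated_convergence _ _ _ (leb 0 1) setT measurableT phi (cst 0%E)
  (fun x => ((2 * G x) * (2 * G x))%:E) phi_m (measurable_cst _) _ intG.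
- apply: ae_leb_itv => x x01 _; apply/cvg_EFin; first by near=> n.
  rewrite [X in X @ _ --> _](_ : _ = (fun n => (f x - h n x) * (f x - h n x))); last first.
    exact/funext.
  rewrite [X in _ --> X](_ : _ = (f x - f x) * (f x - f x)); last by rewrite subrr mul0r.
  by apply: cvgM; apply: cvgB; (exact: cvg_cst || exact: hf).
- apply: ae_leb_itv => x x01 n _; rewrite /phi lee_fin normrM.
  have h1 : `|(f - h n) x| <= 2 * G x.
    rewrite [_ x](_ : _ = f x - h n x)//.
    by have := ler_normB (f x) (h n x); have := hG n x x01; have := fG x x01; lra.
  exact: ler_pM.
move=> _ + _ => /fine_cvgP[_ /cvgr0Pnorm_lt /(_ (e ^+ 2))].
rewrite exprn_gt0// => /(_ isT) [n _ /(_ n (leqnn n)) /= H]; exists n.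
rewrite -ltr_sqr ?nnegrE ?snorm_ge0 ?(ltW e0)// (snorm_sqr ipP).
apply: le_lt_trans H; rewrite (le_trans _ (ler_norm _))//.
rewrite /L2ip /Rintegral le_eqVlt; apply/orP; left; apply/eqP; congr fine.
apply: eq_integral => x _; congr _%:E.
by rewrite subr0 ger0_norm// -expr2 sqr_ge0.
Unshelve. all: by end_near. Qed.

Section Density.
Variable S : L2 -> Prop.
Hypothesis S_lin : forall (k : R) (f g : L2), S f -> S g -> S (k *: f + g).
Hypothesis S_closed : forall f, (forall e, 0 < e -> exists g, S g /\ nrm (f - g) < e) -> S f.
Hypothesis S_itv : forall (a b : R) (f : L2), 0 < a -> a < b -> b < 1 ->
  (forall x : R, 0 < x < 1 -> f x = \1_`]a, b[ x) -> S f.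

Lemma closed_dominated (h : nat -> L2) (f G : L2) : (forall n, S (h n)) ->
  (forall n (x : R), 0 < x < 1 -> `|h n x| <= G x) ->
  (forall x : R, 0 < x < 1 -> h n x @[n --> \oo] --> f x) -> S f.
Proof.
move=> Sh hG hf; apply: S_closed => e e0.
by have [n nP] := L2_dominated hG hf e0; exists (h n).
Qed.

Lemma indic_Lfun (A : set (measurableTypeR R)) : measurable A ->
  (\1_A : R -> R) \in Lfun (leb 0 1) 2%:E.
Proof.
move=> mA; apply: (@Lfun2_bounded _ _ _ _ 1); first exact: measurable_indic.
by move=> x _; rewrite indicE; case: (_ \in _); rewrite ?normr1// normr0.
Qed.

Definition L2indic A (mA : measurable A) : L2 := Lfun_Sub (lee1n 2) (indic_Lfun mA).

Lemma closed_zero : S 0.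
Proof.
have h1 : 0 < 3^-1 :> R by rewrite invr_gt0.
have h2 : 3^-1 < 2^-1 :> R by lra.
have h3 : 2^-1 < 1 :> R by lra.
have Si : S (L2indic (measurable_oo (3^-1 : R) 2^-1)) by apply: S_itv h1 h2 h3 _.
by have := S_lin (-1) Si Si; rewrite scaleN1r addNr.
Qed.

(** Rays are a class stable under intersection, as the monotone class argument
requires; on [(0, 1)] they are limits of intervals. *)
Lemma closed_ray (x0 : R) (f : L2) : (forall x : R, 0 < x < 1 -> f x = \1_`]x0, +oo[ x) -> S f.
Proof.
move=> fE; pose a := Num.max x0 0.
have a0 : 0 <= a by rewrite le_max lexx orbT.
have S0 := closed_zero.
have [a1|a1] := leP 1 a.
  apply: S_closed => e e0; exists 0; split => //; rewrite subr0.
  have ipP := L2ip_semi_inner (R := R) 0 1.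
  have := @L2_upper_bound R 0 1 f 0 ler01.
  rewrite expr0n mul0r => H; apply: le_lt_trans e0.
  rewrite -ler_sqr ?nnegrE ?snorm_ge0// expr0n; apply: H.
  apply: ae_leb_itv => x x01; rewrite fE// indicE memNset ?normr0//= in_itv/= andbT.
  apply/negP; rewrite -leNgt; case/andP: x01 => _ /ltW x1.
  by move: a1; rewrite le_max => /orP[|]; [exact: le_trans|rewrite ler10].
pose t n := (1 - a) / n.+3%:R.
have t0 n : 0 < t n by rewrite divr_gt0// subr_gt0.
have t3 n : 3 * t n <= 1 - a.
  by rewrite /t mulrA ler_pdivrMr// mulrC ler_wpM2l ?subr_ge0 ?(ltW a1)// ler_nat.
have m n := measurable_oo (a + t n) (1 - t n).
apply: (@closed_dominated (fun n => L2indic (m n)) f (L2cst 0 1 1)).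
- move=> n; have := t0 n; have := t3 n => t3n t0n.
  by apply: (@S_itv (a + t n) (1 - t n)) => //; lra.
- move=> n x _ /=; rewrite indicE.
  by case: (_ \in _); rewrite ?normr1// normr0.
- move=> x x01; rewrite fE//=.
  have [ax|xa] := ltP a x; last first.
    rewrite [X in _ --> X](_ : _ = 0).
      apply: cvg_near_cst; near=> n; rewrite /= indicE memNset//= in_itv/=.
      by move=> /andP[h _]; have := t0 n; lra.
    rewrite indicE memNset//= in_itv/= andbT; apply/negP; rewrite -leNgt.
    move: xa; rewrite le_max => /orP[//|x0'].
    by case/andP: x01; rewrite ltNge x0'.
  rewrite [X in _ --> X](_ : _ = 1); last first.
    rewrite indicE mem_set//= in_itv/= andbT.
    by move: ax; rewrite gt_max => /andP[].
  have tc : t n @[n --> \oo] --> 0.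
    rewrite -(mulr0 (1 - a)); apply: cvgM; first exact: cvg_cst.
    rewrite (_ : (fun n => _) = [sequence @harmonic R (n + 2)%N]_n).
      by rewrite cvg_shiftn; exact: cvg_harmonic.
    by apply/funext => n; rewrite /= addn2.
  have x1 : 0 < 1 - x by case/andP: x01; lra.
  have xa : 0 < x - a by rewrite subr_gt0.
  apply: cvg_near_cst; near=> n; rewrite /= indicE mem_set//= in_itv/=.
  have : t n < Num.min (x - a) (1 - x).
    by near: n; apply: (cvgr_lt _ tc); rewrite lt_min xa.
  by rewrite lt_min => /andP[h1 h2]; apply/andP; split; lra.
Unshelve. all: by end_near. Qed.

(** The measurable sets whose indicator belongs to [S] form a Dynkin system. *)
Lemma closed_indic (A : set (measurableTypeR R)) (mA : measurable A) (f : L2) :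
  (forall x : R, 0 < x < 1 -> f x = \1_A x) -> S f.
Proof.
move: f; pose G := [set A | exists x : R, A = `]x, +oo[%classic].
pose P (A : set (measurableTypeR R)) := forall f : L2,
  (forall x : R, 0 < x < 1 -> f x = \1_A x) -> S f.
have ST : P setT.
  move=> f fE; apply: (@closed_ray (-1)) => x x01; rewrite fE// !indicE !mem_set//=.
  by rewrite in_itv/= andbT; case/andP: x01; lra.
have S0 := closed_zero.
have GE : @measurable _ (measurableTypeR R) = <<s G >>.
  exact: RGenOInfty.measurableE.
apply: (@dynkin_induction _ (measurableTypeR R) G P) => //.
- move=> _ _ [x ->] [y ->]; exists (Num.max x y); apply/seteqP; split => z /=;
    rewrite !in_itv/= !andbT gt_max; first by move=> [-> ->].
  by move=> /andP[].
- by move=> _ [x ->] f fE; exact: closed_ray fE.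
- move=> B mB SB f fE.
  have -> : f = -1 *: L2indic mB + (f + L2indic mB).
    by rewrite scaleN1r addrCA addNr addr0.
  apply: S_lin; first exact: SB.
  apply: ST => x x01; rewrite [LHS](_ : _ = f x + \1_B x)// fE// !indicE in_setC in_setT.
  by case: (x \in B); rewrite ?add0r ?addr0.
- move=> F mF tF SF f fE.
  pose h := fix h n : L2 := if n is n'.+1 then h n' + L2indic (mF n') else 0.
  have hE n (x : R) : h n x = \sum_(k < n) \1_(F k) x.
    elim: n => [|n IH]; first by rewrite big_ord0.
    by rewrite big_ord_recr/= [LHS](_ : _ = h n x + \1_(F n) x)// IH.
  have hI n (x : R) : h n x = (`[< exists2 k, (k < n)%N & F k x >])%:R.
    rewrite hE; case: asboolP => [[k kn Fkx]|nF].
      rewrite (bigD1 (Ordinal kn))//= big1 ?addr0 => [|j jk].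
        by rewrite indicE mem_set.
      rewrite indicE memNset// => Fjx; move/eqP: jk; apply; apply: val_inj => /=.
      by apply: tF => //; exists x.
    rewrite big1// => j _; rewrite indicE memNset// => Fjx; apply: nF.
    by exists j.
  apply: (@closed_dominated h f (L2cst 0 1 1)).
  - elim => [|n IH] //=; rewrite addrC -[L2indic _]scale1r; apply: S_lin => //.
    exact: SF.
  - by move=> n x _; rewrite hI /=; case: asbool; rewrite ?normr1// normr0.
  - move=> x x01; rewrite fE//; apply: cvg_near_cst.
    have [[k _ Fkx]|nF] := pselect ((\bigcup_k F k) x).
      near=> n; rewrite hI indicE mem_set; last by exists k.
      rewrite asboolT//; exists k => //; near: n; exact: nbhs_infty_gt.
    near=> n; rewrite hI indicE memNset// asboolF// => -[k _ Fkx]; apply: nF.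
    by exists k.
- by rewrite -GE.
Unshelve. all: by end_near. Qed.

Lemma closed_ext (f g : L2) : (forall x : R, 0 < x < 1 -> g x = f x) -> S f -> S g.
Proof.
move=> gf Sf; apply: S_closed => e e0; exists f; split => //.
have ipP := L2ip_semi_inner (R := R) 0 1.
have /(weqP ipP) -> // : weq ip g f.
by apply: weq_ae; apply: ae_leb_itv => x x01; exact: gf.
Qed.

Lemma closed_simple (m : nat) (c : nat -> R) (A : nat -> set (measurableTypeR R)) (f : L2) :
  (forall i, measurable (A i)) ->
  (forall x : R, 0 < x < 1 -> f x = \sum_(i < m) c i * \1_(A i) x) -> S f.
Proof.
move=> mA fE.
have S0 := closed_zero.
pose h := fix h n : L2 := if n is n'.+1 then c n' *: L2indic (mA n') + h n' else 0.
have hE n (x : R) : h n x = \sum_(i < n) c i * \1_(A i) x.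
  elim: n => [|n IH]; first by rewrite big_ord0.
  by rewrite big_ord_recr/= [LHS](_ : _ = c n * \1_(A n) x + h n x)// IH addrC.
apply: (@closed_ext (h m)); first by move=> x x01; rewrite fE.
elim: m {fE} => [|m IH] //=; apply: S_lin => //.
by apply: (closed_indic (mA m)) => x _.
Qed.

(** Write [f] as [|f| - (|f| - f)], and approximate each of these nonnegative functions
from below by simple ones, which it dominates. *)
Lemma closed_subspace_full (f : L2) : S f.
Proof.
have S_nonneg (g : L2) : (forall x, 0 <= g x) -> S g.
  move=> g0.
  have mg : measurable_fun setT (EFin \o (g : measurableTypeR R -> R)).
    exact/measurable_EFinP.
  pose hs := nnsfun_approx (@measurableT _ (measurableTypeR R)) mg.
  pose h n : measurableTypeR R -> R := hs n.
  have hc (x : measurableTypeR R) : h n x @[n --> \oo] --> g x.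
    have := @cvg_nnsfun_approx _ _ _ _ measurableT _ mg (fun y _ => g0 y) x I.
    by move=> /fine_cvgP[].
  have hnd (x : measurableTypeR R) : nondecreasing_seq (fun n => h n x).
    move=> n m nm; have := nd_nnsfun_approx measurableT mg nm.
    by move=> /lefP; apply.
  have hg n (x : measurableTypeR R) : h n x <= g x.
    rewrite -(cvg_lim (@Rhausdorff R) (hc x)).
    by apply: nondecreasing_cvgn_le; [exact: hnd|apply/cvg_ex; exists (g x)].
  have hL n : h n \in Lfun (leb 0 1) 2%:E.
    apply: (@Lfun2_ae_le _ _ _ g _ 1) => //; first exact: LfunP.
    by apply: ae_leb_itv => x _; rewrite mul1r !ger0_norm//; exact: hg.
  apply: (@closed_dominated (fun n => Lfun_Sub (lee1n 2) (hL n)) g g).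
  - move=> n; pose s : seq R := finmap.enum_fset (fset_set (hs n @` setT)).
    have mA i : measurable ((hs n @^-1` [set s`_i]) : set (measurableTypeR R)).
      exact: measurable_sfunP.
    have H := @closed_simple _ (fun i => s`_i) _ (Lfun_Sub (lee1n 2) (hL n)) mA.
    by apply: H => x _; exact: fimfunEord.
  - by move=> n x _ /=; rewrite ger0_norm//; exact: hg.
  - by move=> x _; exact: hc.
have fL : (fun x => `|f x|) \in Lfun (leb 0 1) 2%:E.
  apply: (@Lfun2_ae_le _ _ _ f _ 1) => //; first exact: LfunP.
    exact: measurableT_comp.
  by apply: ae_leb_itv => x _; rewrite mul1r normr_id.
pose fa : L2 := Lfun_Sub (lee1n 2) fL.
have -> : f = -1 *: (fa - f) + fa by rewrite scaleN1r opprB subrK.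
apply: S_lin; apply: S_nonneg => x; last exact: normr_ge0.
by rewrite [leRHS](_ : _ = `|f x| - f x)// subr_ge0 ler_norm.
Qed.

End Density.
End ClosedSubspace.

Section PositivePart.
Context {R : realType}.

(** The exponent is at least [2], so that the function is differentiable at [0]. *)
Lemma is_derive_pos_pow (m : nat) (y : R) :
  is_derive y (1 : R) (fun t => Num.max t 0 ^+ m.+2) (m.+2%:R * Num.max y 0 ^+ m.+1).
Proof.
apply/is_deriveP => e e0; have [y0|y0|->] := ltrgtP y 0.
- exists (- y); first by rewrite oppr_gt0.
  move=> t; rewrite ltr_norml => /andP[_ ty].
  rewrite max_r; last by lra.
  by rewrite !expr0n/= mulr0 mul0r !subr0 normr0 mulr_ge0// ltW.
- have := is_deriveX m.+2 (is_derive_id y (1 : R)) => /is_deriveP /(_ e e0) [d d0 dP].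
  exists (Num.min d y); first by rewrite lt_min d0.
  move=> t; rewrite lt_min => /andP[td]; rewrite ltr_norml => /andP[ty _].
  rewrite max_l; last by lra.
  by have := dP t td; rewrite /GRing.scale/= !exprfctE/= mulr1.
- exists (Num.min 1 e); first by rewrite lt_min ltr01.
  move=> t; rewrite lt_min !subr0 => /andP[t1 te].
  rewrite !expr0n/= mulr0 mul0r !subr0 normrX exprS exprS mulrA.
  have h0 : `|Num.max t 0| <= `|t|.
    by case: (leP t 0) => _; rewrite ?normr0.
  have h1 : `|Num.max t 0| <= 1 by rewrite (le_trans h0)// ltW.
  have h2 : `|Num.max t 0| <= e by rewrite (le_trans h0)// ltW.
  rewrite -[leRHS]mulr1; apply: ler_pM => //; rewrite ?mulr_ge0 ?exprn_ge0//.
    by apply: ler_pM.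
  by rewrite exprn_ile1.
Qed.

End PositivePart.

Section Bumps.
Context {R : realType} (alpha beta0 beta1 a b : R).
Hypothesis alpha01 : 0 < alpha < 1.
Hypotheses (a0 : 0 < a) (ab : a < b) (b1 : b < 1).
Local Notation L2 := (L2 (0 : R) 1).
Local Notation op := (opA alpha beta0 beta1).

Definition bumpq : {poly R} := ('X - a%:P) * (b%:P - 'X).

(** The closure of this family under [f |-> (x ^ alpha f')'] requires the power
[x `^ s] and the polynomial [P], which both change under differentiation. *)
Definition bump (s : R) (P : {poly R}) (m : nat) (x : R) : R :=
  x `^ s * P.[x] * Num.max bumpq.[x] 0 ^+ m.

Definition bump_der (s : R) (P : {poly R}) (m : nat) : {poly R} :=
  (s *: P + 'X * P^`()) * bumpq + m%:R *: ('X * P * bumpq^`()).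

Lemma bumpqE x : bumpq.[x] = (x - a) * (b - x).
Proof. by rewrite !hornerE. Qed.

Lemma bump_out s P m x : (0 < m)%N -> ~~ (a < x < b) -> bump s P m x = 0.
Proof.
move=> m0 nx; rewrite /bump max_r ?expr0n ?gtn_eqF ?mulr0//.
rewrite bumpqE; move: nx; rewrite negb_and -!leNgt => /orP[xa|bx].
  by rewrite mulr_le0_ge0// ?subr_le0// subr_ge0 (le_trans xa (ltW ab)).
by rewrite mulr_ge0_le0// ?subr_le0// subr_ge0 (le_trans (ltW ab) bx).
Qed.

Lemma bump_derive s P m (x : R) : 0 < x ->
  is_derive x (1 : R) (bump s P m.+2) (bump (s - 1) (bump_der s P m.+2) m.+1 x).
Proof.
move=> x0.
have dw := is_derive1_comp (is_derive_pos_pow m bumpq.[x]) (is_derive_poly bumpq x).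
have dP := is_deriveM (@is_derive1_powR R s x x0) (is_derive_poly P x).
rewrite (_ : bump s P m.+2 = (fun y => y `^ s) * horner P *
  ((fun t => Num.max t 0 ^+ m.+2) \o horner bumpq))//.
apply: (is_derive_eq (is_deriveM dP dw)).
have dE : (bump_der s P m.+2).[x] = (s * P.[x] + x * P^`().[x]) * bumpq.[x]
    + m.+2%:R * (x * P.[x] * bumpq^`().[x]).
  by rewrite /bump_der; move: bumpq => Q; rewrite !hornerE.
rewrite /GRing.scale/= /bump dE.
have xs : x `^ s = x * x `^ (s - 1).
  rewrite -{2}(powRr1 (ltW x0)) -powRD ?subrKC//.
  by rewrite (gt_eqF x0) implybT.
rewrite -[X in X * _]/(x `^ s * P.[x]) xs.
have -> : Num.max bumpq.[x] 0 ^+ m.+2 = bumpq.[x] * Num.max bumpq.[x] 0 ^+ m.+1.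
  rewrite exprS; case: (leP bumpq.[x] 0) => // _.
  by rewrite !expr0n/= !mulr0.
ring.
Qed.

Lemma bump_continuous s P m : continuous (bump s P m.+1).
Proof.
move=> x; have [x0|x0] := ltP 0 x.
  apply: cvgM; [apply: cvgM|].
  - exact: (is_derive_continuous (@is_derive1_powR R s x x0)).
  - exact: continuous_horner.
  - apply: (@continuous_comp _ _ _ (fun x => Num.max bumpq.[x] 0) (fun t => t ^+ m.+1)).
      apply: (@continuous_max _ _ (horner bumpq) (cst 0)).
        exact: continuous_horner.
      exact: cvg_cst.
    exact: exprn_continuous.
rewrite /continuous_at bump_out//; last by rewrite negb_and -leNgt (le_trans x0 (ltW a0)).
apply: cvg_near_cst; near=> y; apply: bump_out => //.
rewrite negb_and -leNgt; apply/orP; left; apply/ltW; near: y.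
by apply: lt_nbhsl; exact: le_lt_trans a0.
Unshelve. all: by end_near. Qed.

Lemma bump_bounded s P m : exists M, forall x, 0 <= x <= 1 -> `|bump s P m.+1 x| <= M.
Proof.
have c : {within `[0, 1], continuous (fun x => `|bump s P m.+1 x|)}.
  apply: continuous_subspaceT => x; apply: cvg_norm; exact: bump_continuous.
have [t _ tP] := EVT_max ler01 c; exists `|bump s P m.+1 t| => x x01.
by apply: tP; rewrite in_itv.
Qed.

Lemma bump_measurable s P m : measurable_fun setT (bump s P m.+1 : measurableTypeR R -> R).
Proof. by apply: continuous_measurable_fun; exact: bump_continuous. Qed.

Lemma bump_Lfun s P m : bump s P m.+1 \in Lfun (leb 0 1) 2%:E.
Proof.
have [M MP] := bump_bounded s P m.
apply: (@Lfun2_bounded _ _ _ _ M); first exact: bump_measurable.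
by move=> x /andP[x0 x1]; apply: MP; rewrite !ltW.
Qed.

Definition bumpL2 s P m : L2 := Lfun_Sub (lee1n 2) (bump_Lfun s P m).

Lemma bump_ac s P m : abs_continuous 0 1 (bump s P m.+2).
Proof.
have [M MP] := bump_bounded (s - 1) (bump_der s P m.+2) m.
move=> e e0; have M1 : 0 < `|M| + 1 by rewrite ltr_wpDl.
exists (e / (`|M| + 1)); first exact: divr_gt0.
move=> n x y xy _; rewrite ltr_pdivlMr// => H; apply: le_lt_trans H.
rewrite mulrC mulr_sumr; apply: ler_sum => i _; have [x0 xyi y1] := xy i.
have [||t tI ->] := @MVT_segment R (bump s P m.+2)
    (bump (s - 1) (bump_der s P m.+2) m.+1) (x i) (y i) xyi.
- move=> t; rewrite in_itv/= => /andP[xt _]; apply: bump_derive.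
  exact: le_lt_trans xt.
- by apply: continuous_subspaceT; exact: bump_continuous.
rewrite normrM (ger0_norm (_ : 0 <= y i - x i)) ?subr_ge0// ler_wpM2r ?subr_ge0//.
move: tI; rewrite in_itv/= => /andP[xt ty].
rewrite (le_trans (MP _ _)) ?(le_trans x0 xt) ?(le_trans ty y1)//.
by rewrite (le_trans (ler_norm _))// lerDl.
Qed.

Lemma bump_shift s s' P m x : 0 <= x -> x `^ s' * bump s P m.+1 x = bump (s' + s) P m.+1 x.
Proof.
rewrite le_eqVlt => /predU1P[<-|x0].
  have o : ~~ (a < 0 < b) by rewrite negb_and -leNgt (ltW a0).
  by rewrite !bump_out// mulr0.
rewrite /bump powRD; first ring.
by rewrite (gt_eqF x0) implybT.
Qed.

(** Each of the two derivatives decreases by one the exponent of the positive part,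
and preserves the shape of the function. The support stays away from [0] and [1],
which settles the boundary conditions. *)
Lemma bump_opA s P m : exists s' P', op (bumpL2 s P m.+2) (bumpL2 s' P' m).
Proof.
case/andP: alpha01 => al0 al1.
pose P1 := bump_der s P m.+3; pose s1 := alpha + (s - 1).
pose P2 := bump_der s1 P1 m.+2.
exists (s1 - 1), P2, (bump s P m.+3), (bump (s - 1) P1 m.+2), (bump s1 P1 m.+2).
have out0 s' P' n : bump s' P' n.+1 0 = 0.
  by rewrite bump_out// negb_and -leNgt (ltW a0).
have dU : ae_derivative (bump s P m.+3) (bump (s - 1) P1 m.+2).
  by apply: ae_leb_itv => x /andP[x0 _]; exact: bump_derive.
split.
- exact: ae_leb_itv.
- split; last split.
  + split => //; first exact: bump_ac.
      apply: (@Lfun2_ae_le _ _ _ (bumpL2 (alpha / 2 + (s - 1)) P1 m.+1) _ 1) => //.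
      * exact: LfunP.
      * by apply: measurable_funM; [exact: measurable_powR|exact: bump_measurable].
      * apply: ae_leb_itv => x /andP[x0 _].
        by rewrite mul1r bump_shift ?(ltW x0).
    by rewrite bump_out// negb_and -!leNgt (ltW b1) orbT.
  + apply: ae_leb_itv => x /andP[x0 _].
    by rewrite bump_shift ?(ltW x0).
  + exact: bump_ac.
  + by apply: ae_leb_itv => x /andP[x0 _]; exact: bump_derive.
  + exact: bump_Lfun.
- by rewrite !out0 !mulr0 subrr.
Qed.

Lemma bump_chain N s P : exists u : nat -> L2,
  u 0%N = bumpL2 s P (2 * N.+1) /\ forall j, (j <= N)%N -> op (u j) (u j.+1).
Proof.
elim: N s P => [|N IH] s P.
  have [s' [P' H]] := bump_opA s P 0.
  exists (fun j => if j is 0 then bumpL2 s P 2 else bumpL2 s' P' 0); split => //.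
  by case.
rewrite mulnS; have [s' [P' H]] := bump_opA s P (2 * N.+1).
have [u [u0 uP]] := IH s' P'.
exists (fun j => if j is j'.+1 then u j' else bumpL2 s P (2 + 2 * N.+1)); split => //.
by case => [_|j]; [rewrite u0|exact: uP].
Qed.

(** [1 - (1 - v) ^ n] is divisible by [v], the quotient being this sum when [v] is the
[m]-th power of [bumpq]. *)
Definition bump_sum (m n : nat) : {poly R} := \sum_(k < n) (1 - bumpq ^+ m) ^+ k.

Lemma bump_sumE m n x : a < x < b ->
  bump 0 (bump_sum m.+1 n) m.+1 x = 1 - (1 - bumpq.[x] ^+ m.+1) ^+ n.
Proof.
move=> /andP[ax xb]; rewrite /bump powRr0 mul1r /bump_sum horner_sum max_l; last first.
  by rewrite bumpqE mulr_ge0// subr_ge0 ltW.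
under eq_bigr do rewrite horner_exp hornerD hornerN hornerC horner_exp.
set v := bumpq.[x] ^+ m.+1.
have := subrXX 1 (1 - v) n; rewrite expr1n => ->; rewrite subKr mulrC.
by congr (_ * _); apply: eq_bigr => k _; rewrite expr1n mul1r.
Qed.

End Bumps.

Section DenseBumps.
Context {R : realType}.
Local Notation L2 := (L2 (0 : R) 1).
Local Notation nrm := (snorm (@L2ip R 0 1)).

(** As [0 < v < 1] inside [(a, b)] and [v = 0] outside for a power [v] of the
basic bump, [1 - (1 - v) ^ n] tends to the indicator of [(a, b)]. *)
Lemma dense_bumps (S : L2 -> Prop) (m : nat) :
  (forall (k : R) (f g : L2), S f -> S g -> S (k *: f + g)) ->
  (forall f, (forall e, 0 < e -> exists g, S g /\ nrm (f - g) < e) -> S f) ->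
  (forall (a b : R) (a0 : 0 < a) (ab : a < b) (b1 : b < 1) s P, S (bumpL2 a0 ab s P m)) ->
  forall f, S f.
Proof.
move=> S_lin S_closed S_bump; apply: closed_subspace_full => // a b f a0 ab b1 fE.
apply: (@closed_dominated _ S S_closed
  (fun n => bumpL2 a0 ab 0 (bump_sum a b m.+1 n) m) f (L2cst 0 1 1)).
    by move=> n; apply: S_bump.
  move=> n x _ /=.
  have [xab|nx] := boolP (a < x < b); last by rewrite bump_out ?normr0.
  rewrite bump_sumE//; set v := _ ^+ m.+1.
  have /andP[v0 v1] : 0 <= v <= 1.
    case/andP: xab => ax xb.
    rewrite /v bumpqE exprn_ge0 ?mulr_ge0 ?exprn_ile1 ?mulr_ge0 ?mulr_ile1//; lra.
  rewrite ger0_norm; last by rewrite subr_ge0 exprn_ile1//; lra.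
  by rewrite gerBl exprn_ge0//; lra.
move=> x x01; rewrite fE//=.
have [xab|nx] := boolP (a < x < b); last first.
  rewrite indicE memNset; last by rewrite /= in_itv/=; apply/negP.
  apply: cvg_near_cst; near=> n; exact: bump_out.
rewrite indicE mem_set; last by rewrite /= in_itv/=.
rewrite [X in X @ _ --> _](_ : _ =
  (fun n => 1 - (1 - (bumpq a b).[x] ^+ m.+1) ^+ n)); last first.
  by apply/funext => n; rewrite bump_sumE.
rewrite -[X in _ --> X]subr0; apply: cvgB; first exact: cvg_cst.
apply: cvg_expr; case/andP: xab => ax xb.
have v0 : 0 < (bumpq a b).[x] < 1.
  by rewrite bumpqE mulr_gt0 ?mulr_ilt1//; lra.
case/andP: v0 => v0 v1.
have w0 : 0 < (bumpq a b).[x] ^+ m.+1 by rewrite exprn_gt0.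
have w1 : (bumpq a b).[x] ^+ m.+1 <= 1 by rewrite exprn_ile1// ltW.
by rewrite ger0_norm; lra.
Unshelve. all: by end_near. Qed.

End DenseBumps.

(** * Observability *)

Section Transfer.
Context {R : realType}.
Local Notation L2 := (L2 (0 : R) 1).
Local Notation ip := (@L2ip R 0 1).
Local Notation nrm := (snorm ip).

Lemma cvg_right0P (h : R -> R) : (forall t, 0 <= h t) ->
  h t @[t --> 0^'+] --> (0 : R) <->
  forall e, 0 < e -> exists2 d, 0 < d & forall t, 0 < t < d -> h t < e.
Proof.
move=> h0; split=> [/cvgr0Pnorm_lt H e e0|H].
  have [d d0 dP] := H e e0; exists d => // t /andP[t0 td].
  have := dP t; rewrite /ball_/= sub0r normrN (gtr0_norm t0) => /(_ td t0).
  by rewrite ger0_norm.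
apply/cvgr0Pnorm_lt => e e0; have [d d0 dP] := H e e0.
exists d => //= t; rewrite /ball_/= sub0r normrN => td t0.
by rewrite ger0_norm// dP// t0 (le_lt_trans (ler_norm _) td).
Qed.

Variable E : R -> L2 -> L2.

Lemma contraction_wsemigroup : contraction_semigroup E -> wsemigroup ip E.
Proof.
move=> [lin e0 eD contr cont]; split.
- by move=> t t0 k f g; apply: weq_ae; exact: lin.
- by move=> f; apply: weq_ae; exact: e0.
- by move=> s t f s0 t0; apply: weq_ae; exact: eD.
- by move=> t f t0; rewrite -!L2norm_snorm; exact: contr.
- move=> f; apply/(@cvg_right0P (fun t => nrm (E t f - f))).
    by move=> t; exact: snorm_ge0.
  by have := cont f; under eq_fun do rewrite L2norm_snorm.
Qed.

Lemma generator_wgenerator (A : L2 -> L2 -> Prop) : is_generator A E ->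
  forall u f, A u f <-> wgenerator ip E u f.
Proof.
move=> AE u f; rewrite (AE u f).
have := @cvg_right0P (fun t => nrm (t^-1 *: (E t u - u) - f)) (fun=> snorm_ge0 _ _).
by under eq_fun do rewrite -L2norm_snorm.
Qed.

End Transfer.

(** Each factor of the falling factorial is at least [j]. *)
Lemma expn_fact_le (j : nat) : (j ^ j * j`! <= (2 * j)`!)%N.
Proof.
rewrite -(@ffact_fact (2 * j) j); last by lia.
have -> : (2 * j - j = j)%N by lia.
rewrite leq_mul2r; apply/orP; right.
rewrite ffact_prod -[X in (_ ^ X <= _)%N]card_ord -prod_nat_const.
by apply: leq_prod => i _; have := ltn_ord i; lia.
Qed.

(** The bound of the [j]-th iterate by smoothing, put in the form that analyticity
requires, with the dependence on the time isolated in an exponential. *)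
Lemma power_fact_exp (R : realType) (S : R) (j : nat) : 0 < S ->
  (S / j%:R)^-1 ^+ j <= (2 * j)`!%:R * expR S^-1.
Proof.
move=> S0; have e1 : 1 <= expR S^-1 by rewrite -expR0 ler_expR invr_ge0 ltW.
case: j => [|j]; first by rewrite expr0 muln0 fact0 mul1r.
have SV : 0 <= S^-1 by rewrite invr_ge0 ltW.
have f0 : 0 < (j.+1)`!%:R :> R by rewrite ltr0n fact_gt0.
have h : S^-1 ^+ j.+1 <= (j.+1)`!%:R * expR S^-1.
  by have := expR_ge1Dxn j SV; rewrite -ler_pdivrMl// mulrC => ?; lra.
rewrite invfM invrK mulrC exprMn.
apply: (@le_trans _ _ (j.+1%:R ^+ j.+1 * ((j.+1)`!%:R * expR S^-1))).
  by rewrite ler_wpM2l// exprn_ge0.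
rewrite mulrA ler_wpM2r ?expR_ge0// -natrX -natrM ler_nat.
exact: expn_fact_le.
Qed.

Section Control_of_degenerate_semigroup.
Context (R : realType) (alpha beta0 beta1 kappa : R).
Variable E : R -> L2 (0 : R) 1 -> L2 (0 : R) 1.
Hypotheses (alpha01 : 0 < alpha < 1) (beta1_neq0 : beta1 != 0).
Hypothesis kappa01 : 0 < kappa < 1.
Hypothesis E_semigroup : contraction_semigroup E.
Hypothesis E_generator : is_generator (opA alpha beta0 beta1) E.
Local Notation op := (opA alpha beta0 beta1).
Local Notation L2 := (L2 (0 : R) 1).
Local Notation ip := (@L2ip R 0 1).
Local Notation nrm := (snorm ip).
Local Notation ipw := (ipw kappa01).
Local Notation nrmw := (snorm ipw).

Let ipP : semi_inner ip := L2ip_semi_inner 0 1.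
Let ipwP : semi_inner ipw := ipw_semi_inner kappa01.
Let EP : wsemigroup ip E := contraction_wsemigroup E_semigroup.
Let genP u f : op u f <-> wgenerator ip E u f := generator_wgenerator E_generator u f.

Lemma op_lin (k : R) u f v g : op u f -> op v g -> op (k *: u + v) (k *: f + g).
Proof.
move=> /genP uf /genP vg; apply/genP => e e0.
have k0 : 0 < 2 * (`|k| + 1) by rewrite mulr_gt0// ltr_wpDl.
have [d1 d10 d1P] := uf _ (divr_gt0 e0 k0).
have [d2 d20 d2P] := vg _ (divr_gt0 e0 (ltr0n _ 2)).
exists (Num.min d1 d2); first by rewrite lt_min d10.
move=> t /andP[t0]; rewrite lt_min => /andP[td1 td2].
have {}d1P := d1P t; have {}d2P := d2P t; rewrite t0 in d1P d2P.
have := d1P td1; have := d2P td2.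
set X := t^-1 *: (E t u - u) - f; set Y := t^-1 *: (E t v - v) - g => hY hX.
have -> : nrm (t^-1 *: (E t (k *: u + v) - (k *: u + v)) - (k *: f + g)) = nrm (k *: X + Y).
  apply: (weq_snorm ipP) => w.
  rewrite !(ipBl ipP) !(ipZl ipP) !(ipBl ipP) (ws_lin EP (ltW t0)).
  by rewrite !(ipDl ipP) !(ipZl ipP) !(ipBl ipP) !(ipZl ipP) !(ipBl ipP) (ipNl ipP); ring.
apply: le_lt_trans (snormD ipP _ _) _; rewrite (snormZ ipP).
have : `|k| * nrm X <= `|k| * (e / (2 * (`|k| + 1))) by rewrite ler_wpM2l// ltW.
have := scaled_half_le k e0.
lra.
Qed.

(** The subspace of the vectors that can be approximated is closed and contains the
bumps. *)
Lemma power_domain_dense (N : nat) (f : L2) e : 0 < e ->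
  exists u : nat -> L2, (forall j, (j <= N)%N -> op (u j) (u j.+1)) /\ nrm (f - u 0%N) < e.
Proof.
pose S f := forall e, 0 < e -> exists u : nat -> L2,
  (forall j, (j <= N)%N -> op (u j) (u j.+1)) /\ nrm (f - u 0%N) < e.
move: e; apply: (@dense_bumps R S (2 * N.+1)) => {f}.
- move=> k f g Sf Sg e e0.
  have k0 : 0 < 2 * (`|k| + 1) by rewrite mulr_gt0// ltr_wpDl.
  have [u [uP ue]] := Sf _ (divr_gt0 e0 k0).
  have [v [vP ve]] := Sg _ (divr_gt0 e0 (ltr0n _ 2)).
  exists (fun j => k *: u j + v j); split.
    by move=> j jN; apply: op_lin; [exact: uP|exact: vP].
  have -> : k *: f + g - (k *: u 0%N + v 0%N) = k *: (f - u 0%N) + (g - v 0%N).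
    by rewrite scalerBr opprD addrACA.
  apply: le_lt_trans (snormD ipP _ _) _; rewrite (snormZ ipP).
  have : `|k| * nrm (f - u 0%N) <= `|k| * (e / (2 * (`|k| + 1))) by rewrite ler_wpM2l// ltW.
  have := scaled_half_le k e0.
  lra.
- move=> f Sf e e0; have e2 : 0 < e / 2 by rewrite divr_gt0.
  have [g [Sg fg]] := Sf _ e2; have [u [uP ue]] := Sg _ e2.
  exists u; split => //; apply: le_lt_trans (snorm_triangle ipP g _ _) _; lra.
- move=> a b a0 ab b1 s P e e0.
  have [u [u0 uP]] := bump_chain beta0 beta1 alpha01 a0 ab b1 N s P.
  exists u; split => //; rewrite u0 subrr /snorm (ip0l ipP) sqrtr0//.
Qed.

Lemma E_symmetric (t : R) u v : 0 <= t -> ip (E t u) v = ip u (E t v).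
Proof.
apply: (semigroup_symmetric ipP EP).
- by move=> u' f v' g /genP uf /genP vg; exact: opA_sym uf vg.
- move=> f e e0; have [w [wP we]] := power_domain_dense 0 f e0.
  by exists (w 0%N), (w 1%N); split => //; apply/genP; exact: wP.
Qed.

(** For each [n], finitely many powers of the operator intervene: approximate [u0] by
an element of the domain of such a power, whose orbit obeys the interior
estimate, and let the error tend to [0]. *)
Lemma orbit_estimate : exists (C1 C2 : R) (p : nat), [/\ 0 < C1, 0 < C2 &
  forall (S : R) (n : nat) (u0 : L2), 0 < S -> (0 < n)%N ->
    nrm (E S u0) <= C1 * 2 ^+ (p * n) * nrmw (E S u0)
                    + C2 * expR S^-1 * nrm u0 * 2^-1 ^+ n].
Proof.
have [C1 [C2 [p [q [C10 C20 H]]]]] := interior_estimate beta0 beta1 alpha01 kappa01.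
exists C1, C2, p; split => // S n u0 S0 n0; have S0' := ltW S0.
apply/ler_addgt0Pr => e e0.
pose K := 1 + C1 * 2 ^+ (p * n) + C2 * expR S^-1 * 2^-1 ^+ n.
have K1 : 0 <= C1 * 2 ^+ (p * n) by rewrite mulr_ge0 ?exprn_ge0// ltW.
have K2 : 0 <= C2 * expR S^-1 * 2^-1 ^+ n.
  by rewrite !mulr_ge0 ?exprn_ge0 ?expR_ge0// ltW.
have K0 : 0 < K by rewrite /K; lra.
have [u [uP ue]] := power_domain_dense (q * n) u0 (divr_gt0 e0 K0).
pose eta := nrm (u0 - u 0%N).
have etaP : K * eta <= e by rewrite mulrC -ler_pdivlMr// ltW.
have eta0 : 0 <= eta by exact: snorm_ge0.
have A0 : 0 <= expR S^-1 * nrm (u 0%N) by rewrite mulr_ge0 ?expR_ge0 ?snorm_ge0.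
have := H (q * n)%N n _ (fun j => E S (u j)) n0 (leqnn _) A0.
have chainE j : (j <= q * n)%N -> op (E S (u j)) (E S (u j.+1)).
  by move=> jN; apply/genP; apply: (gen_orbit ipP EP S0'); apply/genP; exact: uP.
have boundE j : (j <= (q * n).+1)%N ->
    nrm (E S (u j)) <= ((2 * j)`!)%:R * (expR S^-1 * nrm (u 0%N)).
  case: j => [|j] jN.
    rewrite muln0 fact0 mul1r (le_trans (ws_contraction EP _ S0'))//.
    by rewrite ler_peMl ?snorm_ge0// -expR0 ler_expR invr_ge0.
  have Sj : 0 < S / j.+1%:R by rewrite divr_gt0.
  have := ws_smoothing_iter ipP EP E_symmetric (u := u) (j := j.+1) Sj.
  rewrite mulrC divfK ?pnatr_eq0// => /(_ _)/le_trans -> //.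
    by move=> k kj; apply/genP; apply: uP; rewrite -ltnS (leq_trans kj).
  by rewrite mulrA ler_wpM2r ?snorm_ge0// power_fact_exp.
move=> /(_ chainE boundE) Hu.
have d1 : nrm (E S u0) <= nrm (E S (u 0%N)) + eta.
  have := snorm_triangle ipP (E S (u 0%N)) (E S u0) 0; rewrite !subr0 => /le_trans; apply.
  by rewrite addrC lerD2l; exact: (ws_contrB ipP EP u0 (u 0%N) S0').
have d2 : nrmw (E S (u 0%N)) <= nrmw (E S u0) + eta.
  have := snorm_triangle ipwP (E S u0) (E S (u 0%N)) 0; rewrite !subr0 => /le_trans; apply.
  rewrite addrC lerD2l (@le_trans _ _ (nrm (E S (u 0%N) - E S u0)))//.
    by apply: ler_wsqrtr; exact: ipw_le.
  by rewrite (snormBC ipP); exact: (ws_contrB ipP EP u0 (u 0%N) S0').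
have d3 : nrm (u 0%N) <= nrm u0 + eta.
  have := snorm_triangle ipP u0 (u 0%N) 0; rewrite !subr0 => /le_trans; apply.
  by rewrite addrC lerD2l (snormBC ipP).
apply: (le_trans d1); apply: (@le_trans _ _ (C1 * 2 ^+ (p * n) * (nrmw (E S u0) + eta)
  + C2 * expR S^-1 * 2^-1 ^+ n * (nrm u0 + eta) + eta)).
  rewrite lerD2r; apply: (le_trans Hu); apply: lerD; first exact: ler_wpM2l.
  rewrite [leLHS](_ : _ = C2 * expR S^-1 * 2^-1 ^+ n * nrm (u 0%N)); last by ring.
  by rewrite ler_wpM2l.
rewrite [leLHS](_ : _ = C1 * 2 ^+ (p * n) * nrmw (E S u0)
  + C2 * expR S^-1 * nrm u0 * 2^-1 ^+ n + K * eta); last by rewrite /K; ring.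
by rewrite lerD2l.
Qed.

(** Choose [n] with [2 ^ n] between [Y] and [2 * Y], where [Y] is proportional to
[exp (1 / S) / eps]: the second term of the orbit estimate is then at most half of
[eps * nrm u0], and the coefficient [2 ^ (p * n)] of the first one is of the order of
[Y ^ p]. *)
Lemma orbit_observability : exists C beta : R,
  [/\ 0 < C, 0 < beta & observability kappa E C beta].
Proof.
have [C1 [C2 [p [C10 C20 H]]]] := orbit_estimate.
(* As [2 * Y = (2 + 4 * C2) * expR S^-1 / eps], the coefficient [2 * C1 * 2 ^ (p * n)]
is at most [D * (expR S^-1 / eps) ^ p.+1]; the exponent [p.+1] keeps [beta] positive. *)
pose D := (1 + 2 * C1) * (2 + 4 * C2) ^+ p.+1.
have D1 : 1 < D.
  rewrite /D -[X in X < _](mulr1 1) ltr_pM// ?ltrDl ?mulr_gt0//.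
  by rewrite exprn_egt1//; lra.
have D0 : 0 < D by exact: lt_trans D1.
pose C := p.+1%:R + ln D.
have lnD : 0 < ln D by rewrite ln_gt0.
exists C, p.+1%:R; split; [by rewrite addr_gt0|by []|].
move=> S eps u0 S0 eps0; have S0' := ltW S0.
rewrite !L2norm_snorm L2norm_restr.
have wX : 0 <= (expR (C * (1 + S^-1)) / eps `^ p.+1%:R) ^+ 2 * nrmw (E S u0) ^+ 2.
  by rewrite mulr_ge0// sqr_ge0.
(* For [eps] at least [1], contraction suffices. *)
have [e1|e1] := leP 1 eps.
  rewrite (@le_trans _ _ (nrm u0 ^+ 2))//.
    by rewrite ler_sqr ?nnegrE ?snorm_ge0// (ws_contraction EP).
  apply: ler_wpDl; first exact: wX.
  by apply: ler_peMl; [exact: sqr_ge0|exact: exprn_ege1].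
pose Y := (2 * C2 + 1) * expR S^-1 / eps.
have ex1 : 1 <= expR S^-1 by rewrite -expR0 ler_expR invr_ge0.
have Y0 : 0 < Y by rewrite !mulr_gt0 ?expR_gt0 ?invr_gt0// addr_gt0// mulr_gt0.
have Y1 : 1 < Y.
  rewrite /Y ltr_pdivlMr// mul1r (lt_le_trans e1)//.
  by rewrite (le_trans ex1)// ler_peMl ?expR_ge0// lerDr mulr_ge0// ltW.
have [n [n0 nY nY2]] : exists n, [/\ (0 < n)%N, Y <= 2 ^+ n & 2 ^+ n <= 2 * Y].
  have [||n nP] := @geometric_lt R 2^-1 (Y^-1); [by lra|by rewrite invr_gt0|].
  have ex : exists n, Y <= 2 ^+ n.
    exists n; rewrite -[leRHS]invrK -exprVn -[leLHS]invrK lef_pV2 ?posrE ?invr_gt0 ?exprn_gt0//.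
    exact: ltW.
  have [m mP mmin] := ex_minnP ex.
  case: m mP mmin => [|m] mP mmin; first by move: mP; rewrite expr0 leNgt Y1.
  exists m.+1; split => //; rewrite exprS ler_pM2l//.
  by rewrite leNgt; apply/negP => /ltW /mmin; rewrite ltnn.
have := H S n u0 S0 n0.
have t2 : C2 * expR S^-1 * nrm u0 * 2^-1 ^+ n <= eps / 2 * nrm u0.
  rewrite mulrAC ler_wpM2r ?snorm_ge0// exprVn ler_pdivrMr ?exprn_gt0//.
  apply: (@le_trans _ _ (eps / 2 * Y)); last by rewrite ler_wpM2l// divr_ge0// ltW.
  have -> : eps / 2 * Y = (C2 + 2^-1) * expR S^-1 by rewrite /Y; field; rewrite gt_eqF.
  by rewrite ler_wpM2r ?expR_ge0// lerDl.
pose Z := expR (C * (1 + S^-1)) / eps `^ p.+1%:R.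
have Z0 : 0 <= Z by rewrite divr_ge0 ?expR_ge0// powR_ge0.
have t1 : 2 * (C1 * 2 ^+ (p * n)) <= Z.
  have k1 : 2 ^+ (p * n) <= (2 * Y) ^+ p.+1.
    apply: (@le_trans _ _ ((2 * Y) ^+ p)).
      by rewrite mulnC exprM; apply: lerXn2r; rewrite ?nnegrE ?exprn_ge0// mulr_ge0// ltW.
    have Y2 : 1 <= 2 * Y by lra.
    by rewrite exprSr ler_peMr// exprn_ge0// (le_trans ler01).
  have -> : Z = D * (expR S^-1) ^+ p.+1 / eps ^+ p.+1 * expR (p.+1%:R + ln D * S^-1).
    rewrite /Z powR_mulrn ?(ltW eps0)// /C.
    have -> : (p.+1%:R + ln D) * (1 + S^-1) = ln D + S^-1 * p.+1%:R + (p.+1%:R + ln D * S^-1) by ring.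
    by rewrite !expRD lnK ?posrE// expRM_natr; ring.
  have w : 1 <= expR (p.+1%:R + ln D * S^-1).
    by rewrite -expR0 ler_expR addr_ge0// mulr_ge0 ?invr_ge0// ltW.
  have z0 : 0 <= D * (expR S^-1) ^+ p.+1 / eps ^+ p.+1.
    have h1 := exprn_ge0 p.+1 (expR_ge0 S^-1); have h2 := exprn_ge0 p.+1 (ltW eps0).
    by rewrite divr_ge0// mulr_ge0// ltW.
  apply: le_trans (ler_peMr z0 w).
  have -> : D * (expR S^-1) ^+ p.+1 / eps ^+ p.+1
    = (1 + 2 * C1) * ((2 + 4 * C2) * expR S^-1 / eps) ^+ p.+1.
    by rewrite /D !exprMn exprVn; ring.
  have YE : (2 + 4 * C2) * expR S^-1 / eps = 2 * Y by rewrite /Y; ring.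
  have C1' : 0 <= 2 * C1 by rewrite mulr_ge0// ltW.
  have C1'' : 2 * C1 <= 1 + 2 * C1 by rewrite lerDr.
  rewrite YE mulrA; apply: (ler_pM C1' _ C1'' k1); exact: exprn_ge0.
move=> Hn.
have t1' : C1 * 2 ^+ (p * n) * nrmw (E S u0) <= Z / 2 * nrmw (E S u0).
  apply: ler_wpM2r; first exact: snorm_ge0.
  by rewrite ler_pdivlMr// mulrC; exact: t1.
have := le_trans Hn (lerD t1' t2).
rewrite [leRHS](_ : _ = (Z * nrmw (E S u0) + eps * nrm u0) / 2); last by field.
set X := nrm (E S u0); set w := nrmw (E S u0); set v := nrm u0 => HX.
rewrite -/Z -!exprMn.
have X0 : 0 <= X by exact: snorm_ge0.
apply: (@le_trans _ _ (((Z * w + eps * v) / 2) ^+ 2)).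
  by apply: lerXn2r; rewrite ?nnegrE// (le_trans X0).
exact: sqr_mean_le.
Qed.

(** * Controllability and its cost *)

Let cutP f g : ip (cut kappa01 f) g = ipw f g := ip_cut kappa01 f g.

Lemma observability_semi C beta S e : 0 < S -> 0 < e ->
  observability kappa E C beta -> forall z,
  nrm (E S z) ^+ 2 <= (expR (C * (1 + S^-1)) / e `^ beta) ^+ 2 * ipw (E S z) (E S z)
    + e ^+ 2 * nrm z ^+ 2.
Proof.
move=> S0 e0 obs z; have := obs S e z S0 e0.
rewrite (L2norm_restr kappa01) (snorm_sqr ipwP) !L2norm_snorm; exact: id.
Qed.

Lemma final_state tau T y0 v (c : R) yT : 0 < tau < T ->
  nrm (mild_solution E tau y0 (restr kappa01 (c *: v)) T - yT)
  = nrm (E T y0 - yT + c *: E (T - tau) (cut kappa01 v)).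
Proof.
move=> /andP[tau0 tauT]; have S0 : 0 <= T - tau by rewrite subr_ge0 ltW.
rewrite /mild_solution (ltW tauT); apply: (weq_snorm ipP) => w.
rewrite -/(cut kappa01 (c *: v)) addrAC !(ipDl ipP); congr (_ + _).
rewrite -(ws_Z ipP EP c _ S0 w); apply: (ws_weq ipP EP S0) => {}w.
by rewrite (ipZl ipP) !cutP (ipZl ipwP).
Qed.

Lemma approx_controllable tau T : 0 < tau < T ->
  approx_impulse_controllable kappa E tau T.
Proof.
move=> tT y0 yT eps eps0; have S0 : 0 < T - tau by case/andP: tT; rewrite subr_gt0.
have [C [beta [C0 b0 obs]]] :=
  orbit_observability.
set e := eps * _; have e0 : 0 < e.
  rewrite mulr_gt0//; case: ifPn => // y0n.
  by rewrite lt_neqAle eq_sym y0n L2norm_snorm snorm_ge0.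
have obsK d : 0 < d -> exists2 K : R, 0 < K & forall z,
    nrm (E (T - tau) z) ^+ 2 <=
    K ^+ 2 * ipw (E (T - tau) z) (E (T - tau) z) + d ^+ 2 * nrm z ^+ 2.
  move=> d0; exists (expR (C * (1 + (T - tau)^-1)) / d `^ beta).
    by rewrite divr_gt0 ?expR_gt0// powR_gt0.
  exact: observability_semi.
have [z [c zc]] := approx_control ipP EP E_symmetric ipwP (ipw_le kappa01) cutP S0
  (yT - E T y0) e0 obsK.
exists (restr kappa01 (c *: E (T - tau) z)); rewrite L2norm_snorm final_state//.
rewrite -(snormN ipP) opprD opprB; exact: zc.
Qed.

(** The control given by duality is admissible only up to an error [d] on the final
state and on its own norm. Apply it with [eps / r] in place of [eps], for [r > 1]:
this leaves room for [d], and increases the constant [K] by the factor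
[a = r `^ beta], chosen close to [1]. *)
Lemma control_cost_le C beta tau T eps : 0 < beta -> observability kappa E C beta ->
  0 < tau < T -> 0 < eps ->
  (control_cost kappa E tau T eps <=
    ((eps `^ beta)^-1 * expR (C * (1 + (T - tau)^-1)))%:E)%E.
Proof.
move=> b0 obs tT eps0; have S0 : 0 < T - tau by case/andP: tT; rewrite subr_gt0.
set K := (_^-1 * _); have K0 : 0 < K by rewrite mulr_gt0 ?expR_gt0// invr_gt0 powR_gt0.
apply: ge_ereal_sup => _ [y0 /= y01 <-]; apply/lee_addgt0Pr => eta eta0.
pose a := 1 + eta / (2 * K); pose r := a `^ beta^-1.
have aK : a * K = K + eta / 2 by rewrite /a; field; rewrite gt_eqF.
have a1 : 1 < a by rewrite /a ltrDl divr_gt0// mulr_gt0.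
have rb : r `^ beta = a by rewrite -powRrM mulVf ?gt_eqF// powRr1// ltW// (lt_trans ltr01).
have r1 : 1 < r.
  have -> : (1 : R) = 1 `^ beta^-1 by rewrite powR1.
  rewrite gt0_ltr_powR ?nnegrE ?invr_gt0//.
  by rewrite ltW// (lt_trans ltr01).
have r0 : 0 < r by exact: lt_trans r1.
have e0 : 0 < eps / r by rewrite divr_gt0.
have e1 : 0 < eps - eps / r by rewrite subr_gt0 ltr_pdivrMr// ltr_pMr.
have K'E : expR (C * (1 + (T - tau)^-1)) / (eps / r) `^ beta = K + eta / 2.
  have rVb : r^-1 `^ beta = a^-1.
    by rewrite -(powR_inv1 (ltW r0)) -powRrM mulrC powRrM rb powR_inv1// ltW// (lt_trans ltr01).
  rewrite powRM ?invr_ge0 ?(ltW eps0) ?(ltW r0)// rVb -aK /K; field.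
  by rewrite !gt_eqF ?powR_gt0// (lt_trans ltr01).
have K'0 : 0 < K + eta / 2 by rewrite addr_gt0// divr_gt0.
pose d := Num.min (eps - eps / r) (eta / 2).
have d0 : 0 < d by rewrite lt_min e1 divr_gt0.
have := observability_semi S0 e0 obs; rewrite K'E => obs'.
have [z [zT zw]] := null_control ipP EP E_symmetric ipwP (ipw_le kappa01) cutP S0
  (E tau y0) K'0 e0 d0 obs'.
have tau0 : 0 <= tau by case/andP: tT => /ltW.
have y0n : nrm (E tau y0) <= 1.
  by rewrite (le_trans (ws_contraction EP _ tau0))// -L2norm_snorm y01.
have d1 : d <= eps - eps / r by rewrite ge_min lexx.
have d2 : d <= eta / 2 by rewrite ge_min lexx orbT.
pose c := - (K + eta / 2) ^+ 2.
have adm : null_controls E tau T eps y0 (restr kappa01 (c *: E (T - tau) z)).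
  suff : L2norm 0 1 (mild_solution E tau y0 (restr kappa01 (c *: E (T - tau) z)) T)
      <= eps * L2norm 0 1 y0 by [].
  rewrite y01 mulr1 L2norm_snorm -[X in nrm X]subr0 final_state//.
  rewrite subr0 scaleNr.
  have -> : nrm (E T y0 - (K + eta / 2) ^+ 2 *: E (T - tau) (cut kappa01 (E (T - tau) z)))
    = nrm (E (T - tau) (E tau y0)
           - (K + eta / 2) ^+ 2 *: E (T - tau) (cut kappa01 (E (T - tau) z))).
    apply: (weq_snorm ipP); apply: (weqB ipP) => // w.
    by rewrite -(ws_D EP _ (ltW S0) tau0 w) subrK.
  rewrite (le_trans zT)//.
  have h : eps / r * nrm (E tau y0) <= eps / r by apply: ler_piMr => //; exact: ltW.
  by rewrite (le_trans (lerD h d1))// addrC subrK.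
apply: (@le_trans _ _ (L2norm 0 kappa (restr kappa01 (c *: E (T - tau) z)))%:E).
  by apply: ereal_inf_lbound; exists (restr kappa01 (c *: E (T - tau) z)).
have -> : L2norm 0 kappa (restr kappa01 (c *: E (T - tau) z))
   = (K + eta / 2) ^+ 2 * nrmw (E (T - tau) z).
  rewrite [LHS](L2norm_restr kappa01 (c *: E (T - tau) z)).
  by rewrite (snormZ ipwP) normrN ger0_norm// sqr_ge0.
rewrite lee_fin (le_trans zw)//.
have h : (K + eta / 2) * nrm (E tau y0) <= K + eta / 2.
  by apply: ler_piMr => //; exact: ltW.
by rewrite (le_trans (lerD h d2))// -addrA -splitr.
Qed.

End Control_of_degenerate_semigroup.

Theorem theorem4p2 (R : realType) (alpha beta0 beta1 kappa : R)
    (E : R -> L2 (0 : R) 1 -> L2 (0 : R) 1)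
    (alpha01 : 0 < alpha < 1)
    (beta_ge0 : 0 <= beta0 * beta1) (beta1_neq0 : beta1 != 0)
    (kappa01 : 0 < kappa < 1)
    (E_semigroup : contraction_semigroup E)
    (E_generator : is_generator (opA alpha beta0 beta1) E) :
  [/\ forall T tau : R, 0 < T -> 0 < tau < T ->
        approx_impulse_controllable kappa E tau T,
      exists C beta : R, [/\ 0 < C, 0 < beta & observability kappa E C beta] &
      forall C beta : R, 0 < C -> 0 < beta -> observability kappa E C beta ->
        forall T tau eps : R, 0 < T -> 0 < tau < T -> 0 < eps ->
          (control_cost kappa E tau T eps <=
            ((eps `^ beta)^-1 * expR (C * (1 + (T - tau)^-1)))%:E)%E ].
Proof.
split.
- by move=> T tau _; exact: (approx_controllable alpha01 beta1_neq0 kappa01 E_semigroup E_generator).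
- exact: (orbit_observability alpha01 beta1_neq0 kappa01 E_semigroup E_generator).
- move=> C beta _ b0 obs T tau eps _ tT eps0.
  exact: (control_cost_le alpha01 beta1_neq0 kappa01 E_semigroup E_generator b0 obs tT eps0).
Qed.
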